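(* Suppose the Centering, Mixing, Factor, Loading, Noise-decomposition, Noise-dynamics and Rate assumptions listed in the context hold for the MEFM. Then, as $T,p,q\to\infty$, for each $t\in[T]$ in the first three lines, \begin{align*} (\widehat\mu_t-\mu_t)^2&=O_P(p^{-1}q^{-1}),\\ p^{-1}\|\widehat{\boldsymbol{\alpha}}_t-\boldsymbol{\alpha}_t\|^2&=O_P(q^{-1}),\\ q^{-1}\|\widehat{\boldsymbol{\beta}}_t-\boldsymbol{\beta}_t\|^2&=O_P(p^{-1}),\\ p^{-1}\|\widehat{\mathbf{Q}}_r-\mathbf{Q}_r\mathbf{H}_r'\|_F^2&=O_P\big(T^{-1}p^{1-2\delta_{r,k_r}}q^{1-2\delta_{c,1}}+p^{-2\delta_{r,k_r}}q^{2(1-\delta_{c,1})}\big),\\ q^{-1}\|\widehat{\mathbf{Q}}_c-\mathbf{Q}_c\mathbf{H}_c'\|_F^2&=O_P\big(T^{-1}q^{1-2\delta_{c,k_c}}p^{1-2\delta_{r,1}}+q^{-2\delta_{c,k_c}}p^{2(1-\delta_{r,1})}\big). \end{align*}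
   Context: Notation: $[m]=\{1,\dots,m\}$; $\mathbf{1}_m$ is the vector of $m$ ones; $\mathbf{M}_m=\mathbf{I}_m-m^{-1}\mathbf{1}_m\mathbf{1}_m'$; $'$ is transpose; $\|\cdot\|$ is the spectral norm (Euclidean norm for vectors), $\|\cdot\|_F$ the Frobenius norm, $\|\mathbf{A}\|_1=\max_j\sum_i|A_{ij}|$; $\circ$ is the Hadamard product; $\mathrm{diag}(\mathbf{A})$ is the diagonal matrix with the diagonal of $\mathbf{A}$; $a\asymp b$ means $a=O(b)$ and $b=O(a)$. Asymptotics are as $T,p,q\to\infty$ with $k_r,k_c$ fixed. Model (MEFM): for $t\in[T]$, the observed $\mathbf{Y}_t\in\mathbb{R}^{p\times q}$ satisfies $$\mathbf{Y}_t=\mu_t\mathbf{1}_p\mathbf{1}_q'+\boldsymbol{\alpha}_t\mathbf{1}_q'+\mathbf{1}_p\boldsymbol{\beta}_t'+\mathbf{C}_t+\mathbf{E}_t,\qquad \mathbf{C}_t=\mathbf{A}_r\mathbf{F}_t\mathbf{A}_c',$$ with scalar $\mu_t$, $\boldsymbol{\alpha}_t\in\mathbb{R}^p$, $\boldsymbol{\beta}_t\in\mathbb{R}^q$, latent core factor $\mathbf{F}_t\in\mathbb{R}^{k_r\times k_c}$, loadings $\mathbf{A}_r\in\mathbb{R}^{p\times k_r}$, $\mathbf{A}_c\in\mathbb{R}^{q\times k_c}$, noise $\mathbf{E}_t\in\mathbb{R}^{p\times q}$. Put $\mathbf{Z}_r=\mathrm{diag}(\mathbf{A}_r'\mathbf{A}_r)$,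 $\mathbf{Z}_c=\mathrm{diag}(\mathbf{A}_c'\mathbf{A}_c)$, $\mathbf{Q}_r=\mathbf{A}_r\mathbf{Z}_r^{-1/2}$, $\mathbf{Q}_c=\mathbf{A}_c\mathbf{Z}_c^{-1/2}$, $\mathbf{F}_{Z,t}=\mathbf{Z}_r^{1/2}\mathbf{F}_t\mathbf{Z}_c^{1/2}$. Assumptions. Centering: for every $t$, $\mathbf{1}_p'\boldsymbol{\alpha}_t=\mathbf{1}_q'\boldsymbol{\beta}_t=0$, $\mathbf{1}_p'\mathbf{A}_r=\mathbf{0}$, $\mathbf{1}_q'\mathbf{A}_c=\mathbf{0}$. Mixing: the elements of $\mathrm{vec}(\mathbf{F}_t)$ and $\mathrm{vec}(\mathbf{E}_t)$ are $\alpha$-mixing, where a process $\{\mathbf{x}_t\}$ is $\alpha$-mixing if for some $\gamma>2$, $\sum_{h\ge1}\alpha(h)^{1-2/\gamma}<\infty$, with $\alpha(h)=\sup_\tau\sup_{A\in\mathcal{H}_{-\infty}^\tau,B\in\mathcal{H}_{\tau+h}^\infty}|\mathbb{P}(A\cap B)-\mathbb{P}(A)\mathbb{P}(B)|$ and $\mathcal{H}_\tau^s$ the $\sigma$-field generated by $\{\mathbf{x}_t:\tau\le t\le s\}$. Factor: $\mathbf{F}_t=\sum_{w\ge0}a_{f,w}\mathbf{X}_{f,t-w}$, where $\{\mathbf{X}_{f,t}\}$ (same dimension as $\mathbf{F}_t$) has i.i.d. elements with mean $0$, variance $1$ and uniformly bounded fourth moments; $\sum_{w\ge0}a_{f,w}^2=1$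 and $\sum_{w\ge0}|a_{f,w}|\le c$ for a constant $c$. Loading: $\mathbf{A}_r,\mathbf{A}_c$ are of full rank and independent of the factor and error series. As $p,q\to\infty$, $\mathbf{Z}_r^{-1/2}\mathbf{A}_r'\mathbf{A}_r\mathbf{Z}_r^{-1/2}\to\boldsymbol{\Sigma}_{A,r}$ and $\mathbf{Z}_c^{-1/2}\mathbf{A}_c'\mathbf{A}_c\mathbf{Z}_c^{-1/2}\to\boldsymbol{\Sigma}_{A,c}$, both positive definite with eigenvalues bounded away from $0$ and infinity; $(\mathbf{Z}_r)_{jj}\asymp p^{\delta_{r,j}}$, $j\in[k_r]$, $1/2<\delta_{r,k_r}\le\dots\le\delta_{r,1}\le1$; $(\mathbf{Z}_c)_{jj}\asymp q^{\delta_{c,j}}$, $j\in[k_c]$, $1/2<\delta_{c,k_c}\le\dots\le\delta_{c,1}\le1$. Noise-decomposition: $\mathbf{E}_t=\mathbf{A}_{e,r}\mathbf{F}_{e,t}\mathbf{A}_{e,c}'+\boldsymbol{\Sigma}_\epsilon\circ\boldsymbol{\epsilon}_t$, where $\mathbf{F}_{e,t}\in\mathbb{R}^{k_{e,r}\times k_{e,c}}$ and $\boldsymbol{\epsilon}_t\in\mathbb{R}^{p\times q}$ each have independent elements with mean $0$ and variance $1$, $\{\boldsymbol{\epsilon}_t\}$ is independent of $\{\mathbf{F}_{e,t}\}$, the (standard deviation) matrix $\boldsymbol{\Sigma}_\epsilon$ has elements uniformly bounded away from $0$ and infinity, $\|\mathbf{A}_{e,r}\|_1,\|\mathbf{A}_{e,c}\|_1=O(1)$,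 and $k_{e,r},k_{e,c}=O(1)$. Noise-dynamics: $\mathbf{F}_{e,t}=\sum_{w\ge0}a_{e,w}\mathbf{X}_{e,t-w}$, $\boldsymbol{\epsilon}_t=\sum_{w\ge0}a_{\epsilon,w}\mathbf{X}_{\epsilon,t-w}$, with $\{\mathbf{X}_{e,t}\},\{\mathbf{X}_{\epsilon,t}\}$ independent of each other and of $\{\mathbf{X}_{f,t}\}$, each having independent elements with mean $0$, variance $1$ and uniformly bounded fourth moments; $\sum a_{e,w}^2=\sum a_{\epsilon,w}^2=1$, $\sum|a_{e,w}|,\sum|a_{\epsilon,w}|\le c$. Rate: $T^{-1}p^{2(1-\delta_{r,k_r})}q^{1-2\delta_{c,1}}$, $p^{1-2\delta_{r,k_r}}q^{2(1-\delta_{c,1})}$, $T^{-1}q^{2(1-\delta_{c,k_c})}p^{1-2\delta_{r,1}}$, $q^{1-2\delta_{c,k_c}}p^{2(1-\delta_{r,1})}$ are all $o(1)$. Estimators. $\widehat\mu_t=\mathbf{1}_p'\mathbf{Y}_t\mathbf{1}_q/(pq)$, $\widehat{\boldsymbol{\alpha}}_t=q^{-1}\mathbf{Y}_t\mathbf{1}_q-\widehat\mu_t\mathbf{1}_p$, $\widehat{\boldsymbol{\beta}}_t=p^{-1}\mathbf{Y}_t'\mathbf{1}_p-\widehat\mu_t\mathbf{1}_q$, $\widehat{\mathbf{L}}_t=\mathbf{M}_p\mathbf{Y}_t\mathbf{M}_q$. $\widehat{\mathbf{Q}}_r$ (resp. $\widehat{\mathbf{Q}}_c$) has as columns the orthonormal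 eigenvectors of $T^{-1}\sum_t\widehat{\mathbf{L}}_t\widehat{\mathbf{L}}_t'$ (resp. $T^{-1}\sum_t\widehat{\mathbf{L}}_t'\widehat{\mathbf{L}}_t$) for its $k_r$ (resp. $k_c$) largest eigenvalues, and $\widehat{\mathbf{D}}_r$ (resp. $\widehat{\mathbf{D}}_c$) is the diagonal matrix of those eigenvalues. Finally $\mathbf{H}_r=T^{-1}\widehat{\mathbf{D}}_r^{-1}\widehat{\mathbf{Q}}_r'\mathbf{Q}_r\sum_{t=1}^T\mathbf{F}_{Z,t}\mathbf{Q}_c'\mathbf{Q}_c\mathbf{F}_{Z,t}'$ and $\mathbf{H}_c=T^{-1}\widehat{\mathbf{D}}_c^{-1}\widehat{\mathbf{Q}}_c'\mathbf{Q}_c\sum_{t=1}^T\mathbf{F}_{Z,t}'\mathbf{Q}_r'\mathbf{Q}_r\mathbf{F}_{Z,t}$. *)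

(* Defs.v *)
From HB Require Import structures.
From mathcomp Require Import all_boot all_order all_algebra.
From mathcomp Require Import all_classical all_reals all_analysis.
Set Implicit Arguments.
Unset Strict Implicit.
Unset Printing Implicit Defensive.
Import Order.TTheory GRing.Theory Num.Theory.
Import numFieldNormedType.Exports.
Local Open Scope classical_set_scope.
Local Open Scope ring_scope.

Section Matrices.
Variable R : realType.

Definition ones (m : nat) : 'cV[R]_m := const_mx 1.

(* M_m = I_m - m^-1 1_m 1_m' *)
Definition centering_mx (m : nat) : 'M[R]_m :=
  1%:M - m%:R^-1 *: (ones m *m (ones m)^T).

Definition hadamard (m n : nat) (A B : 'M[R]_(m, n)) : 'M[R]_(m, n) :=
  map2_mx *%R A B.

(* Frobenius norm; on column vectors it is the Euclidean norm.  (The norm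
   `|A| that the library puts on matrices is the maximum of the entries.) *)
Definition normF (m n : nat) (A : 'M[R]_(m, n)) : R :=
  Num.sqrt (\sum_i \sum_j A i j ^+ 2).

(* ||A||_1 = max_j sum_i |A_ij| *)
Definition norm1 (m n : nat) (A : 'M[R]_(m, n)) : R :=
  \big[Num.max/0]_j \sum_i `|A i j|.

Definition pos_def (k : nat) (S : 'M[R]_k) : Prop :=
  S^T = S /\ forall v : 'cV[R]_k, v != 0 -> 0 < (v^T *m S *m v) 0 0.

(* The diagonal of Z = diag(A'A), then Z^{1/2} and Z^{-1/2}. *)
Definition Zdiag (m k : nat) (A : 'M[R]_(m, k)) : 'rV[R]_k :=
  \row_j (A^T *m A) j j.
Definition Zhalf (m k : nat) (A : 'M[R]_(m, k)) : 'M[R]_k :=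
  diag_mx (map_mx Num.sqrt (Zdiag A)).
Definition Zhalf_inv (m k : nat) (A : 'M[R]_(m, k)) : 'M[R]_k :=
  diag_mx (map_mx (fun x => (Num.sqrt x)^-1) (Zdiag A)).

(* The columns of Q are orthonormal eigenvectors of S, with eigenvalues D,
   for the k largest eigenvalues of S counted with multiplicity: s lists the
   whole spectrum in decreasing order and D is a rearrangement of its first
   k entries.  Signs, the order of the columns and the basis chosen in a
   multiple eigenspace are left free. *)
Definition leading_eigen (m k : nat) (S : 'M[R]_m)
    (Q : 'M[R]_(m, k)) (D : 'rV[R]_k) : Prop :=
  [/\ Q^T *m Q = 1%:M,
      S *m Q = Q *m diag_mx D &
      exists s : seq R,
        [/\ sorted (fun x y => y <= x) s,
            char_poly S = \prod_(x <- s) ('X - x%:P) &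
            perm_eq [seq D 0 j | j <- enum 'I_k] (take k s)]].

(* a_n = O(b_n) and b_n = O(a_n) *)
Definition asymp (a b : nat -> R) : Prop :=
  ((a : nat -> R^o) =O_\oo (b : nat -> R^o)) /\
  ((b : nat -> R^o) =O_\oo (a : nat -> R^o)).

End Matrices.

Section Probability.
Context {R : realType} {d : measure_display} {Om : measurableType d}.
Variable P : probability Om R.

Definition indep_systems (G1 G2 : set (set Om)) : Prop :=
  forall A B, G1 A -> G2 B -> P (A `&` B) = (P A * P B)%E.

Definition indep_family (I : choiceType) (X : I -> Om -> R) : Prop :=
  forall (s : seq I) (B : I -> set R), uniq s ->
    (forall i, measurable (B i)) ->
    P (\bigcap_(i in [set` s]) (X i @^-1` B i)) =
    (\prod_(i <- s) P (X i @^-1` B i))%E.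

Definition random_mx (m n : nat) (x : Om -> 'M[R]_(m, n)) : Prop :=
  forall i j, measurable_fun setT (fun w => x w i j).

(* Events determined by one entry of a random matrix, or by one entry at one
   time of a matrix process; <<s _ >> of these are the generated
   sigma-algebras. *)
Definition gen_mx (m n : nat) (x : Om -> 'M[R]_(m, n)) : set (set Om) :=
  \bigcup_i \bigcup_j
    preimage_set_system setT (fun w => x w i j) measurable.
Definition gen_proc (m n : nat) (x : int -> Om -> 'M[R]_(m, n)) :
    set (set Om) :=
  \bigcup_t gen_mx (x t).

Definition entries (m n : nat) (x : int -> Om -> 'M[R]_(m, n)) :
    int * 'I_m * 'I_n -> Om -> R :=
  fun k w => x k.1.1 w k.1.2 k.2.

Definition standardized (m n : nat) (x : int -> Om -> 'M[R]_(m, n)) : Prop :=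
  forall k, ('E_P[entries x k] = 0 /\ 'V_P[entries x k] = 1)%E.

Definition fourth_moments_le (C : R) (m n : nat)
    (x : int -> Om -> 'M[R]_(m, n)) : Prop :=
  forall k, ('E_P[fun w => (entries x k w ^+ 4)%R] <= C%:E)%E.

Definition identically_distributed (I : Type) (X : I -> Om -> R) : Prop :=
  forall i j (B : set R), measurable B -> P (X i @^-1` B) = P (X j @^-1` B).

(* F_t = sum_(w >= 0) a_w X_(t-w), almost surely *)
Definition linear_process (a : nat -> R) (m n : nat)
    (X F : int -> Om -> 'M[R]_(m, n)) : Prop :=
  forall t, {ae P, forall w : Om,
    (\sum_(0 <= k < N) a k *: X (t - k%:Z) w) @[N --> \oo] --> F t w}.

Definition filter_coefs (a : nat -> R) : Prop :=
  (\sum_(0 <= k < N) a k ^+ 2) @[N --> \oo] --> (1 : R) /\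
  exists c : R, forall N, \sum_(0 <= k < N) `|a k| <= c.

Definition sigma_window d' (S : measurableType d') (x : int -> Om -> S)
    (D : set int) : set (set Om) :=
  <<s \bigcup_(t in D) preimage_set_system setT (x t) measurable >>.

Definition mixing_coef d' (S : measurableType d') (x : int -> Om -> S)
    (h : nat) : R :=
  sup [set r | exists (tau : int) (A B : set Om),
    [/\ sigma_window x [set t | t <= tau] A,
        sigma_window x [set t | tau + h%:Z <= t] B &
        r = `|fine (P (A `&` B)) - fine (P A) * fine (P B)|]].

Definition alpha_mixing d' (S : measurableType d') (x : int -> Om -> S) :
    Prop :=
  exists2 g : R, 2 < g &
    (\sum_(1 <= h <oo) (mixing_coef x h `^ (1 - 2 / g))%:E < +oo)%E.

(* X_n = O_P(r_n).  Probabilities of {|X_n| > M r_n} are read as outer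
   probabilities, which are the usual ones when X_n is measurable: an
   arbitrary choice of eigenvectors need not depend measurably on the data. *)
Definition stochO (X : nat -> Om -> R) (r : nat -> R) : Prop :=
  forall eps : R, 0 < eps -> exists2 M : R, 0 < M &
    \forall n \near \oo, exists B : set Om,
      [/\ measurable B, (P B <= eps%:E)%E &
          [set w | M * r n < `|X n w|] `<=` B].

End Probability.

(* The model along a sequence (T_n, p_n, q_n), n = 0, 1, 2, ...: the numbers
   of factors kr, kc, the factor process and the linear filters do not depend
   on n; the other ingredients form arrays.  Time ranges over int, the sample
   being t = 1, ..., T_n.  The main effects may be deterministic or random. *)
Record mefm (R : realType) (d : measure_display) (Om : measurableType d)
    (kr kc : nat) := MEFM {
  nT : nat -> nat;
  np : nat -> nat;
  nq : nat -> nat;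
  mu : nat -> nat -> Om -> R;
  alpha : forall n, nat -> Om -> 'cV[R]_(np n);
  beta : forall n, nat -> Om -> 'cV[R]_(nq n);
  Ar : forall n, Om -> 'M[R]_(np n, kr);
  Ac : forall n, Om -> 'M[R]_(nq n, kc);
  F : int -> Om -> 'M[R]_(kr, kc);
  E : forall n, int -> Om -> 'M[R]_(np n, nq n);
  a_f : nat -> R;
  Xf : int -> Om -> 'M[R]_(kr, kc);
  k_er : nat -> nat;
  k_ec : nat -> nat;
  Aer : forall n, 'M[R]_(np n, k_er n);
  Aec : forall n, 'M[R]_(nq n, k_ec n);
  Sigma_eps : forall n, 'M[R]_(np n, nq n);
  Fe : forall n, int -> Om -> 'M[R]_(k_er n, k_ec n);
  eps : forall n, int -> Om -> 'M[R]_(np n, nq n);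
  a_e : nat -> R;
  a_eps : nat -> R;
  Xe : forall n, int -> Om -> 'M[R]_(k_er n, k_ec n);
  Xeps : forall n, int -> Om -> 'M[R]_(np n, nq n)
}.

Section Model.
Context {R : realType} {d : measure_display} {Om : measurableType d}.
Context {kr kc : nat}.
Variables (P : probability Om R) (m : mefm R Om kr kc).

Definition C n (t : nat) (w : Om) : 'M[R]_(np m n, nq m n) :=
  Ar m n w *m F m t%:Z w *m (Ac m n w)^T.

Definition Y n (t : nat) (w : Om) : 'M[R]_(np m n, nq m n) :=
  mu m n t w *: (ones R (np m n) *m (ones R (nq m n))^T)
  + alpha m n t w *m (ones R (nq m n))^T
  + ones R (np m n) *m (beta m n t w)^T
  + C n t w + E m n t%:Z w.

Definition Qr n w : 'M[R]_(np m n, kr) := Ar m n w *m Zhalf_inv (Ar m n w).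
Definition Qc n w : 'M[R]_(nq m n, kc) := Ac m n w *m Zhalf_inv (Ac m n w).
Definition FZ n (t : nat) w : 'M[R]_(kr, kc) :=
  Zhalf (Ar m n w) *m F m t%:Z w *m Zhalf (Ac m n w).

Definition assume_centering : Prop :=
  forall n, {ae P, forall w : Om,
    [/\ forall t, (1 <= t <= nT m n)%N ->
          (ones R (np m n))^T *m alpha m n t w = 0 /\
          (ones R (nq m n))^T *m beta m n t w = 0,
        (ones R (np m n))^T *m Ar m n w = 0 &
        (ones R (nq m n))^T *m Ac m n w = 0]}.

Definition assume_mixing : Prop :=
  (forall i j, alpha_mixing P (fun t w => F m t w i j)) /\
  (forall n i j, alpha_mixing P (fun t w => E m n t w i j)).

Definition assume_factor : Prop :=
  [/\ forall t, random_mx (Xf m t) /\ random_mx (F m t),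
      linear_process P (a_f m) (Xf m) (F m),
      indep_family P (entries (Xf m)) /\
        identically_distributed P (entries (Xf m)),
      standardized P (Xf m) /\ (exists c, fourth_moments_le P c (Xf m)) &
      filter_coefs (a_f m)].

Definition loading_strength (k : nat) (sz : nat -> nat)
    (A : forall n, Om -> 'M[R]_(sz n, k)) (delta : nat -> R) : Prop :=
  [/\ forall n, random_mx (A n) /\
        {ae P, forall w : Om, \rank (A n w) = minn (sz n) k},
      exists S : 'M[R]_k,
        [/\ pos_def S,
            exists lo hi : R, 0 < lo /\
              forall l, eigenvalue S l -> lo <= l <= hi &
            {ae P, forall w : Om,
              (Zhalf_inv (A n w) *m (A n w)^T *m A n w *m Zhalf_inv (A n w))
                @[n --> \oo] --> S}],
      (* delta j is the exponent of the j-th diagonal entry, 1 <= j <= k *)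
      forall j : 'I_k, {ae P, forall w : Om,
        asymp (fun n => Zdiag (A n w) 0 j)
              (fun n => (sz n)%:R `^ delta j.+1)} &
      [/\ 1 / 2 < delta k,
          forall i j, (1 <= i <= j)%N -> (j <= k)%N -> delta j <= delta i &
          delta 1%N <= 1]].

Definition assume_loading (dr dc : nat -> R) : Prop :=
  [/\ loading_strength (Ar m) dr,
      loading_strength (Ac m) dc &
      forall n, indep_systems P
        <<s gen_mx (Ar m n) `|` gen_mx (Ac m n) >>
        <<s gen_proc (F m) `|` gen_proc (E m n) >>].

Definition assume_noise_decomposition : Prop :=
  [/\ forall n t, [/\ random_mx (E m n t), random_mx (Fe m n t) &
                      random_mx (eps m n t)],
      forall n t, {ae P, forall w : Om,
        E m n t w = Aer m n *m Fe m n t w *m (Aec m n)^T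
                    + hadamard (Sigma_eps m n) (eps m n t w)},
      forall n,
        [/\ standardized P (Fe m n), standardized P (eps m n),
            forall t, indep_family P (fun ij w => Fe m n t w ij.1 ij.2) /\
                      indep_family P (fun ij w => eps m n t w ij.1 ij.2) &
            indep_systems P <<s gen_proc (eps m n) >> <<s gen_proc (Fe m n) >>],
      exists lo hi : R, 0 < lo /\
        forall n i j, lo <= Sigma_eps m n i j <= hi &
      [/\ (fun n => norm1 (Aer m n) : R^o) =O_\oo (fun=> 1 : R^o),
          (fun n => norm1 (Aec m n) : R^o) =O_\oo (fun=> 1 : R^o),
          (fun n => (k_er m n)%:R : R^o) =O_\oo (fun=> 1 : R^o) &
          (fun n => (k_ec m n)%:R : R^o) =O_\oo (fun=> 1 : R^o)]].

Definition assume_noise_dynamics : Prop :=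
  [/\ forall n, [/\ forall t, random_mx (Xe m n t) /\ random_mx (Xeps m n t),
          linear_process P (a_e m) (Xe m n) (Fe m n) &
          linear_process P (a_eps m) (Xeps m n) (eps m n)],
      (* mutual independence of the three innovation processes *)
      forall n,
        indep_systems P <<s gen_proc (Xe m n) >> <<s gen_proc (Xeps m n) >> /\
        indep_systems P <<s gen_proc (Xe m n) `|` gen_proc (Xeps m n) >>
          <<s gen_proc (Xf m) >>,
      forall n,
        [/\ indep_family P (entries (Xe m n)),
            indep_family P (entries (Xeps m n)),
            standardized P (Xe m n) & standardized P (Xeps m n)],
      exists c, forall n,
        fourth_moments_le P c (Xe m n) /\ fourth_moments_le P c (Xeps m n) &
      filter_coefs (a_e m) /\ filter_coefs (a_eps m)].

Local Notation Tn n := ((nT m n)%:R : R).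
Local Notation pn n := ((np m n)%:R : R).
Local Notation qn n := ((nq m n)%:R : R).

Definition assume_rate (dr dc : nat -> R) : Prop :=
  [/\ ((Tn n)^-1 * pn n `^ (2 * (1 - dr kr)) * qn n `^ (1 - 2 * dc 1%N))
        @[n --> \oo] --> (0 : R),
      (pn n `^ (1 - 2 * dr kr) * qn n `^ (2 * (1 - dc 1%N)))
        @[n --> \oo] --> (0 : R),
      ((Tn n)^-1 * qn n `^ (2 * (1 - dc kc)) * pn n `^ (1 - 2 * dr 1%N))
        @[n --> \oo] --> (0 : R) &
      (qn n `^ (1 - 2 * dc kc) * pn n `^ (2 * (1 - dr 1%N)))
        @[n --> \oo] --> (0 : R)].

Definition mu_hat n t w : R :=
  ((ones R (np m n))^T *m Y n t w *m ones R (nq m n)) 0 0 / (pn n * qn n).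

Definition alpha_hat n t w : 'cV[R]_(np m n) :=
  (qn n)^-1 *: (Y n t w *m ones R (nq m n)) - mu_hat n t w *: ones R (np m n).

Definition beta_hat n t w : 'cV[R]_(nq m n) :=
  (pn n)^-1 *: ((Y n t w)^T *m ones R (np m n))
  - mu_hat n t w *: ones R (nq m n).

Definition L_hat n t w : 'M[R]_(np m n, nq m n) :=
  centering_mx R (np m n) *m Y n t w *m centering_mx R (nq m n).

Definition Sr_hat n w : 'M[R]_(np m n) :=
  (Tn n)^-1 *: \sum_(1 <= t < (nT m n).+1) L_hat n t w *m (L_hat n t w)^T.

Definition Sc_hat n w : 'M[R]_(nq m n) :=
  (Tn n)^-1 *: \sum_(1 <= t < (nT m n).+1) (L_hat n t w)^T *m L_hat n t w.

Definition Hr n w (Q : 'M[R]_(np m n, kr)) (D : 'rV[R]_kr) : 'M[R]_kr :=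
  (Tn n)^-1 *: (invmx (diag_mx D) *m Q^T *m Qr n w *m
    \sum_(1 <= t < (nT m n).+1)
      FZ n t w *m (Qc n w)^T *m Qc n w *m (FZ n t w)^T).

Definition Hc n w (Q : 'M[R]_(nq m n, kc)) (D : 'rV[R]_kc) : 'M[R]_kc :=
  (Tn n)^-1 *: (invmx (diag_mx D) *m Q^T *m Qc n w *m
    \sum_(1 <= t < (nT m n).+1)
      (FZ n t w)^T *m (Qr n w)^T *m Qr n w *m FZ n t w).

End Model.

Arguments Hr {R d Om kr kc} m n w Q D.
Arguments Hc {R d Om kr kc} m n w Q D.

(* Main.v *)
Require Import Defs.
From HB Require Import structures.
From mathcomp Require Import all_boot all_order all_algebra.
From mathcomp Require Import all_classical all_reals all_analysis measurable_realfun.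
From mathcomp.real_closed Require complex.
From mathcomp Require Import ring lra zify.
Set Implicit Arguments.
Unset Strict Implicit.
Unset Printing Implicit Defensive.
Import Order.TTheory GRing.Theory Num.Theory.
Import numFieldNormedType.Exports.
Local Open Scope classical_set_scope.
Local Open Scope ring_scope.

(* By centering, the errors of mu, alpha and beta are averages of the noise
   E_t, and sums of squares of linear combinations of E_t are bounded in mean.

   For the loadings let S = T^-1 sum_t L_t L_t', where centering gives
   L_t = C_t + M E_t M. Since S Qhat = Qhat D, one has
     Qhat - Qr Hr' = (S - T^-1 sum_t C_t C_t') Qhat D^-1,
   so it suffices to bound two residuals above and D below.
   - Pure noise: |T^-1 sum_t E_t E_t'|_F^2 = O_P(p q^2 + p^2 q / T), by
     orthogonality of products of distinct innovations off the diagonal and a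
     crude Cauchy-Schwarz bound for the rest.
   - Cross terms: conditionally on the loadings, a second moment computation
     gives |T^-1 sum_t F_t Ac' E_t'|_F^2 = O_P(p q / T).
   - D: by Courant-Fischer it suffices to bound the quadratic form of S below
     on the column space of Ar, where the law of large numbers for F_t and the
     strength of the loadings give D >= const p^{dr kr} q^{dc 1}.
   The statement on the columns is the one on the rows for Y_t'. *)

(** * Mean squares *)

(** Mean squares are the common currency. The filters are infinite, the loadings are random without
    moment assumptions, and the eigenvectors need not be measurable. So every random quantity is
    reduced to linear or bilinear forms in innovations at fixed lags, where orthogonality gives the
    mean square, and the lags are then summed with the l1 norms of the filters. Markov's inequality
    turns the mean squares into events, and a deterministic inequality is applied on their
    intersection: the estimators themselves are never integrated.

    With [alp] = p^{dr kr} and [bet] = q^{dc 1}, the quotient of p q^2 + p^2 q / T by (alp bet)^2 is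
    exactly the sum of the first two expressions of the Rate assumption. That assumption thus says
    that the noise Gram matrix, even in Frobenius norm, is negligible against the eigenvalues, whose
    lower bound is of order alp bet. In that lower bound the cross terms are absorbed by |a - b|^2
    <= 2|a|^2 + 2|b|^2, so only the pure noise has to be small there. *)

Lemma weighted_CS (R : realFieldType) (I : Type) (s : seq I) (w x y : I -> R) :
  (forall i, 0 <= w i) ->
  (\sum_(i <- s) w i * x i * y i) ^+ 2 <=
  (\sum_(i <- s) w i * x i ^+ 2) * (\sum_(i <- s) w i * y i ^+ 2).
Proof.
move=> w0; elim: s => [|i s IH]; first by rewrite !big_nil expr0n /= mulr0.
rewrite !big_cons.
set D := \sum_(_ <- _) _ in IH *; set A := \sum_(_ <- _) _ in IH *.
set B := \sum_(_ <- _) _ in IH *.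
have A0 : 0 <= A by apply: sumr_ge0 => j _; rewrite mulr_ge0 ?sqr_ge0.
have B0 : 0 <= B by apply: sumr_ge0 => j _; rewrite mulr_ge0 ?sqr_ge0.
(* The mixed term of the induction step: squared, it follows from [D ^+ 2 <= A * B] and the
   arithmetic-geometric mean inequality. A negative left side needs no squaring. *)
have key : 2 * D * (x i * y i) <= A * y i ^+ 2 + B * x i ^+ 2.
  have S0 : 0 <= A * y i ^+ 2 + B * x i ^+ 2.
    by rewrite addr_ge0 // mulr_ge0 ?sqr_ge0.
  case: (lerP 0 (2 * D * (x i * y i))) => [h0|h0]; last exact: le_trans (ltW h0) S0.
  rewrite -ler_sqr ?nnegrE //.
  apply: (@le_trans _ _ (4 * (A * B) * (x i * y i) ^+ 2)).
    rewrite exprMn exprMn.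
    have -> : 2 ^+ 2 = 4 :> R by ring.
    by apply: ler_wpM2r; [exact: sqr_ge0|apply: ler_wpM2l IH].
  rewrite -subr_ge0.
  have -> : (A * y i ^+ 2 + B * x i ^+ 2) ^+ 2 - 4 * (A * B) * (x i * y i) ^+ 2 =
    (A * y i ^+ 2 - B * x i ^+ 2) ^+ 2 by ring.
  exact: sqr_ge0.
have := w0 i; move: (w i) key IH => v key IH v0.
rewrite -subr_ge0.
have -> : (v * x i ^+ 2 + A) * (v * y i ^+ 2 + B) - (v * x i * y i + D) ^+ 2 =
  (A * B - D ^+ 2) + v * (A * y i ^+ 2 + B * x i ^+ 2 - 2 * D * (x i * y i)).
  by ring.
by rewrite addr_ge0 ?mulr_ge0 // subr_ge0.
Qed.

Lemma sum_CS (R : realFieldType) (I : Type) (s : seq I) (x y : I -> R) :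
  (\sum_(i <- s) x i * y i) ^+ 2 <=
  (\sum_(i <- s) x i ^+ 2) * (\sum_(i <- s) y i ^+ 2).
Proof.
have := @weighted_CS R I s (fun=> 1) x y (fun=> ler01).
by under eq_bigr do rewrite mul1r; under [X in _ <= X * _]eq_bigr do rewrite mul1r;
  under [X in _ <= _ * X]eq_bigr do rewrite mul1r.
Qed.

(** Cauchy-Schwarz with weights [|a i|] applied to the signs of [a] and to [u]. Only the l1 norm of
    [a] appears, which is what the assumptions bound for a filter, and the number of terms is
    irrelevant. *)
Lemma sqr_sum_le (R : realFieldType) (I : Type) (s : seq I) (a u : I -> R) :
  (\sum_(i <- s) a i * u i) ^+ 2 <=
  (\sum_(i <- s) `|a i|) * (\sum_(i <- s) `|a i| * u i ^+ 2).
Proof.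
have h := @weighted_CS R I s (fun i => `|a i|) (fun i => Num.sg (a i)) u
  (fun i => normr_ge0 _).
apply: le_trans (le_trans h _).
  by under [X in _ <= X ^+ 2]eq_bigr do rewrite [_ * Num.sg _]mulrC -numEsg.
apply: ler_wpM2r; first by apply: sumr_ge0 => i _; rewrite mulr_ge0 ?sqr_ge0.
apply: ler_sum => i _; rewrite sqr_sg; case: (_ != _); rewrite ?mulr1 ?mulr0 //.
Qed.

Section MeanSquare.
Context {R : realType} {d : measure_display} {Om : measurableType d}.
Variable P : probability Om R.
Implicit Types f g : Om -> R.

(** Measurability travels with the bound, so that a real [K] alone gives square integrability of [f]
    and integrability of products. *)
Definition msq_le f (K : R) : Prop :=
  measurable_fun setT f /\ (\int[P]_w ((f w) ^+ 2)%:E <= K%:E)%E.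

Lemma msq_le_ge0 {f K} : msq_le f K -> 0 <= K.
Proof.
move=> [_ h]; rewrite -lee_fin; apply: le_trans h.
by apply: integral_ge0 => w _; rewrite lee_fin sqr_ge0.
Qed.

Lemma measurable_sqE f : measurable_fun setT f ->
  measurable_fun setT (fun w => ((f w) ^+ 2)%:E).
Proof. by move=> mf; apply/measurable_EFinP; exact: measurable_funX. Qed.

Lemma msq_le_trans f K L : msq_le f K -> K <= L -> msq_le f L.
Proof. by move=> [mf h] KL; split => //; apply: le_trans h _; rewrite lee_fin. Qed.

Lemma msq_le_ae f g K : measurable_fun setT f ->
  {ae P, forall w, f w = g w} -> msq_le g K -> msq_le f K.
Proof.
move=> mf fg [mg h]; split => //.
rewrite (@ge0_ae_eq_integral _ _ _ P setT _ (fun w => ((g w) ^+ 2)%:E)) //.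
- exact: measurable_sqE.
- exact: measurable_sqE.
- by move=> w _; rewrite lee_fin sqr_ge0.
- by move=> w _; rewrite lee_fin sqr_ge0.
- by apply: filterS fg => w /= -> _.
Qed.

Lemma ge0_integral_le f K : measurable_fun setT f -> (forall w, 0 <= f w) ->
  (\int[P]_w (f w)%:E <= K%:E)%E -> P.-integrable setT (EFin \o f).
Proof.
move=> mf f0 h; apply/integrableP; split; first exact/measurable_EFinP.
under eq_integral do rewrite /= ger0_norm //.
by apply: le_lt_trans h _; rewrite ltry.
Qed.

Lemma msq_le_integrable_sqr {f K} : msq_le f K ->
  P.-integrable setT (EFin \o (fun w => f w ^+ 2)).
Proof.
move=> [mf h]; apply: (@ge0_integral_le _ K) => //; first exact: measurable_funX.
by move=> w; exact: sqr_ge0.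
Qed.

Lemma msq_le_integrable_mul f g K L : msq_le f K -> msq_le g L ->
  P.-integrable setT (EFin \o (fun w => f w * g w)).
Proof.
move=> hf hg; have [mf _] := hf; have [mg _] := hg.
have := integrableD measurableT (msq_le_integrable_sqr hf) (msq_le_integrable_sqr hg).
apply: le_integrable => //.
  by apply/measurable_EFinP; exact: measurable_funM.
move=> w _; rewrite /= lee_fin ler_norml.
rewrite [X in _ <= _ <= X]ger0_norm ?[X in - X <= _ <= _]ger0_norm ?addr_ge0 ?sqr_ge0 //.
by apply/andP; split; rewrite -subr_ge0; nra.
Qed.

Lemma msq_le_integrable f K : msq_le f K -> P.-integrable setT (EFin \o f).
Proof.
move=> hf.
have h1 : msq_le (fun=> 1) 1.
  split; first exact: measurable_cst.
  under eq_integral do rewrite expr1n.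
  by rewrite integral_cst //= probability_setT mule1.
have := msq_le_integrable_mul hf h1.
by apply: eq_integrable => // w _ /=; rewrite mulr1.
Qed.

Lemma msq_leZ c f K : msq_le f K -> msq_le (fun w => c * f w) (c ^+ 2 * K).
Proof.
move=> [mf h]; split; first exact: measurable_funM.
under eq_integral do rewrite exprMn EFinM.
rewrite ge0_integralZl_EFin ?sqr_ge0 //.
- by rewrite [leRHS]EFinM; apply: lee_wpmul2l => //; rewrite lee_fin sqr_ge0.
- by move=> w _; rewrite lee_fin sqr_ge0.
- exact: measurable_sqE.
Qed.

Lemma msq_le_integral f (K : R) (g : Om -> R) : measurable_fun setT f ->
  measurable_fun setT g -> (forall w, f w ^+ 2 <= g w) ->
  (\int[P]_w (g w)%:E <= K%:E)%E -> msq_le f K.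
Proof.
move=> mf mg fg h; split => //; apply: le_trans h; apply: ge0_le_integral => //.
- by move=> w _; rewrite lee_fin sqr_ge0.
- exact: measurable_sqE.
- exact/measurable_EFinP.
- by move=> w _; rewrite lee_fin.
Qed.

Lemma integral_sum_le (I : Type) (s : seq I) (a : I -> R) (h : I -> Om -> R)
    (K : I -> R) :
  (forall i, 0 <= a i) -> (forall i, measurable_fun setT (h i)) ->
  (forall i w, 0 <= h i w) -> (forall i, \int[P]_w (h i w)%:E <= (K i)%:E)%E ->
  (\int[P]_w (\sum_(i <- s) a i * h i w)%:E <= (\sum_(i <- s) a i * K i)%:E)%E.
Proof.
move=> a0 mh h0 hK.
under eq_integral do rewrite -sumEFin.
rewrite ge0_integral_sum //; last 2 first.
- by move=> i; apply/measurable_EFinP; exact: measurable_funM.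
- by move=> i w _; rewrite lee_fin mulr_ge0.
rewrite -sumEFin; apply: lee_sum => i _.
under eq_integral do rewrite EFinM.
rewrite ge0_integralZl_EFin //.
- by rewrite EFinM; apply: lee_wpmul2l; rewrite ?lee_fin.
- by move=> w _; rewrite lee_fin.
- exact/measurable_EFinP.
Qed.

(** The triangle inequality in L2. It serves wherever terms are correlated: over the lags of the
    filters, and in the crude bound for the diagonal of the noise Gram matrix. *)
Lemma msq_le_wsum (I : Type) (s : seq I) (a : I -> R) (u : I -> Om -> R) (K c : R) :
  (forall i, msq_le (u i) K) -> 0 <= K -> \sum_(i <- s) `|a i| <= c ->
  msq_le (fun w => \sum_(i <- s) a i * u i w) (c ^+ 2 * K).
Proof.
move=> uK K0 ac.
have mu i : measurable_fun setT (u i) by case: (uK i).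
have mau i b : measurable_fun setT (fun w => b * u i w) by exact: measurable_funM.
have c0 : 0 <= \sum_(i <- s) `|a i| by apply: sumr_ge0.
have mub i b : measurable_fun setT (fun w => b * u i w ^+ 2).
  by apply: measurable_funM => //; exact: measurable_funX.
apply: (@msq_le_integral _ _ (fun w => c * (\sum_(i <- s) `|a i| * u i w ^+ 2))).
- exact: measurable_sum.
- by apply: measurable_funM => //; exact: measurable_sum.
- move=> w; apply: le_trans (sqr_sum_le s a (fun i => u i w)) _.
  apply: ler_wpM2r => //; apply: sumr_ge0 => i _.
  by rewrite mulr_ge0 ?sqr_ge0.
- under eq_integral do rewrite EFinM.
  rewrite ge0_integralZl_EFin //; last 3 first.
  + by move=> w _; rewrite lee_fin sumr_ge0 // => i _; rewrite mulr_ge0 ?sqr_ge0.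
  + by apply/measurable_EFinP; exact: measurable_sum.
  + exact: le_trans ac.
  rewrite expr2 -mulrA EFinM; apply: lee_wpmul2l; rewrite ?lee_fin ?(le_trans c0) //.
  apply: le_trans (@integral_sum_le _ s (fun i => `|a i|) (fun i w => u i w ^+ 2)
    (fun=> K) _ _ _ _) _ => //.
  + by move=> i; exact: measurable_funX.
  + by move=> i w; exact: sqr_ge0.
  + by move=> i; case: (uK i).
  + by rewrite lee_fin -mulr_suml; exact: ler_wpM2r.
Qed.

Lemma msq_leD f g K L : msq_le f K -> msq_le g L ->
  msq_le (fun w => f w + g w) (2 * K + 2 * L).
Proof.
move=> [mf hf] [mg hg].
have m2 (h : Om -> R) : measurable_fun setT h ->
    measurable_fun setT (fun w => 2 * h w ^+ 2).
  by move=> mh; apply: measurable_funM => //; exact: measurable_funX.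
apply: (@msq_le_integral _ _ (fun w => 2 * f w ^+ 2 + 2 * g w ^+ 2)).
- exact: measurable_funD.
- by apply: measurable_funD; apply: m2.
- by move=> w; rewrite -subr_ge0; have := sqr_ge0 (f w - g w); nra.
- under eq_integral do rewrite EFinD.
  rewrite ge0_integralD //; last 4 first.
  + by move=> w _; rewrite lee_fin mulr_ge0 ?sqr_ge0.
  + by apply/measurable_EFinP; apply: m2.
  + by move=> w _; rewrite lee_fin mulr_ge0 ?sqr_ge0.
  + by apply/measurable_EFinP; apply: m2.
  have int2 (h : Om -> R) M : measurable_fun setT h ->
      (\int[P]_w ((h w) ^+ 2)%:E <= M%:E)%E ->
      (\int[P]_w (2 * (h w) ^+ 2)%:E <= (2 * M)%:E)%E.
    move=> mh hh; under eq_integral do rewrite EFinM.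
    rewrite ge0_integralZl_EFin //.
    - by rewrite EFinM; apply: lee_wpmul2l.
    - by move=> w _; rewrite lee_fin sqr_ge0.
    - exact: measurable_sqE.
  by rewrite EFinD; apply: leeD; exact: int2.
Qed.

(** Pythagoras in L2. Compared with the triangle inequality it gains a factor equal to the number of
    terms, which is where the powers of T and q in the rates come from. *)
Lemma msq_le_orth_sum (I : eqType) (s : seq I) (Z : I -> Om -> R) (K : I -> R) :
  uniq s -> (forall i, msq_le (Z i) (K i)) ->
  (forall i j, i \in s -> j \in s -> i != j ->
     (\int[P]_w (Z i w * Z j w)%:E = 0)%E) ->
  msq_le (fun w => \sum_(i <- s) Z i w) (\sum_(i <- s) K i).
Proof.
move=> us ZK orth.
have mZ i : measurable_fun setT (Z i) by case: (ZK i).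
split; first exact: measurable_sum.
have int i j : P.-integrable setT (EFin \o (fun w => Z i w * Z j w)).
  exact: msq_le_integrable_mul.
under eq_integral => w _.
  rewrite expr2 mulr_suml; under eq_bigr do rewrite mulr_sumr.
  rewrite -sumEFin; under eq_bigr do rewrite -sumEFin.
  over.
rewrite integral_sum //; last first.
  move=> i; apply: integrable_sum => // j _; exact: int.
rewrite -sumEFin; rewrite big_seq [leRHS]big_seq.
apply: lee_sum => i si.
rewrite integral_sum //; last by move=> j; exact: int.
rewrite (bigD1_seq i) //= big_seq_cond big1 ?adde0; last first.
  by move=> j /andP[sj ji]; rewrite orth // eq_sym.
under eq_integral do rewrite -expr2.
by case: (ZK i).
Qed.

(** Fatou's lemma: almost sure convergence, the only mode of convergence assumed for the filters, is
    enough for an upper bound on the mean square of the limit. *)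
Lemma msq_le_lim (Z : nat -> Om -> R) (f : Om -> R) (K : R) :
  measurable_fun setT f ->
  (forall N, msq_le (Z N) K) ->
  {ae P, forall w, Z ^~ w @ \oo --> f w} -> msq_le f K.
Proof.
move=> mf ZK Zf; split => //.
have mZ N : measurable_fun setT (fun w => ((Z N w) ^+ 2)%:E).
  by apply: measurable_sqE; case: (ZK N).
have h := fatou P measurableT mZ (fun N w _ => sqr_ge0 (Z N w)).
apply: (@le_trans _ _ (\int[P]_w (limn_einf (fun N => ((Z N w) ^+ 2)%:E)))%E).
  rewrite (@ge0_ae_eq_integral _ _ _ P setT _
    (fun w => limn_einf (fun N => ((Z N w) ^+ 2)%:E))) //.
  - exact: measurable_sqE.
  (* The lower limit is measurable as the opposite of the upper limit of the opposites. *)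
  - under eq_fun do rewrite -[limn_einf _]oppeK -limn_esupN.
    apply: measurableT_comp => //; apply: measurable_fun_limn_esup => N.
    exact: measurableT_comp.
  - by move=> w _; rewrite lee_fin sqr_ge0.
  - move=> w _; rewrite limn_einf_lim; apply: lime_ge; first exact: is_cvg_einfs.
    apply: nearW => N; apply: le_ereal_inf_tmp => _ [k _ <-].
    by rewrite lee_fin sqr_ge0.
  - apply: filterS Zf => w Zw _ /=.
    have : (fun N => ((Z N w) ^+ 2)%:E) @ \oo --> ((f w) ^+ 2)%:E.
      apply: cvg_EFin; first by apply: nearW.
      exact: (cvgM Zw Zw).
    by move/cvg_limn_einf_sup => [].
apply: le_trans h _; rewrite limn_einf_lim.
apply: lime_le; first exact: is_cvg_einfs.
apply: nearW => N; apply: le_trans (_ : (\int[P]_w ((Z N w) ^+ 2)%:E <= _)%E).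
  by apply: ereal_inf_lbound; exists N => /=.
by case: (ZK N).
Qed.
End MeanSquare.

(** * Independence *)

Section Independence.
Context {R : realType} {d : measure_display} {Om : measurableType d}.
Variable P : probability Om R.

Definition indep_rv (X Y : Om -> R) : Prop :=
  forall A B : set R, measurable A -> measurable B ->
    P ((X @^-1` A) `&` (Y @^-1` B)) = (P (X @^-1` A) * P (Y @^-1` B))%E.

Lemma indep_rvC X Y : indep_rv X Y -> indep_rv Y X.
Proof. by move=> h A B mA mB; rewrite setIC h // muleC. Qed.

Lemma indep_rv_comp X Y (f g : R -> R) : measurable_fun setT f ->
  measurable_fun setT g -> indep_rv X Y -> indep_rv (f \o X) (g \o Y).
Proof.
move=> mf mg h A B mA mB; apply: (h (f @^-1` A) (g @^-1` B)).
- by rewrite -[X in measurable X]setTI; exact: mf.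
- by rewrite -[X in measurable X]setTI; exact: mg.
Qed.

(** The law of the pair and the product of the two laws agree on rectangles, hence everywhere, and
    Fubini's theorem splits the integral. Integrability of the product is part of the conclusion
    because it too comes from independence. *)
Lemma indep_rv_integralM (X Y : Om -> R) :
  measurable_fun setT X -> measurable_fun setT Y ->
  P.-integrable setT (EFin \o X) -> P.-integrable setT (EFin \o Y) ->
  indep_rv X Y ->
  P.-integrable setT (fun w => (X w * Y w)%:E) /\
  (\int[P]_w (X w * Y w)%:E = \int[P]_w (X w)%:E * \int[P]_w (Y w)%:E)%E.
Proof.
move=> mX mY iX iY iXY.
pose X' : {mfun Om >-> R} := HB.pack X (isMeasurableFun.Build _ _ _ _ X mX).
pose Y' : {mfun Om >-> R} := HB.pack Y (isMeasurableFun.Build _ _ _ _ Y mY).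
pose D1 : probability R R := distribution P X'.
pose D2 : probability R R := distribution P Y'.
pose XY := fun w => (X w, Y w).
have mXY : measurable_fun setT XY by exact: measurable_fun_pair.
pose XY' : {mfun Om >-> (R * R)%type} :=
  HB.pack XY (isMeasurableFun.Build _ _ _ _ XY mXY).
pose J : probability (R * R)%type R := distribution P XY'.
have JE (S : set (R * R)) : measurable S -> (D1 \x D2)%E S = J S.
  apply: product_measure_unique => A B mA mB.
  rewrite /J /D1 /D2 /= /distribution /pushforward /=.
  by rewrite -iXY //; congr (P _); apply/seteqP; split=> w [].
pose f := fun z : R * R => (z.1 * z.2)%:E.
have mf : measurable_fun setT f.
  by apply/measurable_EFinP; apply: measurable_funM.
have intJ (g : R * R -> \bar R) :
    (\int[(D1 \x D2)%E]_z g z = \int[J]_z g z)%E.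
  by apply: (eq_measure_integral J) => A mA _; exact: JE.
have idE1 : (\int[D1]_x (`|x|)%:E = \int[P]_w (`|X w|)%:E)%E.
  by rewrite /D1 (ge0_integral_distribution X' (f := fun x => (`|x|)%:E)) //;
    apply/measurable_EFinP.
have idE2 : (\int[D2]_x (`|x|)%:E = \int[P]_w (`|Y w|)%:E)%E.
  by rewrite /D2 (ge0_integral_distribution Y' (f := fun x => (`|x|)%:E)) //;
    apply/measurable_EFinP.
have id1 : (\int[D1]_x x%:E = \int[P]_w (X w)%:E)%E.
  by rewrite /D1 (integral_distribution (X := X') (f := EFin)).
have id2 : (\int[D2]_x x%:E = \int[P]_w (Y w)%:E)%E.
  by rewrite /D2 (integral_distribution (X := Y') (f := EFin)).
have iD2 : D2.-integrable setT (EFin : R -> \bar R).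
  apply: (integrable_pushforward (phi := Y')) => //.
have iD1 : D1.-integrable setT (EFin : R -> \bar R).
  apply: (integrable_pushforward (phi := X')) => //.
have absfin (Z : Om -> R) : P.-integrable setT (EFin \o Z) ->
    (\int[P]_w (`|Z w|)%:E < +oo)%E.
  by move=> /integrableP[_].
have inn x : (\int[D2]_y `|f (x, y)| = (`|x|)%:E * \int[P]_w (`|Y w|)%:E)%E.
  rewrite -idE2 -ge0_integralZl_EFin //.
  - by apply: eq_integral => y _ /=; rewrite normrM EFinM.
  - exact/measurable_EFinP.
(* Tonelli on the absolute value: the iterated integral is the product of the first absolute
   moments. This is what licenses Fubini below. *)
have dfin : (\int[D1]_x \int[D2]_y `|f (x, y)| < +oo)%E.
  under eq_integral do rewrite inn.
  have hY := absfin _ iY.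
  have Yf : (\int[P]_w (`|Y w|)%:E)%E \is a fin_num.
    by rewrite ge0_fin_numE // integral_ge0.
  rewrite -(fineK Yf) ge0_integralZr // ?lee_fin ?fine_ge0 ?integral_ge0 //.
  - have Xf : (\int[P]_w (`|X w|)%:E)%E \is a fin_num.
      by rewrite ge0_fin_numE ?integral_ge0 //; exact: absfin.
    by rewrite idE1 -(fineK Xf) -EFinM ltry.
  - exact/measurable_EFinP.
have iprod : (D1 \x D2)%E.-integrable setT f by apply/integrable12ltyP.
have iXYP : P.-integrable setT (f \o XY').
  apply/integrableP; split; first exact: measurableT_comp.
  have /integrableP[_] := iprod.
  rewrite intJ /J (ge0_integral_distribution XY' (f := fun z => `|f z|%E)) //.
  exact: measurableT_comp.
split => //.
rewrite -[LHS]/(\int[P]_w (f \o XY') w)%E -(integral_distribution mf iXYP).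
rewrite -intJ -integral12_prod_meas1 // /fubini_F.
have Yf : (\int[P]_w (Y w)%:E)%E \is a fin_num by exact: integrable_fin_num.
transitivity (\int[D1]_x (x%:E * \int[P]_w (Y w)%:E))%E.
  apply: eq_integral => x _; rewrite -id2 -integralZl //.
rewrite -(fineK Yf) integralZr // id1 //.
Qed.

(** The finite measures P(A & .) and P(A) P(.) agree on the pi-system [G], hence on the
    sigma-algebra it generates. *)
Lemma indep_pi_sigma (G : set (set Om)) (A : set Om) :
  setI_closed G -> G setT -> G `<=` measurable -> measurable A ->
  (forall B, G B -> P (A `&` B) = (P A * P B)%E) ->
  forall B, <<s G >> B -> P (A `&` B) = (P A * P B)%E.
Proof.
move=> GI GT Gm mA GA.
have PA0 : 0 <= fine (P A) by rewrite fine_ge0.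
pose m1 := mrestr P mA.
pose m2 := mscale (NngNum PA0) P.
have h := @g_sigma_algebra_measure_unique _ R _ G Gm (fun=> setT) _ _ m1 m2 GI.
have m2E C : m2 C = (P A * P C)%E by rewrite /m2 /mscale /= fineK ?fin_num_measure.
move=> B sB; rewrite setIC -m2E; apply: h => //.
- by apply/seteqP; split => // x _; exists 0%N.
- by move=> C GC; transitivity (P A * P C)%E;
    [rewrite -(GA _ GC) setIC | exact/esym/m2E].
- move=> _; suff: (P (setT `&` A) < +oo)%E by [].
  by rewrite setTI (le_lt_trans (probability_le1 P mA)) ?ltry.
Qed.

(** A pi-system generating the sigma-algebra of the variables with index in [s]; the product formula
    of an independent family speaks exactly of such sets. *)
Definition cylinders (I : choiceType) (X : I -> Om -> R) (s : seq I) :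
    set (set Om) :=
  [set E | exists2 B : I -> set R, forall i, measurable (B i) &
     E = \bigcap_(i in [set` s]) (X i @^-1` B i)].

Lemma cylinders_mem (I : choiceType) (X : I -> Om -> R) (s : seq I) i
    (B : set R) : i \in s -> measurable B -> cylinders X s (X i @^-1` B).
Proof.
move=> si mB; exists (fun j => if j == i then B else setT).
  by move=> j; case: ifP.
apply/seteqP; split=> [w Bw j /= sj|w /(_ i si) /=]; last by rewrite eqxx.
by case: eqP => // ->.
Qed.

Lemma indep_family_cylinders (I : choiceType) (X : I -> Om -> R) (a : I)
    (s : seq I) (Y : Om -> R) :
  indep_family P X -> (forall i, measurable_fun setT (X i)) -> a \notin s ->
  (forall B, measurable B -> <<s cylinders X s >> (Y @^-1` B)) ->
  indep_rv (X a) Y.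
Proof.
move=> iX mX as_ mY A B mA mB.
apply: (@indep_pi_sigma (cylinders X s)).
- move=> E1 E2 [B1 mB1 ->] [B2 mB2 ->]; exists (fun i => B1 i `&` B2 i).
    by move=> i; exact: measurableI.
  by rewrite -bigcapI; apply: eq_bigcapr => i _; rewrite preimage_setI.
- by exists (fun=> setT) => //; apply/seteqP; split.
- move=> E [B1 mB1 ->]; apply: fin_bigcap_measurable.
    exact: finite_seq.
  by move=> i _; rewrite -[X in measurable X]setTI; exact: mX.
- by rewrite -[X in measurable X]setTI; exact: mX.
- move=> E [B1 mB1 ->].
  (* The product formula is available for duplicate-free lists only, whereas [s] may repeat an
     index. The family [B'] below then adds the constraint [A] at the new index [a]. *)
  have -> : \bigcap_(i in [set` s]) (X i @^-1` B1 i) =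
      \bigcap_(i in [set` undup s]) (X i @^-1` B1 i).
    apply/seteqP; split=> w h i /= si; apply: h => /=; first by rewrite -mem_undup.
    by rewrite mem_undup.
  have us := undup_uniq s.
  have as' : a \notin undup s by rewrite mem_undup.
  pose B' i := if i == a then A else B1 i.
  have mB' i : measurable (B' i) by rewrite /B'; case: ifP.
  have h1 := iX _ _ us mB1.
  have uas : uniq (a :: undup s) by rewrite /= as'.
  have := iX _ _ uas mB'.
  rewrite big_cons {2}/B' eqxx => h2.
  rewrite h1.
  have -> : (\prod_(i <- undup s) P (X i @^-1` B1 i) =
             \prod_(i <- undup s) P (X i @^-1` B' i))%E.
    rewrite big_seq [in RHS]big_seq; apply: eq_bigr => i si.
    by rewrite /B'; case: eqP => // ia; rewrite -ia si in as'.
  rewrite -h2; congr (P _).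
  apply/seteqP; split=> [w [Aw Ew] i /=|w Ew].
    rewrite inE /B'; case: eqP => [->//|_ /= si]; exact: Ew.
  split; first by have := Ew a; rewrite /= inE /B' eqxx; apply.
  move=> i /= si; have := Ew i; rewrite /= inE si orbT /B' => /(_ isT).
  by case: eqP => // ia; rewrite -ia si in as'.
- exact: mY.
Qed.

(** The indices [b], [c], [e] may coincide with each other: this covers every product of four
    innovations in which one of them occurs only once. *)
Lemma indep_family_prod3 (I : choiceType) (X : I -> Om -> R) (a b c e : I) :
  indep_family P X -> (forall i, measurable_fun setT (X i)) ->
  a \notin [:: b; c; e] -> indep_rv (X a) (fun w => X b w * X c w * X e w).
Proof.
move=> iX mX abce; apply: (indep_family_cylinders iX mX abce) => B mB.
pose G := cylinders X [:: b; c; e].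
have mXi i : i \in [:: b; c; e] ->
    measurable_fun (setT : set (g_sigma_algebraType G)) (X i : _ -> R).
  move=> si _ C mC; rewrite setTI; apply: sub_sigma_algebra.
  exact: cylinders_mem.
have : measurable_fun (setT : set (g_sigma_algebraType G))
    ((fun w => X b w * X c w * X e w) : _ -> R).
  by apply: measurable_funM; [apply: measurable_funM|]; apply: mXi;
    rewrite !inE eqxx ?orbT.
by move=> /(_ measurableT _ mB); rewrite setTI.
Qed.

Lemma indep_family_pair (I : choiceType) (X : I -> Om -> R) (a b : I) :
  indep_family P X -> (forall i, measurable_fun setT (X i)) ->
  a != b -> indep_rv (X a) (X b).
Proof.
move=> iX mX ab; apply: (@indep_family_cylinders _ X a [:: b]) => //.
  by rewrite inE.
move=> B mB; apply: sub_sigma_algebra; apply: cylinders_mem => //.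
by rewrite inE.
Qed.

Definition white2 (I : choiceType) (X : I -> Om -> R) : Prop :=
  [/\ forall i, measurable_fun setT (X i),
      forall i, (\int[P]_w (X i w ^+ 2)%:E = 1)%E,
      forall i, (\int[P]_w (X i w)%:E = 0)%E &
      forall i j, i != j -> (\int[P]_w (X i w * X j w)%:E = 0)%E].

(** The fourth-order consequences of independence used for bilinear forms: uncorrelated centered
    squares, and a vanishing mean as soon as one of four indices differs from the other three. They
    survive injective reindexing, hence transposition. *)
Definition white4 (I : choiceType) (K : R) (X : I -> Om -> R) : Prop :=
  [/\ white2 X,
      forall i, (\int[P]_w (X i w ^+ 4)%:E <= K%:E)%E,
      forall i j, i != j ->
        (\int[P]_w ((X i w ^+ 2 - 1) * (X j w ^+ 2 - 1))%:E = 0)%E &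
      forall a b c e, a \notin [:: b; c; e] ->
        (\int[P]_w (X a w * (X b w * X c w * X e w))%:E = 0)%E].

Lemma white2_msq (I : choiceType) (X : I -> Om -> R) i :
  white2 X -> msq_le P (X i) 1.
Proof. by move=> [mX X2 _ _]; split => //; rewrite X2. Qed.

Lemma white2_inj (I J : choiceType) (X : I -> Om -> R) (f : J -> I) :
  injective f -> white2 X -> white2 (fun j => X (f j)).
Proof.
move=> fi [h1 h2 h3 h4]; split=> // i j ij; apply: h4.
by apply: contra ij => /eqP/fi ->.
Qed.

Lemma white4_inj (I J : choiceType) K (X : I -> Om -> R) (f : J -> I) :
  injective f -> white4 K X -> white4 K (fun j => X (f j)).
Proof.
move=> fi [h1 h2 h3 h4]; split=> //; first exact: white2_inj.
- by move=> i j ij; apply: h3; apply: contra ij => /eqP/fi ->.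
- move=> a b c e; rewrite !inE => h; apply: h4; apply: contra h.
  by rewrite !inE => /or3P[]/eqP/fi->; rewrite eqxx ?orbT.
Qed.

(** From (f g)^2 <= (f^4 + g^4) / 2, so the constant [K] is preserved. The average of the two fourth
    powers is written as a weighted sum over the booleans. *)
Lemma msq_le_mul (f g : Om -> R) (K : R) :
  measurable_fun setT f -> measurable_fun setT g ->
  (\int[P]_w (f w ^+ 4)%:E <= K%:E)%E -> (\int[P]_w (g w ^+ 4)%:E <= K%:E)%E ->
  msq_le P (fun w => f w * g w) K.
Proof.
move=> mf mg hf hg.
have m4 (h : Om -> R) : measurable_fun setT h -> measurable_fun setT (fun w => h w ^+ 4).
  by move=> mh; exact: measurable_funX.
have p4 (x : R) : 0 <= x ^+ 4 by rewrite -[4%N]/(2 * 2)%N exprM sqr_ge0.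
have := @integral_sum_le _ _ _ P bool [:: true; false] (fun=> 2^-1)
  (fun b w => if b then f w ^+ 4 else g w ^+ 4) (fun=> K) _ _ _ _.
rewrite !big_cons !big_nil addr0 -mulrDl => h.
apply: (@msq_le_integral _ _ _ P _ _ (fun w => 2^-1 * f w ^+ 4 + 2^-1 * g w ^+ 4)).
- exact: measurable_funM.
- by apply: measurable_funD; apply: measurable_funM => //; exact: m4.
- move=> w; rewrite -subr_ge0.
  have -> : 2^-1 * f w ^+ 4 + 2^-1 * g w ^+ 4 - (f w * g w) ^+ 2 =
     2^-1 * (f w ^+ 2 - g w ^+ 2) ^+ 2 by field.
  by rewrite mulr_ge0 ?sqr_ge0.
- have half : 2^-1 + 2^-1 = 1 :> R by field.
  move: h; rewrite half mul1r.
  under eq_integral do rewrite !big_cons big_nil addr0.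
  by apply; case => //; exact: m4.
Qed.

Lemma white4_mul (I : choiceType) K (X : I -> Om -> R) a b :
  white4 K X -> msq_le P (fun w => X a w * X b w) K.
Proof. by move=> [[mX _ _ _] h _ _]; exact: msq_le_mul. Qed.

Lemma white2_indep (I : choiceType) (X : I -> Om -> R) :
  indep_family P X -> (forall i, measurable_fun setT (X i)) ->
  (forall i, 'E_P[X i] = 0 /\ 'V_P[X i] = 1)%E -> white2 X.
Proof.
move=> iX mX sX.
have E0 i : (\int[P]_w (X i w)%:E = 0)%E by have [+ _] := sX i; rewrite unlock.
have E1 i : (\int[P]_w (X i w ^+ 2)%:E = 1)%E.
  have [E0i] := sX i; rewrite /variance unlock E0i /=.
  rewrite unlock => <-; apply: eq_integral => w _ /=.
  by rewrite !fctE /= subr0 expr2.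
have iiX i : P.-integrable setT (EFin \o X i).
  by apply: (@msq_le_integrable _ _ _ P _ 1); split; rewrite ?E1.
split => // i j ij.
have [_ ->] := indep_rv_integralM (mX i) (mX j) (iiX i) (iiX j)
  (indep_family_pair iX mX ij).
by rewrite E0 mul0e.
Qed.

Lemma white4_indep (I : choiceType) K (X : I -> Om -> R) :
  indep_family P X -> (forall i, measurable_fun setT (X i)) ->
  (forall i, 'E_P[X i] = 0 /\ 'V_P[X i] = 1)%E ->
  (forall i, 'E_P[fun w => (X i w ^+ 4)%R] <= K%:E)%E -> white4 K X.
Proof.
move=> iX mX sX; rewrite unlock => X4.
have w2 := white2_indep iX mX sX; have [_ E1 E0 _] := w2.
have iiX i : P.-integrable setT (EFin \o X i).
  exact: msq_le_integrable (white2_msq i w2).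
have i2X i : P.-integrable setT (EFin \o (fun w => X i w ^+ 2)).
  exact: msq_le_integrable_sqr (white2_msq i w2).
have m2 : measurable_fun setT (fun x : R => x ^+ 2 - 1).
  by apply: measurable_funB => //; exact: measurable_funX.
have i21 i : P.-integrable setT (EFin \o (fun w => X i w ^+ 2 - 1)).
  have h := integrableB measurableT (i2X i)
    (finite_measure_integrable_cst P 1 measurableT).
  by apply: eq_integrable h => // w _ /=; rewrite EFinB.
have E21 i : (\int[P]_w (X i w ^+ 2 - 1)%:E = 0)%E.
  under eq_integral do rewrite EFinB.
  rewrite integralB_EFin //; last exact: finite_measure_integrable_cst.
  by rewrite E1 integral_cst //= probability_setT mule1 subee.
split => //.
- move=> i j ij.
  have mX1 k : measurable_fun setT (fun w => X k w ^+ 2 - 1).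
    exact: (measurableT_comp m2 (mX k)).
  have [_ ->] := indep_rv_integralM (mX1 i) (mX1 j) (i21 i) (i21 j)
    (indep_rv_comp m2 m2 (indep_family_pair iX mX ij)).
  by rewrite E21 mul0e.
- move=> a b c e abce.
  have h := msq_le_integrable_mul
    (msq_le_mul (mX b) (mX c) (X4 b) (X4 c)) (white2_msq e w2).
  have m3 : measurable_fun setT (fun w => X b w * X c w * X e w).
    by apply: measurable_funM => //; apply: measurable_funM.
  have [_ ->] := indep_rv_integralM (mX a) m3 (iiX a) h
    (indep_family_prod3 iX mX abce).
  by rewrite E0 mul0e.
Qed.

End Independence.

(** * Linear processes *)

Section LinearProcess.
Context {R : realType} {d : measure_display} {Om : measurableType d}.
Variable P : probability Om R.

(** Here [X k] is the innovation [k] lags back: the time and the entry of the matrix are fixed by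
    the caller. *)
Definition lin_limit (a : nat -> R) (X : nat -> Om -> R) (x : Om -> R) : Prop :=
  {ae P, forall w, (\sum_(0 <= k < N) a k * X k w) @[N --> \oo] --> x w}.

(* Both filters are truncated at N: the sum is then a combination of the terms
   (i, j) with total weight at most c * c', and Fatou's lemma lets N grow. *)
Lemma msq_le_bilinear (K : finType) (b : K -> R) (a a' : nat -> R) (c c' : R)
    (U V : nat -> K -> Om -> R) (x y : K -> Om -> R) (m : nat -> nat -> R)
    (M Q : R) :
  (forall N, \sum_(0 <= i < N) `|a i| <= c) ->
  (forall N, \sum_(0 <= i < N) `|a' i| <= c') ->
  (forall k, measurable_fun setT (x k)) ->
  (forall k, measurable_fun setT (y k)) ->
  (forall k, lin_limit a (U ^~ k) (x k)) ->
  (forall k, lin_limit a' (V ^~ k) (y k)) ->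
  (\sum_(0 <= i < N) \sum_(0 <= j < N) a i * a' j * m i j) @[N --> \oo] --> M ->
  (forall i j, msq_le P (fun w => \sum_k b k * (U i k w * V j k w) - m i j) Q) ->
  msq_le P (fun w => \sum_k b k * (x k w * y k w) - M) ((c * c') ^+ 2 * Q).
Proof.
move=> ac ac' mx my xU yV mM hQ.
have Q0 : 0 <= Q := msq_le_ge0 (hQ 0%N 0%N).
pose u (p : nat * nat) w := \sum_k b k * (U p.1 k w * V p.2 k w) - m p.1 p.2.
pose Z N w := \sum_(p : 'I_N * 'I_N) a p.1 * a' p.2 * u (p.1 : nat, p.2 : nat) w.
apply: (@msq_le_lim _ _ _ P Z).
- apply: measurable_funB => //; apply: measurable_sum => k.
  by apply: measurable_funM => //; exact: measurable_funM.
- move=> N; apply: (@msq_le_wsum _ _ _ P _ _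
    (fun p : 'I_N * 'I_N => a p.1 * a' p.2)
    (fun p => u (p.1 : nat, p.2 : nat))) => //.
    by move=> p; exact: hQ.
  rewrite -(pair_bigA _ (fun i j : 'I_N => `|a i * a' j|)) /=.
  under eq_bigr do under eq_bigr do rewrite normrM.
  under eq_bigr do rewrite -mulr_sumr.
  rewrite -mulr_suml; have := ac N; have := ac' N; rewrite !big_mkord => h' h.
  by apply: ler_pM => //; apply: sumr_ge0.
- have hx : {ae P, forall w k,
      (\sum_(0 <= i < N) a i * U i k w) @[N --> \oo] --> x k w}.
    exact: filter_forall.
  have hy : {ae P, forall w k,
      (\sum_(0 <= i < N) a' i * V i k w) @[N --> \oo] --> y k w}.
    exact: filter_forall.
  apply: filterS2 hx hy => w hx hy.
  have -> : Z ^~ w = (fun N => \sum_k b k * ((\sum_(0 <= i < N) a i * U i k w) *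
      (\sum_(0 <= j < N) a' j * V j k w)) -
      \sum_(0 <= i < N) \sum_(0 <= j < N) a i * a' j * m i j).
    apply/funext => N; rewrite /Z !big_mkord.
    under [in RHS]eq_bigr do rewrite !big_mkord.
    under [X in _ - X]eq_bigr do rewrite big_mkord.
    rewrite pair_bigA /=.
    have -> : \sum_k b k * ((\sum_(i < N) a i * U i k w) *
        (\sum_(j < N) a' j * V j k w)) = \sum_(p : 'I_N * 'I_N)
        \sum_k b k * (a p.1 * U p.1 k w * (a' p.2 * V p.2 k w)).
      rewrite exchange_big /=; apply: eq_bigr => k _.
      rewrite -(pair_bigA _ (fun i j : 'I_N => b k * (a i * U i k w *
        (a' j * V j k w)))) /= mulr_suml mulr_sumr; apply: eq_bigr => i _.
      by rewrite mulr_sumr mulr_sumr.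
    rewrite -sumrB; apply: eq_bigr => p _.
    rewrite /u mulrBr; congr (_ - _); rewrite mulr_sumr; apply: eq_bigr => k _.
    by ring.
  apply: cvgB => //.
  elim: (index_enum K) => [|k s IH].
    by under eq_fun do rewrite big_nil; rewrite big_nil; exact: cvg_cst.
  under eq_fun do rewrite big_cons; rewrite big_cons.
  apply: cvgD => //; apply: cvgM; first exact: cvg_cst.
  exact: cvgM.
Qed.

(** The products X_i Y_j form an orthogonal system with norms at most 1. For independent families
    this comes from second moments alone. *)
Definition cross_white (I J : choiceType) (X : I -> Om -> R) (Y : J -> Om -> R) :
    Prop :=
  (forall i j, msq_le P (fun w => X i w * Y j w) 1) /\
  (forall i j k l, (i, j) != (k, l) ->
     (\int[P]_w (X i w * Y j w * (X k w * Y l w))%:E = 0)%E).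

Lemma orth_sum_scaled (K : finType) (b : K -> R) (Z : K -> Om -> R) (Q : R) :
  (forall k, msq_le P (Z k) Q) ->
  (forall k l, k != l -> (\int[P]_w (Z k w * Z l w)%:E = 0)%E) ->
  msq_le P (fun w => \sum_k b k * Z k w) (Q * \sum_k b k ^+ 2).
Proof.
move=> ZQ orth; rewrite mulr_sumr.
apply: (@msq_le_orth_sum _ _ _ P _ _ (fun k w => b k * Z k w)).
- exact: index_enum_uniq.
- by move=> k; rewrite mulrC; exact: msq_leZ.
- move=> k l _ _ kl.
  under eq_integral do rewrite mulrACA EFinM.
  rewrite integralZl ?orth ?mule0 //.
  exact: msq_le_integrable_mul (ZQ k) (ZQ l).
Qed.

Section Bounds.
Variables (a a' : nat -> R) (c c' : R).
Hypothesis ac : forall N, \sum_(0 <= i < N) `|a i| <= c.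
Hypothesis ac' : forall N, \sum_(0 <= i < N) `|a' i| <= c'.
Variables (K : finType) (b : K -> R) (x y : K -> Om -> R).
Hypothesis mx : forall k, measurable_fun setT (x k).
Hypothesis my : forall k, measurable_fun setT (y k).

Lemma cvg_bilinear0 :
  (\sum_(0 <= i < N) \sum_(0 <= j < N) a i * a' j * 0) @[N --> \oo] --> (0 : R).
Proof.
apply: cvg_near_cst; apply: nearW => N.
by rewrite big1 // => i _; rewrite big1 // => j _; rewrite mulr0.
Qed.

Lemma msq_le_bilinear0 (U V : nat -> K -> Om -> R) (Q : R) :
  (forall k, lin_limit a (U ^~ k) (x k)) ->
  (forall k, lin_limit a' (V ^~ k) (y k)) ->
  (forall i j, msq_le P (fun w => \sum_k b k * (U i k w * V j k w)) Q) ->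
  msq_le P (fun w => \sum_k b k * (x k w * y k w)) ((c * c') ^+ 2 * Q).
Proof.
move=> hx hy hQ.
have := @msq_le_bilinear K b a a' c c' U V x y (fun _ _ => 0) 0 Q ac ac' mx my
  hx hy cvg_bilinear0.
have E f : (fun w : Om => f w - 0 : R) = f by apply/funext => w; rewrite subr0.
by rewrite E; apply => i j; rewrite E.
Qed.

(** At fixed lags [i], [j] the injectivity makes the terms pairwise orthogonal, which gives the sum
    of the squared coefficients; summing over the lags costs the squared product of the l1 norms. *)
Lemma msq_le_cross (I J : choiceType) (X : I -> Om -> R) (Y : J -> Om -> R)
    (f : nat -> K -> I) (g : nat -> K -> J) :
  cross_white X Y ->
  (forall i j, injective (fun k => (f i k, g j k))) ->
  (forall k, lin_limit a (fun i => X (f i k)) (x k)) ->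
  (forall k, lin_limit a' (fun j => Y (g j k)) (y k)) ->
  msq_le P (fun w => \sum_k b k * (x k w * y k w))
    ((c * c') ^+ 2 * \sum_k b k ^+ 2).
Proof.
move=> [XY1 XY0] inj hx hy; rewrite -[\sum_k _]mul1r.
apply: (@msq_le_bilinear0 (fun i k => X (f i k)) (fun j k => Y (g j k))) => //.
move=> i j; apply: (@orth_sum_scaled _ b (fun k w => X (f i k) w * Y (g j k) w)) => //.
by move=> k l kl; apply: XY0; apply: contra kl => /eqP /inj ->.
Qed.

Variables (I : choiceType) (X : I -> Om -> R) (k4 : R).
Hypothesis wX : white4 P k4 X.

(** For two distinct terms the index [f i k] occurs only once among the four indices of their
    product, so the terms are orthogonal. *)
Lemma msq_le_white4 (f g : nat -> K -> I) :
  (forall i j k l, k != l -> f i k \notin [:: g j k; f i l; g j l]) ->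
  (forall k, lin_limit a (fun i => X (f i k)) (x k)) ->
  (forall k, lin_limit a' (fun j => X (g j k)) (y k)) ->
  msq_le P (fun w => \sum_k b k * (x k w * y k w))
    ((c * c') ^+ 2 * (k4 * \sum_k b k ^+ 2)).
Proof.
move=> fg hx hy.
apply: (@msq_le_bilinear0 (fun i k => X (f i k)) (fun j k => X (g j k))) => //.
move=> i j; apply: (@orth_sum_scaled _ b (fun k w => X (f i k) w * X (g j k) w)).
  by move=> k; exact: white4_mul.
move=> k l kl; have [_ _ _ h] := wX; rewrite -[RHS](h _ _ _ _ (fg i j k l kl)).
by apply: eq_integral => w _; rewrite !mulrA.
Qed.

(** Meant for squares, whose means do not vanish: the terms are not orthogonal and the l1 norm of
    [b] replaces its l2 norm. *)
Lemma msq_le_white4_crude (f g : nat -> K -> I) (B : R) :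
  0 <= k4 -> \sum_k `|b k| <= B ->
  (forall k, lin_limit a (fun i => X (f i k)) (x k)) ->
  (forall k, lin_limit a' (fun j => X (g j k)) (y k)) ->
  msq_le P (fun w => \sum_k b k * (x k w * y k w))
    ((c * c') ^+ 2 * (B ^+ 2 * k4)).
Proof.
move=> k40 bB hx hy.
apply: (@msq_le_bilinear0 (fun i k => X (f i k)) (fun j k => X (g j k))) => //.
move=> i j; apply: (@msq_le_wsum _ _ _ P _ _ b
  (fun k w => X (f i k) w * X (g j k) w)) => //.
by move=> k; exact: white4_mul.
Qed.

End Bounds.

(** The law of large numbers for squares of a filtered process. At lags (i, j) the mean of the
    product is 1 if i = j and 0 otherwise, and the squared coefficients sum to 1, so the limiting
    mean is the sum of [b]. The last condition on [f] excludes the only way for the four indices at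
    two lags and two terms to match in pairs across the terms. *)
Lemma msq_le_lln (K : finType) (b : K -> R) (a : nat -> R) (c : R)
    (I : choiceType) (X : I -> Om -> R) (k4 : R) (x : K -> Om -> R)
    (f : nat -> K -> I) :
  (forall N, \sum_(0 <= i < N) `|a i| <= c) ->
  (\sum_(0 <= i < N) a i ^+ 2) @[N --> \oo] --> (1 : R) ->
  (forall k, measurable_fun setT (x k)) ->
  0 <= k4 -> white4 P k4 X ->
  (forall i, injective (f i)) ->
  (forall i j k, i != j -> f i k != f j k) ->
  (forall i j k l, i != j -> k != l -> ~~ ((f i k == f j l) && (f j k == f i l))) ->
  (forall k, lin_limit a (fun i => X (f i k)) (x k)) ->
  msq_le P (fun w => \sum_k b k * (x k w * x k w) - \sum_k b k)
    ((c * c) ^+ 2 * ((2 * k4 + 2) * \sum_k b k ^+ 2)).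
Proof.
move=> ac a2 mx k40 wX finj fne fne2 hx.
have [[mX E2 _ _] X4 X22 h4] := wX.
apply: (@msq_le_bilinear _ b a a c c (fun i k => X (f i k)) (fun i k => X (f i k))
  x x (fun i j => (i == j)%:R * \sum_k b k)) => //.
- have -> : (fun N => \sum_(0 <= i < N) \sum_(0 <= j < N)
      a i * a j * ((i == j)%:R * \sum_k b k)) =
      (fun N => (\sum_(0 <= i < N) a i ^+ 2) * \sum_k b k).
    apply/funext => N; rewrite !big_mkord mulr_suml; apply: eq_bigr => i _.
    rewrite big_mkord (bigD1 i) //= eqxx mul1r [X in _ + X]big1 ?addr0 //.
    move=> j ji; suff -> : (i == j :> nat) = false by rewrite mul0r mulr0.
    by apply: contraNF ji => /eqP ij; apply/eqP/val_inj.
  by rewrite -[X in _ --> X]mul1r; apply: cvgM => //; exact: cvg_cst.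
- move=> i j.
  have -> : (fun w => \sum_k b k * (X (f i k) w * X (f j k) w) -
      (i == j)%:R * \sum_k b k) =
      (fun w => \sum_k b k * (X (f i k) w * X (f j k) w - (i == j)%:R)).
    apply/funext => w; rewrite mulr_sumr -sumrB; apply: eq_bigr => k _.
    by rewrite mulrBr [_ * b k]mulrC.
  apply: (@orth_sum_scaled _ b
    (fun k w => X (f i k) w * X (f j k) w - (i == j)%:R)).
  (* Centering by a constant at most 1 in absolute value: (u - 1)^2 <= 2 u^2 + 2. *)
  + move=> k; apply: (@msq_le_trans _ _ _ P _ (2 * k4 + 2 * 1)); last lra.
    apply: (@msq_leD _ _ _ P _ (fun=> - (i == j)%:R)); first exact: white4_mul.
    apply: (@msq_le_integral _ _ _ P _ _ (fun=> 1)) => //.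
      by move=> _; case: (i == j); rewrite sqrrN ?expr1n ?expr0n //= lexx.
    by rewrite integral_cst //= probability_setT mule1.
  + move=> k l kl; have [eij|nij] := eqVneq i j.
      subst j; rewrite /= -[RHS](X22 (f i k) (f i l)) //.
      by apply: contra kl => /eqP/finj ->.
    under eq_integral do rewrite /= !subr0.
    have AC : f i k != f i l by apply: contra kl => /eqP/finj ->.
    have BD : f j k != f j l by apply: contra kl => /eqP/finj ->.
    have AB := fne i j k nij.
    (* Either [f i k] or [f j k] differs from the three other indices, so one innovation can be
       isolated and the mean vanishes. *)
    have := fne2 i j k l nij kl; rewrite negb_and => /orP[AD|BC].
      rewrite -[RHS](h4 (f i k) (f j k) (f i l) (f j l)).
        by apply: eq_integral => w _; rewrite !mulrA.
      by rewrite !inE !negb_or AB AC AD.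
    rewrite -[RHS](h4 (f j k) (f i k) (f i l) (f j l)).
      by apply: eq_integral => w _; congr EFin; ring.
    by rewrite !inE !negb_or eq_sym AB BC BD.
Qed.
End LinearProcess.

(** * Events of high probability *)

Section HighProbability.
Context {R : realType} {d : measure_display} {Om : measurableType d}.
Variable P : probability Om R.

(** The property may fail to be measurable, as when it involves the chosen eigenvectors; [B] is a
    measurable cover of its failure, in accordance with [stochO]. *)
Definition whp (e : R) (Q : Om -> Prop) : Prop :=
  exists B : set Om, [/\ measurable B, (P B <= e%:E)%E & forall w, ~ B w -> Q w].

Lemma whp_and e1 e2 (Q1 Q2 : Om -> Prop) : whp e1 Q1 -> whp e2 Q2 ->
  whp (e1 + e2) (fun w => Q1 w /\ Q2 w).
Proof.
move=> [B1 [m1 p1 h1]] [B2 [m2 p2 h2]]; exists (B1 `|` B2); split.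
- exact: measurableU.
- by rewrite EFinD; apply: le_trans (leeD p1 p2); exact: measureU2.
- by move=> w /not_orP[n1 n2]; split; [exact: h1|exact: h2].
Qed.

Lemma whp_mono e e' (Q Q' : Om -> Prop) : e <= e' -> (forall w, Q w -> Q' w) ->
  whp e Q -> whp e' Q'.
Proof.
move=> ee QQ [B [m1 p1 h1]]; exists B; split => //.
  by apply: le_trans p1 _; rewrite lee_fin.
by move=> w /h1/QQ.
Qed.

Lemma whp_ae e (Q : Om -> Prop) : 0 <= e -> {ae P, forall w, Q w} -> whp e Q.
Proof.
move=> e0 [N [mN N0 NQ]]; exists N; split => //.
  by rewrite [X in (X <= _)%E]N0 lee_fin.
by move=> w; apply: contra_notP => nQ; apply: NQ.
Qed.

Lemma whp_markov e (f : Om -> R) (K M : R) : measurable_fun setT f ->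
  (forall w, 0 <= f w) -> (\int[P]_w (f w)%:E <= K%:E)%E ->
  0 < M -> K <= e * M -> whp e (fun w => f w <= M).
Proof.
move=> mf f0 fK M0 KM.
exists [set w | M <= f w]; split.
- by rewrite -[X in measurable X]setTI; exact: measurable_fun_le.
- have h := @le_integral_comp_abse _ _ _ P setT measurableT (EFin \o f) M idfun.
  have : (M%:E * P [set w | (M <= f w)%R] <= K%:E)%E.
    apply: le_trans fK.
    have := h _ _ _ _ M0; rewrite setTI /=.
    have -> : [set x | (M%:E <= `|f x|%:E)%E] = [set w | M <= f w].
      by apply/seteqP; split=> w /=; rewrite lee_fin ger0_norm.
    have -> : (\int[P]_x `|f x|%:E = \int[P]_w (f w)%:E)%E.
      by apply: eq_integral => w _; rewrite ger0_norm.
    move=> h'; apply: h'; [exact: measurable_id|by []|by move=> x y|].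
    exact/measurable_EFinP.
  move=> h1; rewrite -(@lee_pmul2l _ M%:E) ?fin_numE // ?lte_fin //.
  by apply: le_trans h1 _; rewrite -EFinM lee_fin mulrC.
- by move=> w /= /negP; rewrite -ltNge => /ltW.
Qed.

Lemma whp_msq e (f : Om -> R) (K M : R) : msq_le P f K ->
  0 < M -> K <= e * M -> whp e (fun w => f w ^+ 2 <= M).
Proof.
move=> [mf fK]; apply: whp_markov fK => //; first exact: measurable_funX.
by move=> w; exact: sqr_ge0.
Qed.

Lemma whp_msq_sum (I : finType) e (f : I -> Om -> R) (K : I -> R) (M : R) :
  (forall i, msq_le P (f i) (K i)) ->
  0 < M -> \sum_i K i <= e * M -> whp e (fun w => \sum_i f i w ^+ 2 <= M).
Proof.
move=> fK M0 KM; have mf2 i : measurable_fun setT (fun w => f i w ^+ 2).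
  by apply: measurable_funX; case: (fK i).
apply: whp_markov M0 KM.
- exact: measurable_sum.
- by move=> w; apply: sumr_ge0 => i _; exact: sqr_ge0.
- have := @integral_sum_le _ _ _ P I (index_enum I) (fun=> 1)
    (fun i w => f i w ^+ 2) K.
  under eq_integral do under eq_bigr do rewrite mul1r.
  under [X in _ -> _ -> _ -> _ -> (_ <= X%:E)%E]eq_bigr do rewrite mul1r.
  apply => //; first by move=> i w; exact: sqr_ge0.
  by move=> i; case: (fK i).
Qed.

Lemma stochO_whp (X : nat -> Om -> R) (r : nat -> R) :
  (forall e, 0 < e -> exists2 M, 0 < M &
    \forall n \near \oo, whp e (fun w => `|X n w| <= M * r n)) ->
  stochO P X r.
Proof.
move=> h e e0; have [M M0 nM] := h e e0; exists M => //.
apply: filterS nM => n [B [mB PB hB]]; exists B; split => //.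
move=> w /= Mr; apply: contrapT => /hB; rewrite leNgt Mr //.
Qed.

(* The truncation at Q replaces moment assumptions on L: the weights
   L k * L l become bounded, hence integrable and independent of G k * G l. *)
Lemma msq_le_quadform (K : finType) (G L : K -> Om -> R) (c Q : R) :
  0 <= c -> 0 <= Q ->
  (forall k, measurable_fun setT (L k)) ->
  (forall a : K -> R, msq_le P (fun w => \sum_k a k * G k w)
     (c * \sum_k a k ^+ 2)) ->
  (forall k l, indep_rv P
     (fun w => if \sum_k L k w ^+ 2 <= Q then L k w * L l w else 0)
     (fun w => G k w * G l w)) ->
  msq_le P (fun w => if \sum_k L k w ^+ 2 <= Q then \sum_k L k w * G k w else 0)
    (c * Q).
Proof.
move=> c0 Q0 mL Gc ind.
pose S w := \sum_k L k w ^+ 2.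
pose LL k l w := if S w <= Q then L k w * L l w else 0.
pose GG k l w := G k w * G l w.
have G1 k : msq_le P (G k) c.
  have := Gc (fun l => (l == k)%:R).
  have -> : (fun w => \sum_l (l == k)%:R * G l w) = G k.
    apply/funext => w; rewrite (bigD1 k) //= eqxx mul1r big1 ?addr0 //.
    by move=> l /negbTE ->; rewrite mul0r.
  rewrite (bigD1 k) //= eqxx expr1n big1 ?addr0 ?mulr1 //.
  by move=> l /negbTE ->; rewrite expr0n.
have mG k : measurable_fun setT (G k) by case: (G1 k).
have iGG k l : P.-integrable setT (EFin \o GG k l).
  exact: msq_le_integrable_mul (G1 k) (G1 l).
have mS : measurable_fun setT S.
  by apply: measurable_sum => k; exact: measurable_funX.
have mSQ : measurable_fun setT (fun w => S w <= Q) by exact: measurable_fun_ler.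
have mLL k l : measurable_fun setT (LL k l).
  by apply: measurable_fun_ifT => //; exact: measurable_funM.
have SL k l w : `|L k w * L l w| <= S w.
  have sq j : L j w ^+ 2 <= S w.
    rewrite /S (bigD1 j) //= lerDl; apply: sumr_ge0 => i _; exact: sqr_ge0.
  rewrite ler_norml; apply/andP; split.
    by have := sqr_ge0 (L k w + L l w); have := sq k; have := sq l; nra.
  by have := sqr_ge0 (L k w - L l w); have := sq k; have := sq l; nra.
have LLQ k l w : `|LL k l w| <= Q.
  rewrite /LL; case: ifP => [h|_]; last by rewrite normr0.
  exact: le_trans (SL k l w) h.
have iLL k l : P.-integrable setT (EFin \o LL k l).
  apply: le_integrable (finite_measure_integrable_cst P Q measurableT) => //.
    exact/measurable_EFinP.
  by move=> w _ /=; rewrite lee_fin (ger0_norm Q0).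
have mGG k l : measurable_fun setT (GG k l) by exact: measurable_funM.
have key k l := indep_rv_integralM (mLL k l) (mGG k l) (iLL k l) (iGG k l) (ind k l).
split.
  by apply: measurable_fun_ifT => //; apply: measurable_sum => k; exact: measurable_funM.
have -> : (\int[P]_w ((if S w <= Q then \sum_k L k w * G k w else 0) ^+ 2)%:E =
    \int[P]_w (\sum_k \sum_l (LL k l w * GG k l w)%:E)%E)%E.
  apply: eq_integral => w _; under [in RHS]eq_bigr do rewrite sumEFin.
  rewrite sumEFin; congr EFin; rewrite /LL; case: ifP => _.
    rewrite expr2 mulr_suml; apply: eq_bigr => k _; rewrite mulr_sumr.
    by apply: eq_bigr => l _; rewrite /GG mulrACA.
  by rewrite expr0n /= big1 // => k _; rewrite big1 // => l _; rewrite mul0r.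
rewrite integral_sum //; last first.
  by move=> k; apply: integrable_sum => // l _; have [] := key k l.
under eq_bigr => k _.
  rewrite integral_sum //; last by move=> l; have [] := key k l.
  under eq_bigr => l _ do rewrite (key k l).2.
  over.
pose g k l := fine (\int[P]_w (GG k l w)%:E)%E.
have gE k l : (\int[P]_w (GG k l w)%:E = (g k l)%:E)%E.
  by rewrite /g fineK //; exact: integrable_fin_num (iGG k l).
(* The second-moment matrix [g] of [G] is at most c times the identity as a quadratic form. This is
   the hypothesis for constant coefficients; it is used below at each [w] with the coefficients
   [L k w]. *)
have quad (a : K -> R) : \sum_k \sum_l a k * a l * g k l <= c * \sum_k a k ^+ 2.
  have [_] := Gc a; rewrite -lee_fin; apply: le_trans.
  have iaa k l : P.-integrable setT (fun w => (a k * a l * GG k l w)%:E).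
    apply: (@eq_integrable _ _ _ P setT measurableT
      (fun w => (a k * a l)%:E * (GG k l w)%:E)%E) => //.
    exact: (integrableZl measurableT _ (iGG k l)).
  have -> : (\int[P]_w ((\sum_k a k * G k w) ^+ 2)%:E =
     \int[P]_w (\sum_k \sum_l (a k * a l * GG k l w)%:E)%E)%E.
    apply: eq_integral => w _; under [in RHS]eq_bigr do rewrite sumEFin.
    rewrite sumEFin; congr EFin; rewrite expr2 mulr_suml.
    apply: eq_bigr => k _; rewrite mulr_sumr.
    by apply: eq_bigr => l _; rewrite /GG mulrACA.
  rewrite integral_sum //; last first.
    by move=> k; apply: integrable_sum.
  rewrite -sumEFin; apply: lee_sum => k _.
  rewrite integral_sum // -sumEFin; apply: lee_sum => l _.
  under eq_integral do rewrite EFinM.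
  by rewrite EFinM -gE (integralZl measurableT (iGG k l)).
have iLg k l : P.-integrable setT (fun w => (LL k l w * g k l)%:E).
  apply: (@eq_integrable _ _ _ P setT measurableT
    (fun w => (g k l)%:E * (LL k l w)%:E)%E) => //.
    by move=> w _; rewrite -EFinM mulrC.
  exact: (integrableZl measurableT _ (iLL k l)).
have iLgs : P.-integrable setT (fun w => (\sum_k \sum_l LL k l w * g k l)%:E).
  under eq_fun => w do rewrite -sumEFin.
  apply: integrable_sum => // k _; under eq_fun => w do rewrite -sumEFin.
  by apply: integrable_sum.
(* Conditioning on the loadings in disguise: the moments of [G] become constants and the expectation
   is that of a quadratic form in [L]. *)
have -> : (\sum_k \sum_l (\int[P]_w (LL k l w)%:E * \int[P]_w (GG k l w)%:E) =
    \int[P]_w (\sum_k \sum_l LL k l w * g k l)%R%:E)%E.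
  under [RHS]eq_integral => w _.
    rewrite -sumEFin; under eq_bigr do rewrite -sumEFin.
    over.
  rewrite integral_sum //; last by move=> k; apply: integrable_sum.
  apply: eq_bigr => k _; rewrite integral_sum //; apply: eq_bigr => l _.
  under [RHS]eq_integral do rewrite mulrC EFinM.
  by rewrite muleC gE (integralZl measurableT (iLL k l)).
apply: (@le_trans _ _ (\int[P]_w (c * Q)%:E)%E); last first.
  by rewrite integral_cst //= probability_setT mule1.
apply: le_integral => //; first exact: finite_measure_integrable_cst.
move=> w _; rewrite lee_fin /LL; have [h|_] := boolP (S w <= Q).
  by apply: le_trans (quad (L ^~ w)) _; exact: ler_wpM2l.
by rewrite big1 ?mulr_ge0 // => k _; rewrite big1 // => l _; rewrite mul0r.
Qed.
End HighProbability.

(** * The noise *)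

Section NoiseModel.
Context {R : realType} {d : measure_display} {Om : measurableType d}.
Variable P : probability Om R.

Lemma sum_pair_mul (A B : finType) (f : A -> R) (g : B -> R) :
  \sum_(k : A * B) f k.1 * g k.2 = (\sum_a f a) * (\sum_b g b).
Proof.
rewrite big_distrlr /= (pair_bigA _ (fun a b => f a * g b)) /=.
by apply: eq_bigr.
Qed.

(** The noise assumptions entry by entry, with numerical constants in place of O(1). [c] bounds both
    filters and [CA] bounds both squared Frobenius norms of the common loadings, which makes the
    record symmetric in rows and columns. *)
Record noise_model (I J U V : finType) (Ar : I -> U -> R) (Ac : J -> V -> R)
    (Sg : I -> J -> R) (c k4 hi CA : R) (e ep Xp : int -> I -> J -> Om -> R)
    (fe Xe : int -> U -> V -> Om -> R) (a_e a_p : nat -> R) : Prop := NoiseModel {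
  nm_me : forall t i j, measurable_fun setT (e t i j);
  nm_mfe : forall t u v, measurable_fun setT (fe t u v);
  nm_mep : forall t i j, measurable_fun setT (ep t i j);
  nm_dec : forall t i j, {ae P, forall w, e t i j w =
    \sum_(z : U * V) Ar i z.1 * Ac j z.2 * fe t z.1 z.2 w + Sg i j * ep t i j w};
  nm_Ar : \sum_i \sum_u Ar i u ^+ 2 <= CA;
  nm_Ac : \sum_j \sum_v Ac j v ^+ 2 <= CA;
  nm_Sg : forall i j, 0 <= Sg i j <= hi;
  nm_k4 : 0 <= k4;
  nm_c : 0 <= c;
  nm_fe2 : forall t, white2 P (fun z : U * V => fe t z.1 z.2);
  nm_ep2 : forall t, white2 P (fun z : I * J => ep t z.1 z.2);
  nm_Xp : white4 P k4 (fun z : int * I * J => Xp z.1.1 z.1.2 z.2);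
  nm_ae : forall N, \sum_(0 <= i < N) `|a_e i| <= c;
  nm_ap : forall N, \sum_(0 <= i < N) `|a_p i| <= c;
  nm_lfe : forall t u v, lin_limit P a_e (fun k => Xe (t - k%:Z) u v) (fe t u v);
  nm_lep : forall t i j, lin_limit P a_p (fun k => Xp (t - k%:Z) i j) (ep t i j)
}.

Lemma noise_model_tr (I J U V : finType) (Ar : I -> U -> R) (Ac : J -> V -> R)
    (Sg : I -> J -> R) (c k4 hi CA : R) (e ep Xp : int -> I -> J -> Om -> R)
    (fe Xe : int -> U -> V -> Om -> R) (a_e a_p : nat -> R) :
  noise_model Ar Ac Sg c k4 hi CA e ep Xp fe Xe a_e a_p ->
  noise_model Ac Ar (fun j i => Sg i j) c k4 hi CA
    (fun t j i => e t i j) (fun t j i => ep t i j) (fun t j i => Xp t i j)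
    (fun t v u => fe t u v) (fun t v u => Xe t u v) a_e a_p.
Proof.
move=> [me mfe mep dec hAr hAc hSg k40 c0 fe2 ep2 Xp4 ae1 ap1 lfe lep]; split => //.
- move=> t j i; apply: filterS (dec t i j) => w ->; congr (_ + _).
  rewrite -(pair_bigA _ (fun u v => Ar i u * Ac j v * fe t u v w)) /=.
  rewrite -(pair_bigA _ (fun v u => Ac j v * Ar i u * fe t u v w)) /=.
  by rewrite exchange_big; apply: eq_bigr => v _; apply: eq_bigr => u _;
    rewrite [Ar i u * _]mulrC.
- move=> t; apply: (white2_inj (f := fun z : V * U => (z.2, z.1))
    _ (fe2 t)).
  by move=> [a b] [a' b'] [-> ->].
- move=> t; apply: (white2_inj (f := fun z : J * I => (z.2, z.1)) _ (ep2 t)).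
  by move=> [a b] [a' b'] [-> ->].
- apply: (white4_inj (f := fun z : int * J * I => (z.1.1, z.2, z.1.2)) _ Xp4).
  by move=> [[t a] b] [[t' a'] b'] [-> -> ->].
Qed.

Section Bounds.
Variables (I J U V : finType) (Ar : I -> U -> R) (Ac : J -> V -> R).
Variables (Sg : I -> J -> R) (c k4 hi CA : R).
Variables (e ep Xp : int -> I -> J -> Om -> R).
Variables (fe Xe : int -> U -> V -> Om -> R) (a_e a_p : nat -> R).
Hypothesis NM : noise_model Ar Ac Sg c k4 hi CA e ep Xp fe Xe a_e a_p.

Let kk t i j w := \sum_(z : U * V) Ar i z.1 * Ac j z.2 * fe t z.1 z.2 w.
Let pp t i j w := Sg i j * ep t i j w.

Let CA0 : 0 <= CA.
Proof.
apply: le_trans (nm_Ar NM); apply: sumr_ge0 => i _; apply: sumr_ge0 => u _.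
exact: sqr_ge0.
Qed.

Let Sg2 i j : Sg i j ^+ 2 <= hi ^+ 2.
Proof.
have /andP[h0 h1] := nm_Sg NM i j.
by rewrite ler_sqr ?nnegrE // (le_trans h0).
Qed.

Let hmkk t i j : measurable_fun setT (kk t i j).
Proof.
apply: measurable_sum => z; apply: measurable_funM => //; exact: (nm_mfe NM).
Qed.

Let hmpp t i j : measurable_fun setT (pp t i j).
Proof. by apply: measurable_funM => //; exact: (nm_mep NM). Qed.

(** At one time the common factors are orthonormal, and so are the idiosyncratic terms: the mean
    square of each part is the sum of its squared coefficients. No power of p or q is lost although
    entries are correlated through the common part. *)
Lemma noise_lincomb t (b : I * J -> R) :
  msq_le P (fun w => \sum_z b z * e t z.1 z.2 w)
    ((2 * CA ^+ 2 + 2 * hi ^+ 2) * \sum_z b z ^+ 2).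
Proof.
have me z : measurable_fun setT (e t z.1 z.2) by exact: (nm_me NM).
(* The coefficients of the common factors, the image of [b] under the Kronecker product of the
   loadings; Cauchy-Schwarz bounds their sum of squares by CA^2 times that of [b]. *)
pose be (y : U * V) := \sum_(z : I * J) b z * (Ar z.1 y.1 * Ac z.2 y.2).
apply: (@msq_le_ae _ _ _ P _ (fun w => \sum_y be y * fe t y.1 y.2 w +
   \sum_z (b z * Sg z.1 z.2) * ep t z.1 z.2 w)).
- by apply: measurable_sum => z; exact: measurable_funM.
- have h : {ae P, forall w (z : I * J), e t z.1 z.2 w =
      kk t z.1 z.2 w + pp t z.1 z.2 w}.
    by apply: filter_forall => z; exact: (nm_dec NM).
  apply: filterS h => w h.
  under eq_bigr do rewrite h mulrDr.
  rewrite big_split /=; congr (_ + _); last first.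
    by apply: eq_bigr => z _; rewrite /pp mulrA.
  under eq_bigr do rewrite /kk mulr_sumr.
  rewrite exchange_big /=; apply: eq_bigr => y _; rewrite /be mulr_suml.
  by apply: eq_bigr => z _; rewrite !mulrA.
have -> : (2 * CA ^+ 2 + 2 * hi ^+ 2) * (\sum_z b z ^+ 2) =
    2 * (CA ^+ 2 * \sum_z b z ^+ 2) + 2 * (hi ^+ 2 * \sum_z b z ^+ 2) by ring.
apply: msq_leD.
- have h := @orth_sum_scaled _ _ _ P _ be (fun y => fe t y.1 y.2) 1.
  apply: (@msq_le_trans _ _ _ P _ (1 * \sum_y be y ^+ 2)).
    apply: h; first by move=> y; exact: white2_msq y (nm_fe2 NM t).
    by move=> y y' yy; have [_ _ _ ->] := nm_fe2 NM t.
  rewrite mul1r.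
  have -> : CA ^+ 2 * (\sum_z b z ^+ 2) = (\sum_z b z ^+ 2) * (CA * CA).
    by rewrite mulrC expr2.
  apply: (@le_trans _ _ (\sum_y (\sum_z b z ^+ 2) *
     ((\sum_i Ar i y.1 ^+ 2) * (\sum_j Ac j y.2 ^+ 2)))).
    apply: ler_sum => y _; rewrite /be.
    apply: le_trans (sum_CS _ _ _) _; apply: ler_wpM2l.
      by apply: sumr_ge0 => z _; exact: sqr_ge0.
    rewrite -sum_pair_mul; apply: ler_sum => z _.
    by rewrite exprMn.
  rewrite -mulr_sumr; apply: ler_wpM2l.
    by apply: sumr_ge0 => z _; exact: sqr_ge0.
  rewrite (sum_pair_mul (fun u => \sum_i Ar i u ^+ 2) (fun v => \sum_j Ac j v ^+ 2)).
  rewrite exchange_big [X in _ * X]exchange_big /=; apply: ler_pM.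
  + by apply: sumr_ge0 => i _; apply: sumr_ge0 => u _; exact: sqr_ge0.
  + by apply: sumr_ge0 => i _; apply: sumr_ge0 => u _; exact: sqr_ge0.
  + exact: (nm_Ar NM).
  + exact: (nm_Ac NM).
- have h := @orth_sum_scaled _ _ _ P _ (fun z => b z * Sg z.1 z.2)
    (fun y => ep t y.1 y.2) 1.
  apply: (@msq_le_trans _ _ _ P _ (1 * \sum_z (b z * Sg z.1 z.2) ^+ 2)).
    apply: h; first by move=> y; exact: white2_msq y (nm_ep2 NM t).
    by move=> y y' yy; have [_ _ _ ->] := nm_ep2 NM t.
  rewrite mul1r mulr_sumr; apply: ler_sum => z _.
  by rewrite exprMn mulrC ler_wpM2r ?sqr_ge0.
Qed.

(** The sample is t = 1, ..., T, whereas ['I_T] starts at 0. *)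
Let tau (T : nat) (t : 'I_T) : int := (t.+1)%:Z.

Let taui T (t t' : 'I_T) : tau t = tau t' -> t = t'.
Proof. by move=> [h]; exact/val_inj. Qed.

Let tauk T (t t' : 'I_T) (k : int) : tau t - k = tau t' - k -> t = t'.
Proof. by move=> /addIr /taui. Qed.

Let kap := (c * c) ^+ 2 * (k4 * hi ^+ 4).

(** Innovations of row [i] never meet those of row [i'], so at fixed lags the T q products are
    orthogonal; with weights 1/T this leaves q/T. *)
Lemma idio_offdiag (T : nat) i i' : (0 < T)%N -> i != i' ->
  msq_le P (fun w => \sum_(z : 'I_T * J) T%:R^-1 *
      (pp (tau z.1) i z.2 w * pp (tau z.1) i' z.2 w))
    (kap * (#|J|%:R / T%:R)).
Proof.
move=> T0 ii.
have T0' : T%:R != 0 :> R by rewrite pnatr_eq0 -lt0n.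
pose b (z : 'I_T * J) := T%:R^-1 * (Sg i z.2 * Sg i' z.2).
have -> : (fun w => \sum_(z : 'I_T * J) T%:R^-1 *
      (pp (tau z.1) i z.2 w * pp (tau z.1) i' z.2 w)) =
    (fun w => \sum_z b z * (ep (tau z.1) i z.2 w * ep (tau z.1) i' z.2 w)).
  by apply/funext => w; apply: eq_bigr => z _; rewrite /b /pp; ring.
apply: (@msq_le_trans _ _ _ P _ ((c * c) ^+ 2 * (k4 * \sum_z b z ^+ 2))).
  apply: (msq_le_white4 (nm_ap NM) (nm_ap NM) b
    (x := fun z w => ep (tau z.1) i z.2 w) (y := fun z w => ep (tau z.1) i' z.2 w)
    _ _ (nm_Xp NM)
    (f := fun (k : nat) (z : 'I_T * J) => (tau z.1 - k%:Z, i, z.2))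
    (g := fun (k : nat) (z : 'I_T * J) => (tau z.1 - k%:Z, i', z.2))).
  - by move=> z; exact: (nm_mep NM).
  - by move=> z; exact: (nm_mep NM).
  - move=> k l [t j] [t' j'] zz; rewrite !inE !xpair_eqE (negbTE ii) !andbF !orbF /=.
    apply: contra zz; rewrite eqxx andbT => /andP[/eqP /tauk -> /eqP ->] //.
  - by move=> z; exact: (nm_lep NM).
  - by move=> z; exact: (nm_lep NM).
have -> : kap * (#|J|%:R / T%:R) =
    (c * c) ^+ 2 * (k4 * (hi ^+ 4 * (#|J|%:R / T%:R))) by rewrite /kap; ring.
apply: ler_wpM2l; first exact: sqr_ge0.
apply: ler_wpM2l; first exact: (nm_k4 NM).
apply: (@le_trans _ _ (\sum_(z : 'I_T * J) (T%:R^-1 ^+ 2 * hi ^+ 4))).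
  apply: ler_sum => z _; rewrite /b exprMn; apply: ler_wpM2l; first exact: sqr_ge0.
  rewrite exprMn (_ : hi ^+ 4 = hi ^+ 2 * hi ^+ 2); last by rewrite -exprD.
  by apply: ler_pM; rewrite ?sqr_ge0.
rewrite sumr_const card_prod card_ord -[leLHS]mulr_natr natrM.
rewrite le_eqVlt; apply/orP; left; apply/eqP.
by field.
Qed.

(** The diagonal has a mean of order q, so q^2 cannot be improved. It is affordable because there
    are only p such entries. *)
Lemma idio_diag (T : nat) i : (0 < T)%N ->
  msq_le P (fun w => \sum_(z : 'I_T * J) T%:R^-1 *
      (pp (tau z.1) i z.2 w * pp (tau z.1) i z.2 w))
    (kap * #|J|%:R ^+ 2).
Proof.
move=> T0.
have T0' : T%:R != 0 :> R by rewrite pnatr_eq0 -lt0n.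
pose b (z : 'I_T * J) := T%:R^-1 * (Sg i z.2 * Sg i z.2).
have -> : (fun w => \sum_(z : 'I_T * J) T%:R^-1 *
      (pp (tau z.1) i z.2 w * pp (tau z.1) i z.2 w)) =
    (fun w => \sum_z b z * (ep (tau z.1) i z.2 w * ep (tau z.1) i z.2 w)).
  by apply/funext => w; apply: eq_bigr => z _; rewrite /b /pp; ring.
apply: (@msq_le_trans _ _ _ P _
  ((c * c) ^+ 2 * ((hi ^+ 2 * #|J|%:R) ^+ 2 * k4))); last first.
  by rewrite le_eqVlt; apply/orP; left; apply/eqP; rewrite /kap; ring.
apply: (msq_le_white4_crude (nm_ap NM) (nm_ap NM)
    (x := fun z w => ep (tau z.1) i z.2 w) (y := fun z w => ep (tau z.1) i z.2 w)
    _ _ (nm_Xp NM)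
    (f := fun (k : nat) (z : 'I_T * J) => (tau z.1 - k%:Z, i, z.2))
    (g := fun (k : nat) (z : 'I_T * J) => (tau z.1 - k%:Z, i, z.2)) (nm_k4 NM)).
- by move=> z; exact: (nm_mep NM).
- by move=> z; exact: (nm_mep NM).
- apply: (@le_trans _ _ (\sum_(z : 'I_T * J) (T%:R^-1 * hi ^+ 2))).
    apply: ler_sum => z _; rewrite /b -expr2 ger0_norm.
      by apply: ler_wpM2l => //; rewrite invr_ge0.
    by rewrite mulr_ge0 ?invr_ge0 ?sqr_ge0.
  rewrite sumr_const card_prod card_ord -[leLHS]mulr_natr natrM.
  rewrite le_eqVlt; apply/orP; left; apply/eqP.
  by field.
- by move=> z; exact: (nm_lep NM).
- by move=> z; exact: (nm_lep NM).
Qed.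

Lemma idio_sum_sqr (T : nat) (eps M : R) : (0 < T)%N -> 0 < M ->
  T%:R * (#|I|%:R * #|J|%:R) * hi ^+ 2 <= eps * M ->
  whp P eps (fun w => \sum_(z : 'I_T * (I * J)) pp (tau z.1) z.2.1 z.2.2 w ^+ 2 <= M).
Proof.
move=> T0 M0 h.
apply: (@whp_msq_sum _ _ _ P _ eps (fun z => pp (tau z.1) z.2.1 z.2.2)
  (fun z => hi ^+ 2)) => //.
- move=> z; apply: (@msq_le_trans _ _ _ P _ (Sg z.2.1 z.2.2 ^+ 2 * 1)).
    by apply: msq_leZ; exact: white2_msq z.2 (nm_ep2 NM _).
  by rewrite mulr1.
- apply: le_trans h; rewrite sumr_const !card_prod card_ord -[leLHS]mulr_natl !natrM.
  by rewrite !mulrA.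
Qed.

(** The expected sum over all entries at one time is the product of the squared Frobenius norms of
    the two common loadings, hence at most CA^2 whatever p and q. *)
Lemma common_sum_sqr (T : nat) (eps M : R) : (0 < T)%N -> 0 < M ->
  T%:R * CA ^+ 2 <= eps * M ->
  whp P eps (fun w => \sum_(z : 'I_T * (I * J)) kk (tau z.1) z.2.1 z.2.2 w ^+ 2 <= M).
Proof.
move=> T0 M0 h.
apply: (@whp_msq_sum _ _ _ P _ eps (fun z => kk (tau z.1) z.2.1 z.2.2)
  (fun z => 1 * \sum_(y : U * V) (Ar z.2.1 y.1 * Ac z.2.2 y.2) ^+ 2)) => //.
- move=> z; apply: (@orth_sum_scaled _ _ _ P _ _ (fun y => fe (tau z.1) y.1 y.2)).
    by move=> y; exact: white2_msq y (nm_fe2 NM _).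
  by move=> y y' yy; have [_ _ _ ->] := nm_fe2 NM (tau z.1).
- apply: le_trans h.
  under eq_bigr => z _.
    rewrite mul1r; under eq_bigr do rewrite exprMn.
    rewrite (sum_pair_mul (fun u => Ar z.2.1 u ^+ 2) (fun v => Ac z.2.2 v ^+ 2)).
    over.
  rewrite -(pair_bigA _ (fun (t : 'I_T) (y : I * J) =>
    (\sum_u Ar y.1 u ^+ 2) * (\sum_v Ac y.2 v ^+ 2))) /= sumr_const card_ord.
  rewrite -[leLHS]mulr_natl; apply: ler_wpM2l => //.
  rewrite (sum_pair_mul (fun i => \sum_u Ar i u ^+ 2) (fun j => \sum_v Ac j v ^+ 2)).
  rewrite expr2; apply: ler_pM.
  + by apply: sumr_ge0 => i _; apply: sumr_ge0 => u _; exact: sqr_ge0.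
  + by apply: sumr_ge0 => i _; apply: sumr_ge0 => u _; exact: sqr_ge0.
  + exact: (nm_Ar NM).
  + exact: (nm_Ac NM).
Qed.

End Bounds.
End NoiseModel.

(** * The Gram matrix of the noise *)

Section Gram.
Variable R : realType.

(** Cauchy-Schwarz over times and columns for each pair of rows; the bound then factors over the two
    rows. *)
Lemma gram_cross (T : nat) (I J : finType) (a b : 'I_T -> I -> J -> R) :
  \sum_(y : I * I) (\sum_(z : 'I_T * J) T%:R^-1 * (a z.1 y.1 z.2 * b z.1 y.2 z.2)) ^+ 2
  <= ((\sum_(z : 'I_T * (I * J)) a z.1 z.2.1 z.2.2 ^+ 2) / T%:R) *
     ((\sum_(z : 'I_T * (I * J)) b z.1 z.2.1 z.2.2 ^+ 2) / T%:R).
Proof.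
have reidx (f : 'I_T -> I -> J -> R) :
    \sum_(z : 'I_T * (I * J)) f z.1 z.2.1 z.2.2 =
    \sum_i \sum_(z : 'I_T * J) f z.1 i z.2.
  rewrite -(pair_bigA _ (fun t (y : I * J) => f t y.1 y.2)) /=.
  under eq_bigr do rewrite -(pair_bigA _ (fun i j => f _ i j)) /=.
  rewrite exchange_big /=; apply: eq_bigr => i _.
  by rewrite -(pair_bigA _ (fun t j => f t i j)).
rewrite (reidx (fun t i j => a t i j ^+ 2)) (reidx (fun t i j => b t i j ^+ 2)).
rewrite mulrACA -sum_pair_mul mulr_suml; apply: ler_sum => y _.
rewrite -mulr_sumr exprMn expr2 mulrC; apply: ler_wpM2r.
  by rewrite mulr_ge0 ?invr_ge0.
exact: sum_CS.
Qed.

Definition gram_entry (T : nat) (I J : finType) (a b : 'I_T -> I -> J -> R)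
    (y : I * I) : R :=
  \sum_(z : 'I_T * J) T%:R^-1 * (a z.1 y.1 z.2 * b z.1 y.2 z.2).

Definition mean_sqr (T : nat) (I J : finType) (a : 'I_T -> I -> J -> R) : R :=
  (\sum_(z : 'I_T * (I * J)) a z.1 z.2.1 z.2.2 ^+ 2) / T%:R.

(** Cauchy-Schwarz is used only where the common part [k] occurs, since [mean_sqr k] is O(1). For
    [p] alone it would give (p q)^2, too large, so that Gram matrix is kept. The 8 counts the two
    mixed products. *)
Lemma gram_split (T : nat) (I J : finType) (k p : 'I_T -> I -> J -> R) :
  \sum_y gram_entry (fun t i j => k t i j + p t i j)
           (fun t i j => k t i j + p t i j) y ^+ 2 <=
    4 * \sum_y gram_entry p p y ^+ 2 + 8 * (mean_sqr p * mean_sqr k) +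
    4 * mean_sqr k ^+ 2.
Proof.
pose S := @gram_entry T I J; pose B := @mean_sqr T I J.
pose kp t i j := k t i j + p t i j.
rewrite -/S -/B -/kp.
have SE y : S kp kp y = S k k y + S k p y + S p k y + S p p y.
  rewrite /S /gram_entry -!big_split /=; apply: eq_bigr => z _; rewrite /kp; ring.
have h y : S kp kp y ^+ 2 <=
    4 * (S k k y ^+ 2 + S k p y ^+ 2 + S p k y ^+ 2 + S p p y ^+ 2).
  rewrite SE -subr_ge0.
  have -> : 4 * (S k k y ^+ 2 + S k p y ^+ 2 + S p k y ^+ 2 + S p p y ^+ 2) -
      (S k k y + S k p y + S p k y + S p p y) ^+ 2 =
    (S k k y - S k p y) ^+ 2 + (S k k y - S p k y) ^+ 2 +
    (S k k y - S p p y) ^+ 2 + (S k p y - S p k y) ^+ 2 +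
    (S k p y - S p p y) ^+ 2 + (S p k y - S p p y) ^+ 2 by ring.
  by rewrite !addr_ge0 ?sqr_ge0.
apply: le_trans (ler_sum _ (fun y _ => h y)) _.
rewrite -mulr_sumr !big_split /=.
have := gram_cross k k; have := gram_cross k p; have := gram_cross p k.
rewrite -/(mean_sqr k) -/(mean_sqr p) expr2 /S /B /gram_entry => h1 h2 h3; lra.
Qed.

End Gram.

Section NoiseGram.
Context {R : realType} {d : measure_display} {Om : measurableType d}.
Variable P : probability Om R.

(** [m1], [m2], [m3] are Markov constants at level eps/3 for the idiosyncratic Gram matrix, the
    idiosyncratic sum of squares and the common sum of squares; the [+ 1] keeps them positive. They
    are combined as in [gram_split]. *)
Definition gram_const (c k4 hi CA eps : R) : R :=
  let m1 := 3 * ((c * c) ^+ 2 * (k4 * hi ^+ 4) + 1) / eps in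
  let m2 := 3 * (hi ^+ 2 + 1) / eps in
  let m3 := 3 * (CA ^+ 2 + 1) / eps in
  4 * m1 + 8 * (m2 * m3) + 4 * m3 ^+ 2.

Variables (I J U V : finType) (Ar : I -> U -> R) (Ac : J -> V -> R).
Variables (Sg : I -> J -> R) (c k4 hi CA : R).
Variables (e ep Xp : int -> I -> J -> Om -> R).
Variables (fe Xe : int -> U -> V -> Om -> R) (a_e a_p : nat -> R).
Hypothesis NM : noise_model P Ar Ac Sg c k4 hi CA e ep Xp fe Xe a_e a_p.

Lemma noise_gram (T : nat) (eps : R) : (0 < T)%N -> (0 < #|I|)%N ->
  (0 < #|J|)%N -> 0 < eps ->
  whp P eps (fun w =>
    \sum_(y : I * I) (\sum_(z : 'I_T * J)
       T%:R^-1 * (e (z.1.+1)%:Z y.1 z.2 w * e (z.1.+1)%:Z y.2 z.2 w)) ^+ 2 <=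
    gram_const c k4 hi CA eps *
      (#|I|%:R * #|J|%:R ^+ 2 + T%:R^-1 * #|I|%:R ^+ 2 * #|J|%:R)).
Proof.
move=> T0 I0 J0 eps0.
set p : R := #|I|%:R; set q : R := #|J|%:R.
have T0' : T%:R != 0 :> R by rewrite pnatr_eq0 -lt0n.
have Tp : 0 < T%:R :> R by rewrite ltr0n.
have p1 : 1 <= p by rewrite ler1n.
have q1 : 1 <= q by rewrite ler1n.
have p0 : 0 < p := lt_le_trans ltr01 p1.
have q0 : 0 < q := lt_le_trans ltr01 q1.
have Ti0 : 0 < T%:R^-1 :> R by rewrite invr_gt0.
set rho := p * q ^+ 2 + T%:R^-1 * p ^+ 2 * q.
have k40 := nm_k4 NM.
set kap := (c * c) ^+ 2 * (k4 * hi ^+ 4).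
have kap0 : 0 <= kap.
  by rewrite mulr_ge0 ?sqr_ge0 // mulr_ge0 // exprn_even_ge0.
pose m1 := 3 * (kap + 1) / eps.
pose m2 := 3 * (hi ^+ 2 + 1) / eps.
pose m3 := 3 * (CA ^+ 2 + 1) / eps.
have m1p : 0 < m1 by rewrite divr_gt0 // mulr_gt0 // ltr_wpDl.
have m2p : 0 < m2 by rewrite divr_gt0 // mulr_gt0 // ltr_wpDl // sqr_ge0.
have m3p : 0 < m3 by rewrite divr_gt0 // mulr_gt0 // ltr_wpDl // sqr_ge0.
have eps' : eps != 0 by rewrite gt_eqF.
have pq0 : 0 <= p * q ^+ 2 by rewrite mulr_ge0 ?sqr_ge0 // (le_trans ler01).
have pqT : 0 <= T%:R^-1 * p ^+ 2 * q.
  by rewrite !mulr_ge0 ?sqr_ge0 // ?(le_trans ler01 q1) // ltW.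
have pq_rho : p * q <= rho.
  apply: (@le_trans _ _ (p * q ^+ 2)); last by rewrite lerDl.
  by rewrite ler_pM2l ?(lt_le_trans ltr01 p1) // expr2 ler_peMr // (le_trans ler01).
have one_rho : 1 <= rho.
  by apply: le_trans pq_rho; rewrite -[1]mulr1 ler_pM.
have rho0 : 0 < rho by apply: lt_le_trans one_rho.
pose kk t i j w := \sum_(z : U * V) Ar i z.1 * Ac j z.2 * fe t z.1 z.2 w.
pose pp t i j w := Sg i j * ep t i j w.
(* The p^2 pairs of rows contribute q/T each and the p diagonal pairs q^2 more, which add up to
   [rho]. *)
have ev1 : whp P (eps / 3) (fun w => \sum_(y : I * I) (\sum_(z : 'I_T * J)
     T%:R^-1 * (pp (z.1.+1)%:Z y.1 z.2 w * pp (z.1.+1)%:Z y.2 z.2 w)) ^+ 2 <= m1 * rho).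
  apply: (@whp_msq_sum _ _ _ P _ _
    (fun y w => \sum_(z : 'I_T * J)
     T%:R^-1 * (pp (z.1.+1)%:Z y.1 z.2 w * pp (z.1.+1)%:Z y.2 z.2 w))
    (fun y => kap * (q / T%:R) + (y.1 == y.2)%:R * (kap * q ^+ 2))).
  - move=> [i i'] /=; have [<-|ii] := eqVneq i i'.
      apply: msq_le_trans (idio_diag NM i T0) _.
      rewrite mul1r lerDr mulr_ge0 // divr_ge0 //.
    by rewrite mul0r addr0; exact: (idio_offdiag NM T0 ii).
  - by rewrite mulr_gt0.
  - rewrite big_split /= sumr_const card_prod -mulr_suml.
    rewrite -(pair_bigA _ (fun i i' : I => (i == i')%:R)) /=.
    under [X in _ + X * _]eq_bigr => i _.
      rewrite (bigD1 i) //= eqxx big1 ?addr0; last first.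
        by move=> j /negbTE; rewrite eq_sym => ->.
      over.
    rewrite sumr_const -[_ *+ (_ * _)]mulr_natl natrM -/p.
    have -> : eps / 3 * (m1 * rho) = (kap + 1) * rho by rewrite /m1; field.
    have -> : p * p * (kap * (q / T%:R)) + p * (kap * q ^+ 2) = kap * rho.
      by rewrite /rho; ring.
    by rewrite ler_pM2r // lerDl.
have ev2 : whp P (eps / 3) (fun w => \sum_(z : 'I_T * (I * J))
    pp (z.1.+1)%:Z z.2.1 z.2.2 w ^+ 2 <= m2 * (T%:R * (p * q))).
  apply: (idio_sum_sqr NM T0).
    by rewrite mulr_gt0 // mulr_gt0 // mulr_gt0.
  have -> : eps / 3 * (m2 * (T%:R * (p * q))) = T%:R * (p * q) * (hi ^+ 2 + 1).
    by rewrite /m2; field.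
  apply: ler_wpM2l; last by rewrite lerDl.
  by rewrite ltW // mulr_gt0 // mulr_gt0.
have ev3 : whp P (eps / 3) (fun w => \sum_(z : 'I_T * (I * J))
    kk (z.1.+1)%:Z z.2.1 z.2.2 w ^+ 2 <= m3 * T%:R).
  apply: (common_sum_sqr NM T0); first by rewrite mulr_gt0.
  have -> : eps / 3 * (m3 * T%:R) = T%:R * (CA ^+ 2 + 1) by rewrite /m3; field.
  by apply: ler_wpM2l => //; rewrite lerDl.
have ev4 : whp P 0 (fun w => forall z : 'I_T * (I * J),
    e (z.1.+1)%:Z z.2.1 z.2.2 w =
    kk (z.1.+1)%:Z z.2.1 z.2.2 w + pp (z.1.+1)%:Z z.2.1 z.2.2 w).
  by apply: whp_ae => //; apply: filter_forall => z; exact: (nm_dec NM).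
have := whp_and (whp_and ev1 ev2) (whp_and ev3 ev4).
apply: whp_mono; first by rewrite addr0 le_eqVlt; apply/orP; left; apply/eqP; field.
move=> w [[h1 h2] [h3 h4]].
have := gram_split (fun (t : 'I_T) i j => kk (t.+1)%:Z i j w)
  (fun (t : 'I_T) i j => pp (t.+1)%:Z i j w).
rewrite /mean_sqr /gram_entry.
set Bp := (X in 8 * (X * _)); set Bk := (X in _ * X ^+ 2) => /= hs.
have Bp0 : 0 <= Bp by rewrite divr_ge0 //; apply: sumr_ge0 => z _; exact: sqr_ge0.
have Bk0 : 0 <= Bk by rewrite divr_ge0 //; apply: sumr_ge0 => z _; exact: sqr_ge0.
have hBp : Bp <= m2 * (p * q).
  by rewrite ler_pdivrMr // -mulrA [p * q * _]mulrC.
have hBk : Bk <= m3 by rewrite ler_pdivrMr.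
under eq_bigr => y _.
  under eq_bigr => z _ do rewrite (h4 (z.1, (y.1, z.2))) (h4 (z.1, (y.2, z.2))).
  over.
apply: le_trans hs _.
rewrite /gram_const -/kap -/m1 -/m2 -/m3 -/Bk.
have hBB : Bp * Bk <= m2 * m3 * rho.
  apply: (@le_trans _ _ (m2 * (p * q) * m3)); first exact: ler_pM.
  by rewrite mulrAC; apply: ler_wpM2l => //; exact: ltW (mulr_gt0 m2p m3p).
have hBk2 : Bk ^+ 2 <= m3 ^+ 2 * rho.
  apply: (@le_trans _ _ (m3 ^+ 2)); first by rewrite ler_sqr ?nnegrE // ltW.
  by rewrite ler_peMr // sqr_ge0.
rewrite [leRHS](_ : _ = 4 * (m1 * rho) + 8 * (m2 * m3 * rho) +
  4 * (m3 ^+ 2 * rho)); last by rewrite !mulrDl !mulrA.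
by apply: lerD; [apply: lerD|]; apply: ler_wpM2l.
Qed.

End NoiseGram.

Lemma sum_pairE (V : nmodType) (A B : finType) (f : A * B -> V) :
  \sum_z f z = \sum_a \sum_b f (a, b).
Proof. by rewrite pair_bigA; apply: eq_bigr => -[]. Qed.

(** * The factors *)

Section FactorModel.
Context {R : realType} {d : measure_display} {Om : measurableType d}.
Variable P : probability Om R.

Record factor_model (A B : finType) (c k4 : R) (F Xf : int -> A -> B -> Om -> R)
    (a_f : nat -> R) : Prop := FactorModel {
  fm_mF : forall t l b, measurable_fun setT (F t l b);
  fm_k4 : 0 <= k4;
  fm_X4 : white4 P k4 (fun z : int * A * B => Xf z.1.1 z.1.2 z.2);
  fm_a : forall N, \sum_(0 <= i < N) `|a_f i| <= c;
  fm_a2 : (\sum_(0 <= i < N) a_f i ^+ 2) @[N --> \oo] --> (1 : R);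
  fm_lF : forall t l b, lin_limit P a_f (fun k => Xf (t - k%:Z) l b) (F t l b)
}.

Lemma factor_model_tr (A B : finType) (c k4 : R) (F Xf : int -> A -> B -> Om -> R)
    (a_f : nat -> R) : factor_model c k4 F Xf a_f ->
  factor_model c k4 (fun t b l => F t l b) (fun t b l => Xf t l b) a_f.
Proof.
move=> [mF k40 X4 a1 a2 lF]; split => //.
apply: (white4_inj (f := fun z : int * B * A => (z.1.1, z.2, z.1.2)) _ X4).
by move=> [[t a] b] [[t' a'] b'] [-> -> ->].
Qed.

Section Factor.
Variables (A B : finType) (c k4 : R) (F Xf : int -> A -> B -> Om -> R).
Variable a_f : nat -> R.
Hypothesis FM : factor_model c k4 F Xf a_f.

(** For [y = y'] this is the law of large numbers for squares. For distinct entries the innovations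
    never coincide and orthogonality alone gives a mean square of order 1/T. *)
Lemma factor_lln (T : nat) (y y' : A * B) : (0 < T)%N ->
  msq_le P (fun w => \sum_(t < T) T%:R^-1 *
      (F (t.+1)%:Z y.1 y.2 w * F (t.+1)%:Z y'.1 y'.2 w) - (y == y')%:R)
    ((c * c) ^+ 2 * (2 * k4 + 2) / T%:R).
Proof.
move=> T0; have k40 := fm_k4 FM.
have T0' : T%:R != 0 :> R by rewrite pnatr_eq0 -lt0n.
have Tp : 0 < T%:R :> R by rewrite ltr0n.
have b2 : \sum_(t < T) (T%:R^-1 : R) ^+ 2 = T%:R^-1.
  by rewrite sumr_const card_ord -[LHS]mulr_natl; field.
have [<-|yy] := eqVneq y y'.
  have b1 : \sum_(t < T) (T%:R^-1 : R) = 1.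
    by rewrite sumr_const card_ord -[LHS]mulr_natl; field.
  have := @msq_le_lln _ _ _ P 'I_T (fun=> T%:R^-1) a_f c _
    (fun z : int * A * B => Xf z.1.1 z.1.2 z.2) k4
    (fun t => F (t.+1)%:Z y.1 y.2)
    (fun k t => ((t.+1)%:Z - k%:Z, y.1, y.2)) (fm_a FM) (fm_a2 FM) _ k40 (fm_X4 FM).
  rewrite b1 b2 mulrA; apply => //.
  - by move=> t; exact: (fm_mF FM).
  - by move=> k t t' [h]; apply/ord_inj; lia.
  - move=> i j t ij; apply: contra ij => /eqP[h]; lia.
  (* A swap would mean t - i = t' - j and t - j = t' - i, and subtracting gives i = j. *)
  - move=> i j t t' ij tt; apply/negP => /andP[/eqP[h1] /eqP[h2]].
    by move/eqP: ij; lia.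
  - by move=> t; exact: (fm_lF FM).
under eq_fun do rewrite subr0.
apply: (@msq_le_trans _ _ _ P _ ((c * c) ^+ 2 * (k4 * \sum_(t < T) T%:R^-1 ^+ 2))).
  apply: (msq_le_white4 (fm_a FM) (fm_a FM) (fun _ : 'I_T => T%:R^-1)
    (x := fun t => F (t.+1)%:Z y.1 y.2) (y := fun t => F (t.+1)%:Z y'.1 y'.2)
    _ _ (fm_X4 FM)
    (f := fun (k : nat) (t : 'I_T) => ((t.+1)%:Z - k%:Z, y.1, y.2))
    (g := fun (k : nat) (t : 'I_T) => ((t.+1)%:Z - k%:Z, y'.1, y'.2))).
  - by move=> t; exact: (fm_mF FM).
  - by move=> t; exact: (fm_mF FM).
  - move=> i j t t' tt; rewrite !inE !negb_or; apply/and3P; split.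
    + by apply: contra yy => /eqP[_ h1 h2]; rewrite [y]surjective_pairing h1 h2 -surjective_pairing.
    + by apply: contra tt => /eqP[h]; apply/eqP/ord_inj; lia.
    + by apply: contra yy => /eqP[_ h1 h2]; rewrite [y]surjective_pairing h1 h2 -surjective_pairing.
  - by move=> t; exact: (fm_lF FM).
  - by move=> t; exact: (fm_lF FM).
rewrite b2 -[leRHS]mulrA; apply: ler_wpM2l; first exact: sqr_ge0.
by apply: ler_wpM2r; [rewrite invr_ge0|lra].
Qed.

Variables (I J U V : finType) (Ar : I -> U -> R) (Ac : J -> V -> R).
Variables (Sg : I -> J -> R) (k4' hi CA : R).
Variables (e ep Xp : int -> I -> J -> Om -> R).
Variables (fe Xe : int -> U -> V -> Om -> R) (a_e a_p : nat -> R).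
Hypothesis NM : noise_model P Ar Ac Sg c k4' hi CA e ep Xp fe Xe a_e a_p.
Hypothesis crossE : cross_white P (fun z : int * A * B => Xf z.1.1 z.1.2 z.2)
  (fun z : int * U * V => Xe z.1.1 z.1.2 z.2).
Hypothesis crossP : cross_white P (fun z : int * A * B => Xf z.1.1 z.1.2 z.2)
  (fun z : int * I * J => Xp z.1.1 z.1.2 z.2).

(** Entry (l, i) of T^-1 sum_t F_t Ac' E_t' is the combination of these means over k = (b, j) with
    coefficients (Ac)_{jb}: the loadings are separated from the factors and the noise. *)
Definition cross_mean (T : nat) l i (k : B * J) w : R :=
  \sum_(t < T) T%:R^-1 * (F (t.+1)%:Z l k.1 w * e (t.+1)%:Z i k.2 w).

Definition cross_const : R := (c * c) ^+ 2 * (2 * CA ^+ 2 + 2 * hi ^+ 2).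

(** For constant coefficients, products of a factor innovation and a noise innovation are orthogonal
    over distinct times and entries, whence the factor 1/T. *)
Lemma cross_mean_msq (T : nat) l i (a : B * J -> R) : (0 < T)%N ->
  msq_le P (fun w => \sum_k a k * cross_mean T l i k w)
    (cross_const / T%:R * \sum_k a k ^+ 2).
Proof.
move=> T0.
have T0' : T%:R != 0 :> R by rewrite pnatr_eq0 -lt0n.
have Tp : 0 < T%:R :> R by rewrite ltr0n.
have mF t y : measurable_fun setT (F t l y) by exact: (fm_mF FM).
have me t j : measurable_fun setT (e t i j) by exact: (nm_me NM).
(* The sum over the columns j is moved into the coefficient, because all of them share the same
   common factors. The remaining terms then have distinct pairs of innovations. *)
pose b1 (z : 'I_T * (B * (U * V))) :=
  T%:R^-1 * (\sum_j a (z.2.1, j) * Ac j z.2.2.2) * Ar i z.2.2.1.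
pose b2 (z : 'I_T * (B * J)) := T%:R^-1 * (a z.2 * Sg i z.2.2).
apply: (@msq_le_ae _ _ _ P _ (fun w =>
  \sum_z b1 z * (F (z.1.+1)%:Z l z.2.1 w * fe (z.1.+1)%:Z z.2.2.1 z.2.2.2 w) +
  \sum_z b2 z * (F (z.1.+1)%:Z l z.2.1 w * ep (z.1.+1)%:Z i z.2.2 w))).
- apply: measurable_sum => z; apply: measurable_funM => //.
  by apply: measurable_sum => t; apply: measurable_funM => //; exact: measurable_funM.
- have h : {ae P, forall w (z : 'I_T * J), e (z.1.+1)%:Z i z.2 w =
      \sum_(y : U * V) Ar i y.1 * Ac z.2 y.2 * fe (z.1.+1)%:Z y.1 y.2 w +
      Sg i z.2 * ep (z.1.+1)%:Z i z.2 w}.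
    by apply: filter_forall => z; exact: (nm_dec NM).
  apply: filterS h => w h; rewrite /cross_mean.
  under eq_bigr => k _.
    under eq_bigr => t _ do rewrite (h (t, k.2)) /= mulrDr mulrDr.
    rewrite big_split /= mulrDr; over.
  rewrite big_split /=; congr (_ + _).
    rewrite sum_pairE [RHS]sum_pairE /=.
    under [RHS]eq_bigr => t _ do rewrite sum_pairE /=.
    rewrite [RHS]exchange_big /=; apply: eq_bigr => b _.
    under eq_bigr => j _ do rewrite mulr_sumr.
    rewrite exchange_big /=; apply: eq_bigr => t _.
    under eq_bigr => j _ do rewrite !mulr_sumr.
    rewrite exchange_big /=; apply: eq_bigr => y _.
    rewrite /b1 /= mulr_sumr !mulr_suml; apply: eq_bigr => j _; ring.
  rewrite [RHS]sum_pairE /=.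
  under eq_bigr do rewrite mulr_sumr.
  rewrite exchange_big /=; apply: eq_bigr => t _; apply: eq_bigr => x _.
  by rewrite /b2 /=; ring.
have sumT (f : R) : \sum_(t < T) (T%:R^-1 ^+ 2 * f) = T%:R^-1 * f.
  by rewrite sumr_const card_ord -[LHS]mulr_natl; field.
rewrite /cross_const.
have -> : (c * c) ^+ 2 * (2 * CA ^+ 2 + 2 * hi ^+ 2) / T%:R * (\sum_k a k ^+ 2) =
   2 * ((c * c) ^+ 2 * (T%:R^-1 * (CA ^+ 2 * \sum_k a k ^+ 2))) +
   2 * ((c * c) ^+ 2 * (T%:R^-1 * (hi ^+ 2 * \sum_k a k ^+ 2))) by ring.
have CA0 : 0 <= CA.
  apply: le_trans (nm_Ar NM); apply: sumr_ge0 => x _; apply: sumr_ge0 => u _.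
  exact: sqr_ge0.
apply: msq_leD.
- apply: (@msq_le_trans _ _ _ P _ ((c * c) ^+ 2 * \sum_z b1 z ^+ 2)).
    apply: (msq_le_cross (fm_a FM) (nm_ae NM) b1
      (x := fun z => F (z.1.+1)%:Z l z.2.1)
      (y := fun z => fe (z.1.+1)%:Z z.2.2.1 z.2.2.2) _ _
      (f := fun k (z : 'I_T * (B * (U * V))) => ((z.1.+1)%:Z - k%:Z, l, z.2.1))
      (g := fun k (z : 'I_T * (B * (U * V))) => ((z.1.+1)%:Z - k%:Z, z.2.2.1, z.2.2.2))
      crossE).
    + by move=> z; exact: mF.
    + by move=> z; exact: (nm_mfe NM).
    + move=> k k' [t [b [u v]]] [t' [b' [u' v']]] /= [h1 -> _ -> ->].
      by congr (_, _); apply/ord_inj; lia.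
    + by move=> z; exact: (fm_lF FM).
    + by move=> z; exact: (nm_lfe NM).
  apply: ler_wpM2l; first exact: sqr_ge0.
  rewrite -sumT sum_pairE /=.
  apply: ler_sum => t _; rewrite /b1 /=.
  under eq_bigr do rewrite -mulrA exprMn.
  rewrite -mulr_sumr; apply: ler_wpM2l; first exact: sqr_ge0.
  rewrite sum_pairE [in leRHS]sum_pairE /= [leRHS]mulr_sumr.
  apply: ler_sum => b _.
  apply: (@le_trans _ _ (\sum_(y : U * V) (\sum_j a (b, j) ^+ 2) *
     (Ar i y.1 ^+ 2 * \sum_j Ac j y.2 ^+ 2))).
    apply: ler_sum => y _; rewrite exprMn.
    have -> : (\sum_j a (b, j) ^+ 2) * (Ar i y.1 ^+ 2 * \sum_j Ac j y.2 ^+ 2) =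
      (\sum_j a (b, j) ^+ 2) * (\sum_j Ac j y.2 ^+ 2) * Ar i y.1 ^+ 2 by ring.
    by apply: ler_wpM2r; [exact: sqr_ge0|exact: sum_CS].
  rewrite -mulr_sumr [leRHS]mulrC; apply: ler_wpM2l.
    by apply: sumr_ge0 => j _; exact: sqr_ge0.
  rewrite (sum_pair_mul (fun u => Ar i u ^+ 2) (fun v => \sum_j Ac j v ^+ 2)) expr2.
  apply: ler_pM.
  + by apply: sumr_ge0 => u _; exact: sqr_ge0.
  + by apply: sumr_ge0 => v _; apply: sumr_ge0 => j _; exact: sqr_ge0.
  + apply: le_trans (nm_Ar NM); rewrite [leRHS](bigD1 i) //= lerDl.
    by apply: sumr_ge0 => x _; apply: sumr_ge0 => u _; exact: sqr_ge0.
  + by rewrite exchange_big; exact: (nm_Ac NM).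
- apply: (@msq_le_trans _ _ _ P _ ((c * c) ^+ 2 * \sum_z b2 z ^+ 2)).
    apply: (msq_le_cross (fm_a FM) (nm_ap NM) b2
      (x := fun z => F (z.1.+1)%:Z l z.2.1)
      (y := fun z => ep (z.1.+1)%:Z i z.2.2) _ _
      (f := fun k (z : 'I_T * (B * J)) => ((z.1.+1)%:Z - k%:Z, l, z.2.1))
      (g := fun k (z : 'I_T * (B * J)) => ((z.1.+1)%:Z - k%:Z, i, z.2.2))
      crossP).
    + by move=> z; exact: mF.
    + by move=> z; exact: (nm_mep NM).
    + move=> k k' [t [b j]] [t' [b' j']] /= [h1 -> _ ->].
      by congr (_, _); apply/ord_inj; lia.
    + by move=> z; exact: (fm_lF FM).
    + by move=> z; exact: (nm_lep NM).
  apply: ler_wpM2l; first exact: sqr_ge0.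
  rewrite -sumT sum_pairE /=.
  apply: ler_sum => t _; rewrite /b2 /=.
  under eq_bigr do rewrite exprMn.
  rewrite -mulr_sumr; apply: ler_wpM2l; first exact: sqr_ge0.
  rewrite [leRHS]mulr_sumr; apply: ler_sum => k _.
  rewrite exprMn mulrC; apply: ler_wpM2r; first exact: sqr_ge0.
  have /andP[h0 h1] := nm_Sg NM i k.2.
  by rewrite ler_sqr ?nnegrE // (le_trans h0).
Qed.

(** The truncated quadratic-form bound is summed over the entries (l, i). The truncation becomes the
    premise of an implication, to be discharged where the size of the loadings is known. *)
Lemma cross_mean_whp (T : nat) (L : B * J -> Om -> R) (Q M eps : R) :
  (0 < T)%N -> 0 <= Q -> 0 < M ->
  (forall k, measurable_fun setT (L k)) ->
  (forall l i k k', indep_rv P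
     (fun w => if \sum_k L k w ^+ 2 <= Q then L k w * L k' w else 0)
     (fun w => cross_mean T l i k w * cross_mean T l i k' w)) ->
  #|A|%:R * #|I|%:R * (cross_const / T%:R * Q) <= eps * M ->
  whp P eps (fun w => \sum_k L k w ^+ 2 <= Q ->
    \sum_(y : A * I) (\sum_k L k w * cross_mean T y.1 y.2 k w) ^+ 2 <= M).
Proof.
move=> T0 Q0 M0 mL ind h.
have cc0 : 0 <= cross_const / T%:R.
  by rewrite divr_ge0 // mulr_ge0 ?sqr_ge0 // addr_ge0 // mulr_ge0 // sqr_ge0.
have := @whp_msq_sum _ _ _ P (A * I)%type eps
  (fun y w => if \sum_k L k w ^+ 2 <= Q then \sum_k L k w * cross_mean T y.1 y.2 k w else 0)
  (fun=> cross_const / T%:R * Q) M.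
move=> /(_ _ M0 _)/(whp_mono (lexx eps)); apply.
- by move=> w + h'; under eq_bigr do rewrite h'.
- move=> y; apply: msq_le_quadform => //.
  by move=> a; exact: cross_mean_msq.
- by rewrite sumr_const card_prod -[leLHS]mulr_natl natrM.
Qed.

End Factor.
End FactorModel.

(** * Eigenvalues *)

Section CourantFischer.
Import complex.
Variable R : realType.

Lemma Re_sum (I : Type) (s : seq I) (G : I -> R[i]) :
  complex.Re (\sum_(k <- s) G k) = \sum_(k <- s) complex.Re (G k).
Proof. by elim/big_rec2: _ => //= k x y _ <-; case: (G k) => a b; case: y. Qed.

Lemma Re_quad_entry (x y : R[i]) (h : R) :
  complex.Re (x * (real_complex R h) * y^*) =
  h * (complex.Re x * complex.Re y + complex.Im x * complex.Im y).
Proof. by case: x => a b; case: y => c e; simpc; rewrite /=; ring. Qed.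

Lemma char_poly_conj (F : fieldType) n (M D : 'M[F]_n) : M \in unitmx ->
  char_poly (invmx M *m D *m M) = char_poly D.
Proof.
move=> uM; rewrite /char_poly.
have -> : char_poly_mx (invmx M *m D *m M) =
    map_mx polyC (invmx M) *m char_poly_mx D *m map_mx polyC M.
  rewrite /char_poly_mx mulmxBr mulmxBl !map_mxM; congr (_ - _).
  by rewrite scalar_mxC -mulmxA -map_mxM mulVmx // map_mx1 mulmx1.
rewrite !det_mulmx !det_map_mx mulrAC -rmorphM -det_mulmx mulVmx // det1.
by rewrite mul1r.
Qed.

(** Carries positivity from real to complex vectors, the spectral theorem being applied over the
    complex numbers. *)
Lemma Re_quad_form k (H : 'M[R]_k) (x : 'rV[R[i]]_k) :
  complex.Re ((x *m map_mx (real_complex R) H *m (x ^t*)%sesqui) 0 0) =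
  (map_mx (@complex.Re R) x *m H *m (map_mx (@complex.Re R) x)^T) 0 0 +
  (map_mx (@complex.Im R) x *m H *m (map_mx (@complex.Im R) x)^T) 0 0.
Proof.
rewrite !mxE Re_sum -big_split /=; apply: eq_bigr => j _.
rewrite !mxE !mulr_suml Re_sum -big_split /=; apply: eq_bigr => i _.
by rewrite !mxE Re_quad_entry; ring.
Qed.

(* The number of eigenvalues of S above l is at least the dimension k of a
   subspace on which S - l is positive definite; otherwise some nonzero
   (complex) vector of that subspace is orthogonal to all the eigenvectors
   with eigenvalue above l. *)
Lemma spectrum_count n k (S : 'M[R]_n) (s : seq R) (A : 'M[R]_(n, k)) (l : R) :
  S^T = S -> char_poly S = \prod_(x <- s) ('X - x%:P) ->
  (forall x : 'rV[R]_k, x != 0 ->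
     0 < (x *m (A^T *m (S - l%:M) *m A) *m x^T) 0 0) ->
  (k <= count (fun x : R => (l < x)%R) s)%N.
Proof.
move=> symS chS posA; rewrite leqNgt; apply/negP => lt_k.
pose f := real_complex R; pose Sc : 'M[R[i]]_n := map_mx f S.
have nS : Sc \is normalmx.
  apply: symmetric_normalmx.
    apply/is_hermitianmxP; rewrite expr0 scale1r.
    by apply/matrixP => i j; rewrite !mxE -{1}symS mxE.
  by apply/mxOverP => i j; rewrite mxE; apply/complex_realP; exists (S i j).
pose M := spectralmx Sc; pose dg := spectral_diag Sc.
have uM : M \is unitarymx by exact: spectral_unitarymx.
have unM := unitarymx_unit uM.
have Seq : Sc = invmx M *m diag_mx dg *m M 
  by have := elimT (@orthomx_spectralP _ _ Sc) nS.
(* The list [s] and the diagonal given by the spectral theorem are root lists of the same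
   characteristic polynomial, so they agree up to order; in particular the diagonal is real. *)
have chd : \prod_(x <- [seq f x | x <- s]) ('X - x%:P) =
    \prod_(x <- [seq dg 0 i | i <- enum 'I_n]) ('X - x%:P).
  rewrite big_map [RHS]big_image /=.
  have tr : is_trig_mx (diag_mx dg) by exact/diag_mx_is_trig.
  have := char_poly_conj (diag_mx dg) unM; rewrite -Seq (char_poly_trig tr).
  under [X in _ = X -> _]eq_bigr do rewrite mxE eqxx mulr1n.
  rewrite [RHS](eq_bigl xpredT) //.
  move=> <-; rewrite -map_char_poly chS rmorph_prod; apply: eq_bigr => x _.
  by rewrite rmorphB /= map_polyX map_polyC.
have pe := prod_XsubC_eq chd.
have dgE i : exists r, dg 0 i = f r.
  have : dg 0 i \in [seq f x | x <- s].
    by rewrite (perm_mem pe) map_f // mem_enum.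
  by move=> /mapP[r _ ->]; exists r.
pose rd i := complex.Re (dg 0 i).
have rdE i : dg 0 i = f (rd i) by rewrite /rd; have [r ->] := dgE i.
pose J := [set i | l < rd i]%SET.
have cJ : #|J| = count (fun x : R => (l < x)%R) s.
  have -> : count (fun x : R => (l < x)%R) s =
     count (fun z : R[i] => (l < complex.Re z)%R) [seq f x | x <- s].
    by rewrite count_map; apply: eq_count.
  rewrite (permP pe) count_map cardE size_filter enumT.
  by apply: eq_count => i; rewrite /= inE.
pose W : 'M[R[i]]_(k, n) := map_mx f A^T.
(* The coordinates, on the eigenvectors with eigenvalue above [l], of the vectors spanning the
   column space of [A]. With fewer than [k] columns this matrix has a nonzero left kernel vector
   [x]. *)
pose N : 'M[R[i]]_(k, #|J|) := \matrix_(i, j) (W *m (M ^t*)%sesqui) i (enum_val j).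
have kN : kermx N != 0.
  rewrite -mxrank_eq0 mxrank_ker subn_eq0 -ltnNge.
  by apply: leq_ltn_trans (rank_leq_col _) _; rewrite cJ.
have [x xN x0] := rowV0Pn kN.
have {}xN : x *m N = 0 by exact/sub_kermxP.
pose u := x *m (W *m (M ^t*)%sesqui).
have uJ i : i \in J -> u 0 i = 0.
  move=> iJ; have h : (x *m N) 0 (enum_rank_in iJ i) = 0 by rewrite xN mxE.
  rewrite -h /u mxE [RHS]mxE; apply: eq_bigr => j _; congr (_ * _).
  by rewrite [RHS]mxE enum_rankK_in.
pose H := A^T *m (S - l%:M) *m A.
have posx : 0 < complex.Re ((x *m map_mx f H *m (x ^t*)%sesqui) 0 0).
  rewrite Re_quad_form.
  have : (map_mx (@complex.Re R) x != 0) || (map_mx (@complex.Im R) x != 0).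
    apply: contraNT x0; rewrite negb_or !negbK => /andP[/eqP r0 /eqP i0].
    apply/eqP/matrixP => a b; apply/eqP; rewrite eq_complex.
    have := congr1 (fun B : 'rV_k => B a b) r0.
    have := congr1 (fun B : 'rV_k => B a b) i0.
    by rewrite !mxE => -> ->; rewrite /= !eqxx.
  have ge0 (y : 'rV[R]_k) : 0 <= (y *m H *m y^T) 0 0.
    have [->|y0] := eqVneq y 0; first by rewrite !mul0mx mxE.
    by apply: ltW; exact: posA.
  by case/orP => h; [apply: ltr_wpDr|apply: ltr_wpDl] => //; exact: posA.
suff : complex.Re ((x *m map_mx f H *m (x ^t*)%sesqui) 0 0) <= 0.
  by rewrite leNgt posx.
have -> : x *m map_mx f H *m (x ^t*)%sesqui =
    u *m (diag_mx dg - (f l)%:M) *m (u ^t*)%sesqui.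
  have Sl : map_mx f (S - l%:M) = invmx M *m (diag_mx dg - (f l)%:M) *m M.
    rewrite map_mxB map_scalar_mx mulmxBr mulmxBl -Seq; congr (_ - _).
    by rewrite scalar_mxC -mulmxA mulVmx // mulmx1.
  rewrite /H !map_mxM Sl /u invmx_unitary //.
  rewrite !trmx_mul !map_mxM !map_trmx !trmxK.
  have hA : map_mx Num.conj (map_mx f A) = map_mx f A.
    by apply/matrixP => i j; rewrite !mxE /f; simpc.
  have hM : map_mx Num.conj (map_mx Num.conj M) = M.
    by apply/matrixP => i j; rewrite !mxE conjCK.
  by rewrite [X in _ = _ *m (X *m _ *m _)]hM [X in _ = _ *m (_ *m X *m _)]hA !mulmxA.
rewrite !mxE Re_sum; apply: sumr_le0 => i _.
have -> : (u *m (diag_mx dg - (f l)%:M)) 0 i = u 0 i * f (rd i - l).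
  have -> : f (rd i - l) = f (rd i) - f l by rewrite /f rmorphB.
  rewrite mulmxBr mul_mx_diag mul_mx_scalar mxE [X in X + _]mxE rdE.
  by rewrite [X in _ + X]mxE [X in _ - X]mxE mulrBr [f l * _]mulrC.
rewrite [X in _ * _ * X]mxE [X in X^*]mxE Re_quad_entry.
have [iJ|] := boolP (i \in J); first by rewrite uJ //= !mulr0 addr0 mulr0.
rewrite inE -leNgt => h; apply: mulr_le0_ge0; first by rewrite subr_le0.
by rewrite -!expr2 addr_ge0 ?sqr_ge0.
Qed.

(** At least [k] members of the decreasing list [s] exceed [l], so its first [k] members all do, and
    [D] is a rearrangement of them. *)
Lemma leading_eigen_lb n k (S : 'M[R]_n) (Q : 'M[R]_(n, k)) (D : 'rV[R]_k)
    (A : 'M[R]_(n, k)) (l : R) :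
  S^T = S -> leading_eigen S Q D ->
  (forall x : 'rV[R]_k, x != 0 ->
     0 < (x *m (A^T *m (S - l%:M) *m A) *m x^T) 0 0) ->
  forall j, l < D 0 j.
Proof.
move=> symS [_ _ [s [srt chS pD]]] posA j.
have := spectrum_count symS chS posA => hk.
have hall : all (fun x : R => l < x) (take k s).
  have [ks|sk] := leqP (size s) k.
    rewrite take_oversize //.
    by rewrite all_count eqn_leq count_size (leq_trans _ hk) // .
  apply/allP => x xs; rewrite ltNge; apply/negP => xl.
  move: hk; rewrite -{1}(cat_take_drop k s) count_cat.
  have -> : count (fun y : R => l < y) (drop k s) = 0%N.
    apply/eqP; rewrite -leqn0 leqNgt -has_count; apply/hasPn => y ys.
    rewrite -leNgt; apply: le_trans xl.
    move: srt; rewrite -{1}(cat_take_drop k s).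
    have tr : transitive (fun x y : R => y <= x).
      by move=> a b c h1 h2; exact: le_trans h2 h1.
    rewrite sorted_pairwise // pairwise_cat => /and3P[/allrelP h _ _].
    exact: h.
  rewrite addn0 leqNgt => /negP; apply.
  have : (size (take k s) <= k)%N by rewrite size_take sk.
  apply: leq_trans; rewrite -(count_predC (fun y : R => l < y)) -addn1 leq_add2l.
  by rewrite -has_count; apply/hasP; exists x => //=; rewrite -leNgt.
have : D 0 j \in [seq D 0 i | i <- enum 'I_k] by rewrite map_f // mem_enum.
by rewrite (perm_mem pD) => /(allP hall).
Qed.

End CourantFischer.

(** * Deterministic error bound *)

Section Frobenius.
Variable R : realType.

Definition fsq (m n : nat) (A : 'M[R]_(m, n)) : R := \sum_i \sum_j A i j ^+ 2.

Lemma fsq_ge0 m n (A : 'M[R]_(m, n)) : 0 <= fsq A.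
Proof. by apply: sumr_ge0 => i _; apply: sumr_ge0 => j _; exact: sqr_ge0. Qed.

Lemma normF_sqr m n (A : 'M[R]_(m, n)) : normF A ^+ 2 = fsq A.
Proof. by rewrite sqr_sqrtr //; exact: fsq_ge0. Qed.

Lemma fsqT m n (A : 'M[R]_(m, n)) : fsq A^T = fsq A.
Proof.
rewrite /fsq exchange_big; apply: eq_bigr => i _; apply: eq_bigr => j _.
by rewrite mxE.
Qed.

Lemma fsq_trace m n (A : 'M[R]_(m, n)) : fsq A = \tr (A *m A^T).
Proof.
apply: eq_bigr => i _; rewrite mxE; apply: eq_bigr => j _.
by rewrite mxE expr2.
Qed.

Lemma fsq_row n (v : 'rV[R]_n) : fsq v = (v *m v^T) 0 0.
Proof. by rewrite fsq_trace /mxtrace big_ord1. Qed.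

Lemma fsqZ m n a (A : 'M[R]_(m, n)) : fsq (a *: A) = a ^+ 2 * fsq A.
Proof.
rewrite /fsq mulr_sumr; apply: eq_bigr => i _; rewrite mulr_sumr.
by apply: eq_bigr => j _; rewrite mxE exprMn.
Qed.

Lemma fsqM m n p (A : 'M[R]_(m, n)) (B : 'M[R]_(n, p)) :
  fsq (A *m B) <= fsq A * fsq B.
Proof.
rewrite -(fsqT B) /fsq mulr_suml; apply: ler_sum => i _.
rewrite mulr_sumr; apply: ler_sum => k _; rewrite mxE.
apply: le_trans (sum_CS _ _ _) _; apply: ler_wpM2l.
  by apply: sumr_ge0 => j _; exact: sqr_ge0.
by apply: ler_sum => j _; rewrite mxE.
Qed.

Lemma fsqD m n (A B : 'M[R]_(m, n)) : fsq (A + B) <= 2 * fsq A + 2 * fsq B.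
Proof.
rewrite /fsq !mulr_sumr -big_split /=; apply: ler_sum => i _.
rewrite !mulr_sumr -big_split /=; apply: ler_sum => j _; rewrite mxE.
by rewrite -subr_ge0; have := sqr_ge0 (A i j - B i j); nra.
Qed.

Lemma fsqD3 m n (A B C : 'M[R]_(m, n)) :
  fsq (A + B + C) <= 4 * fsq A + 4 * fsq B + 2 * fsq C.
Proof. by have := fsqD (A + B) C; have := fsqD A B; lra. Qed.

(** The spectral norm is at most the Frobenius norm. *)
Lemma quad_le n (X : 'M[R]_n) (v : 'rV[R]_n) (g : R) : 0 <= g ->
  fsq X <= g ^+ 2 -> `|(v *m X *m v^T) 0 0| <= g * fsq v.
Proof.
move=> g0 Xg; rewrite -ler_sqr ?nnegrE // ?mulr_ge0 ?fsq_ge0 // real_normK ?num_real // mxE.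
apply: le_trans (sum_CS _ _ _) _.
have h1 : \sum_i (v *m X) 0 i ^+ 2 <= g ^+ 2 * fsq v.
  have -> : \sum_i (v *m X) 0 i ^+ 2 = fsq (v *m X) by rewrite /fsq big_ord1.
  by apply: le_trans (fsqM _ _) _; rewrite mulrC; apply: ler_wpM2r => //; exact: fsq_ge0.
have h2 : \sum_i v^T i 0 ^+ 2 = fsq v.
  by rewrite /fsq big_ord1; apply: eq_bigr => i _; rewrite mxE.
rewrite h2 exprMn [X in _ <= _ * X]expr2 mulrA.
by apply: ler_wpM2r => //; exact: fsq_ge0.
Qed.

Lemma fsq_proj m n (X : 'M[R]_(m, n)) (M : 'M[R]_n) : M^T = M -> M *m M = M ->
  fsq (X *m M) <= fsq X.
Proof.
move=> sM iM.
have e1 : fsq (X *m M) = \tr (X *m M *m X^T).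
  by rewrite fsq_trace trmx_mul sM !mulmxA -(mulmxA X) iM.
have : 0 <= fsq (X *m (1%:M - M)) by exact: fsq_ge0.
have -> : fsq (X *m (1%:M - M)) = fsq X - fsq (X *m M).
  have sM1 : (1%:M - M)^T = 1%:M - M by rewrite linearB /= trmx1 sM.
  rewrite e1 !fsq_trace trmx_mul sM1 !mulmxA -(mulmxA X).
  have -> : (1%:M - M) *m (1%:M - M) = 1%:M - M.
    by rewrite mulmxBl mul1mx mulmxBr mulmx1 iM subrr subr0.
  by rewrite mulmxBr mulmx1 mulmxBl linearB.
by rewrite subr_ge0.
Qed.

Lemma fsq_projl m n (X : 'M[R]_(n, m)) (M : 'M[R]_n) : M^T = M -> M *m M = M ->
  fsq (M *m X) <= fsq X.
Proof. by move=> sM iM; rewrite -fsqT trmx_mul sM -(fsqT X); exact: fsq_proj. Qed.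

(** Expanding the squared norm as a trace and using its cyclicity moves the inner projections to the
    outside of E_s' E_t. *)
Lemma fsq_sum_gram (I : Type) (r : seq I) p q (E : I -> 'M[R]_(p, q))
    (M : 'M[R]_q) : M^T = M -> M *m M = M ->
  fsq (\sum_(t <- r) E t *m M *m (E t)^T) =
  \sum_(s <- r) \sum_(t <- r) fsq (M *m (E s)^T *m E t *m M).
Proof.
move=> sM iM; rewrite fsq_trace linear_sum /= mulmx_suml linear_sum /=.
apply: eq_bigr => s _; rewrite mulmx_sumr linear_sum /=; apply: eq_bigr => t _.
rewrite fsq_trace !trmx_mul sM !trmxK -!mulmxA (mulmxA M M) iM.
transitivity (\tr (M *m ((E s)^T *m (E t *m (M *m ((E t)^T *m E s)))))).
  by rewrite mxtrace_mulC -!mulmxA.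
by rewrite [RHS]mxtrace_mulC -!mulmxA iM [LHS]mxtrace_mulC -!mulmxA.
Qed.

(** The column centering sits between E_t and E_t', where [fsq_proj] does not apply directly. After
    the trace expansion each summand is multiplied by projections from outside and can only
    decrease. *)
Lemma fsq_gram_proj (I : Type) (r : seq I) p q (E : I -> 'M[R]_(p, q))
    (M : 'M[R]_q) : M^T = M -> M *m M = M ->
  fsq (\sum_(t <- r) E t *m M *m (E t)^T) <=
  fsq (\sum_(t <- r) E t *m (E t)^T).
Proof.
move=> sM iM; rewrite fsq_sum_gram //.
have -> : \sum_(t <- r) E t *m (E t)^T = \sum_(t <- r) E t *m 1%:M *m (E t)^T.
  by apply: eq_bigr => t _; rewrite mulmx1.
rewrite fsq_sum_gram ?trmx1 ?mulmx1 //.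
apply: ler_sum => s _; apply: ler_sum => t _.
rewrite mul1mx mulmx1; apply: le_trans (fsq_proj _ sM iM) _.
by rewrite -mulmxA; exact: fsq_projl.
Qed.

Lemma ones_sq m : (ones R m)^T *m ones R m = (m%:R)%:M.
Proof.
apply/matrixP => i j; rewrite !ord1 !mxE eqxx mulr1n.
under eq_bigr do rewrite !mxE mulr1.
by rewrite sumr_const card_ord.
Qed.

Lemma centering_sym m : (centering_mx R m)^T = centering_mx R m.
Proof.
by rewrite /centering_mx linearB /= trmx1 linearZ /= trmx_mul trmxK.
Qed.

Lemma centering_idem m : (0 < m)%N ->
  centering_mx R m *m centering_mx R m = centering_mx R m.
Proof.
move=> m0; have m0' : m%:R != 0 :> R by rewrite pnatr_eq0 -lt0n.
rewrite {1}/centering_mx mulmxBl mul1mx -scalemxAl -mulmxA.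
suff -> : (ones R m)^T *m centering_mx R m = 0 by rewrite mulmx0 scaler0 subr0.
rewrite /centering_mx mulmxBr mulmx1 -scalemxAr mulmxA ones_sq mul_scalar_mx.
by rewrite scalerA mulVf // scale1r subrr.
Qed.

Lemma centering_id m n (A : 'M[R]_(m, n)) : (ones R m)^T *m A = 0 ->
  centering_mx R m *m A = A.
Proof.
by move=> h; rewrite /centering_mx mulmxBl mul1mx -scalemxAl -mulmxA h mulmx0
  scaler0 subr0.
Qed.

Lemma Zhalf_invK m k (A : 'M[R]_(m, k)) : (forall j, 0 < Zdiag A 0 j) ->
  Zhalf_inv A *m Zhalf A = 1%:M.
Proof.
move=> Z0; apply/matrixP => i j; rewrite mul_diag_mx !mxE.
have [ij|ij] := eqVneq i j; last by rewrite mulr0n mulr0.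
by rewrite mulr1n mulVf // gt_eqF // sqrtr_gt0; have := Z0 i; rewrite !mxE.
Qed.

Lemma Zhalf_tr m k (A : 'M[R]_(m, k)) : (Zhalf A)^T = Zhalf A.
Proof. exact: tr_diag_mx. Qed.

Lemma Zhalf_inv_tr m k (A : 'M[R]_(m, k)) : (Zhalf_inv A)^T = Zhalf_inv A.
Proof. exact: tr_diag_mx. Qed.

Lemma sum_Zdiag m k (A : 'M[R]_(m, k)) : \sum_j Zdiag A 0 j = fsq A.
Proof.
rewrite -fsqT fsq_trace trmxK; apply: eq_bigr => j _; by rewrite mxE.
Qed.

End Frobenius.

(** * The eigenvector error for a fixed sample *)

Section Core.
Variable R : realType.

(** That is, N^2 >= lam N when N >= lam I. With N = A'A it bounds |v A|^2 below by lam |v|^2 for v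
    in the column space of A. *)
Lemma psd_image_lb k (N : 'M[R]_k) (lam : R) : 0 < lam ->
  (forall x : 'rV[R]_k, lam * fsq x <= (x *m N *m x^T) 0 0) ->
  forall x : 'rV[R]_k, lam * (x *m N *m x^T) 0 0 <= fsq (x *m N).
Proof.
move=> l0 h x; have hx := h x.
have n0 : 0 <= (x *m N *m x^T) 0 0.
  by apply: le_trans hx; rewrite mulr_ge0 ?fsq_ge0 // ltW.
have CS : (x *m N *m x^T) 0 0 ^+ 2 <= fsq (x *m N) * fsq x.
  have -> : fsq x = fsq x^T by rewrite fsqT.
  have -> : (x *m N *m x^T) 0 0 ^+ 2 = fsq (x *m N *m x^T).
    by rewrite /fsq !big_ord1.
  exact: fsqM.
set a := (_ *m _ *m _) 0 0 in hx n0 CS *; set b := fsq (_ *m _) in CS *.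
have b0 : 0 <= b by exact: fsq_ge0.
have [->|a0] := eqVneq a 0; first by rewrite mulr0.
have ap : 0 < a by rewrite lt_def a0.
rewrite -(ler_pM2r ap) -mulrA -expr2.
apply: (@le_trans _ _ (lam * (b * fsq x))); first by rewrite ler_pM2l.
rewrite mulrCA; exact: ler_wpM2l.
Qed.

(** With N = B'B, replacing the empirical moments of the factors by their means turns T^-1 sum_t F_t
    N F_t' into tr(N) I, where tr(N) = |B|_F^2. Since |N|_F <= tr(N), a total squared moment error
    of 1/4 costs at most half of tr(N), whatever B. *)
Lemma factor_gram_lb (T kr kc q : nat) (B : 'M[R]_(q, kc))
    (F : 'I_T -> 'M[R]_(kr, kc)) :
  \sum_(y : ('I_kr * 'I_kc) * ('I_kr * 'I_kc))
    (\sum_(t < T) T%:R^-1 * (F t y.1.1 y.1.2 * F t y.2.1 y.2.2)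
      - (y.1 == y.2)%:R) ^+ 2 <= 1 / 4 ->
  forall x : 'rV[R]_kr, fsq B / 2 * fsq x <=
    (x *m (T%:R^-1 *: \sum_(t < T) F t *m (B^T *m B) *m (F t)^T) *m x^T) 0 0.
Proof.
pose D y := \sum_(t < T) T%:R^-1 * (F t y.1.1 y.1.2 * F t y.2.1 y.2.2)
      - (y.1 == y.2 :> 'I_kr * 'I_kc)%:R.
move=> hD x; pose N := B^T *m B.
set G := T%:R^-1 *: _; pose tN := fsq B.
have tN0 : 0 <= tN by exact: fsq_ge0.
have GE : G = tN%:M + (G - tN%:M) by rewrite addrC subrK.
pose Del := G - tN%:M.
have trN : tN = \sum_b N b b by rewrite /tN -fsqT fsq_trace trmxK.
have DelE l m : Del l m = \sum_(z : 'I_kc * 'I_kc) N z.1 z.2 * D ((l, z.1), (m, z.2)).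
  rewrite /Del /D /=; under eq_bigr do rewrite mulrBr.
  rewrite sumrB mxE [X in _ + X]mxE; congr (_ - _); last first.
    rewrite [tN%:M l m]mxE (sum_pairE (fun z : 'I_kc * 'I_kc =>
      N z.1 z.2 * ((l, z.1) == (m, z.2))%:R)) /=.
    case: eqVneq => [->|lm]; last first.
      rewrite mulr0n big1 // => b _; rewrite big1 // => b' _.
      by rewrite xpair_eqE (negbTE lm) mulr0.
    rewrite mulr1n trN; apply: eq_bigr => b _.
    rewrite (bigD1 b) //= eqxx mulr1 big1 ?addr0 // => b' bb.
    by rewrite xpair_eqE eqxx eq_sym (negbTE bb) mulr0.
  rewrite mxE summxE mulr_sumr.
  under [RHS]eq_bigr do rewrite mulr_sumr.
  rewrite exchange_big /=; apply: eq_bigr => t _.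
  rewrite mxE (sum_pairE (fun z : 'I_kc * 'I_kc => N z.1 z.2 * (T%:R^-1 *
    (F t l z.1 * F t m z.2)))) /= exchange_big /= mulr_sumr.
  apply: eq_bigr => b' _; rewrite !mxE mulr_suml mulr_sumr.
  by apply: eq_bigr => b _; rewrite -/N; ring.
have fDel : fsq Del <= (tN / 2) ^+ 2.
  apply: (@le_trans _ _ (\sum_l \sum_m (fsq N *
     \sum_(z : 'I_kc * 'I_kc) D ((l, z.1), (m, z.2)) ^+ 2))).
    apply: ler_sum => l _; apply: ler_sum => m _; rewrite DelE.
    apply: le_trans (sum_CS _ _ _) _; apply: ler_wpM2r.
      by apply: sumr_ge0 => z _; exact: sqr_ge0.
    by rewrite (sum_pairE (fun z : 'I_kc * 'I_kc => N z.1 z.2 ^+ 2)).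
  under eq_bigr do rewrite -mulr_sumr.
  rewrite -mulr_sumr.
  have fN : fsq N <= tN ^+ 2.
    by apply: le_trans (fsqM _ _) _; rewrite fsqT expr2.
  have sD : \sum_l \sum_m \sum_(z : 'I_kc * 'I_kc) D ((l, z.1), (m, z.2)) ^+ 2 <= 1 / 4.
    apply: le_trans hD; rewrite le_eqVlt; apply/orP; left; apply/eqP.
    rewrite [RHS]sum_pairE /= [RHS]sum_pairE /=; apply: eq_bigr => l _.
    under [RHS]eq_bigr do rewrite sum_pairE /=.
    rewrite [RHS]exchange_big /=; apply: eq_bigr => m _.
    by rewrite sum_pairE.
  have := ler_pM (fsq_ge0 N) _ fN sD.
  have -> : (tN / 2) ^+ 2 = tN ^+ 2 * (1 / 4) by field.
  apply; apply: sumr_ge0 => l _; apply: sumr_ge0 => m _; apply: sumr_ge0 => z _.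
  exact: sqr_ge0.
have hq := quad_le x (divr_ge0 tN0 (ler0n _ 2)) fDel.
rewrite GE mulmxDr mulmxDl mxE mul_mx_scalar -scalemxAl mxE -fsq_row.
have := ler_norm (- (x *m Del *m x^T) 0 0); rewrite normrN -/Del -/tN => h1.
have : - (tN / 2 * fsq x) <= (x *m Del *m x^T) 0 0 by lra.
lra.
Qed.

(** All randomness is confined to the numbers [g], [x], [lam], [gam]. The condition on [g] makes the
    noise at most a quarter of gam lam, the strength of the signal on the column space of [A]. *)
Lemma eigenvector_error (p q T kr kc : nat) (A : 'M[R]_(p, kr))
    (B : 'M[R]_(q, kc)) (F : nat -> 'M[R]_(kr, kc)) (E : nat -> 'M[R]_(p, q))
    (S : 'M[R]_p) (Q : 'M[R]_(p, kr)) (D : 'rV[R]_kr) (g x lam gam : R) :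
  let L t := A *m F t *m B^T + centering_mx R p *m E t *m centering_mx R q in
  let FZ t := Zhalf A *m F t *m Zhalf B in
  let Qa := A *m Zhalf_inv A in let Qb := B *m Zhalf_inv B in
  (0 < p)%N -> (0 < q)%N -> 0 < lam -> 0 < gam ->
  (ones R p)^T *m A = 0 -> (ones R q)^T *m B = 0 ->
  (forall j, 0 < Zdiag A 0 j) -> (forall j, 0 < Zdiag B 0 j) ->
  S = T%:R^-1 *: \sum_(1 <= t < T.+1) L t *m (L t)^T ->
  leading_eigen S Q D ->
  fsq (T%:R^-1 *: \sum_(1 <= t < T.+1) E t *m (E t)^T) <= g ->
  fsq (T%:R^-1 *: \sum_(1 <= t < T.+1) F t *m B^T *m (E t)^T) <= x ->
  (forall v : 'rV[R]_kr, lam * fsq v <= (v *m (A^T *m A) *m v^T) 0 0) ->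
  (forall v : 'rV[R]_kr, gam * fsq v <=
    (v *m (T%:R^-1 *: \sum_(1 <= t < T.+1) F t *m (B^T *m B) *m (F t)^T) *m v^T) 0 0) ->
  g <= (gam * lam / 4) ^+ 2 ->
  fsq (Q - Qa *m (T%:R^-1 *: (invmx (diag_mx D) *m Q^T *m Qa *m
     \sum_(1 <= t < T.+1) FZ t *m Qb^T *m Qb *m (FZ t)^T))^T) <=
  (8 * (fsq A * x) + 2 * g) * (kr%:R ^+ 2 * (8 / (gam * lam)) ^+ 2).
Proof.
move=> L FZ Qa Qb p0 q0 lam0 gam0 A0 B0 ZA ZB SE lead hg hx hA hF hgl.
set r := index_iota 1 T.+1.
set Mp := centering_mx R p; set Mq := centering_mx R q.
have sMp : Mp^T = Mp by exact: centering_sym.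
have sMq : Mq^T = Mq by exact: centering_sym.
have iMp : Mp *m Mp = Mp by exact: centering_idem.
have iMq : Mq *m Mq = Mq by exact: centering_idem.
have MpA : Mp *m A = A by exact: centering_id.
have MqB : Mq *m B = B by exact: centering_id.
have BMq : B^T *m Mq = B^T by rewrite -sMq -trmx_mul MqB.
pose C t := A *m F t *m B^T; pose Et t := Mp *m E t *m Mq.
pose c := (T%:R^-1 : R).
have c0 : 0 <= c by rewrite invr_ge0.
pose CC := c *: \sum_(t <- r) C t *m (C t)^T.
pose CE := c *: \sum_(t <- r) C t *m (Et t)^T.
pose EE := c *: \sum_(t <- r) Et t *m (Et t)^T.
have Sdec : S = CC + (CE + CE^T + EE).
  have CET : CE^T = c *: \sum_(t <- r) Et t *m (C t)^T.
    rewrite /CE linearZ /= linear_sum /=; congr (_ *: _); apply: eq_bigr => t _.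
    by rewrite trmx_mul trmxK.
  rewrite SE CET /CC /CE /EE -!scalerDr -/c; congr (_ *: _).
  rewrite -!big_split /=; apply: eq_bigr => t _.
  rewrite /L -/(C t) -/(Et t) linearD /= mulmxDl !mulmxDr trmx_mul trmxK.
  by rewrite !addrA addrAC -!addrA.
have EEg : fsq EE <= g.
  apply: le_trans hg; rewrite /EE !fsqZ; apply: ler_wpM2l; first exact: sqr_ge0.
  have -> : \sum_(t <- r) Et t *m (Et t)^T =
      Mp *m (\sum_(t <- r) E t *m Mq *m (E t)^T) *m Mp.
    rewrite mulmx_sumr mulmx_suml; apply: eq_bigr => t _.
    rewrite /Et !trmx_mul sMp sMq -!mulmxA (mulmxA Mq Mq) iMq //.
  apply: le_trans (fsq_proj _ sMp iMp) _; apply: le_trans (fsq_projl _ sMp iMp) _.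
  exact: fsq_gram_proj.
have CEx : fsq CE <= fsq A * x.
  have -> : CE = A *m (c *: \sum_(t <- r) F t *m B^T *m (E t)^T) *m Mp.
    rewrite /CE -scalemxAr -scalemxAl; congr (_ *: _).
    rewrite mulmx_sumr mulmx_suml; apply: eq_bigr => t _.
    by rewrite /C /Et !trmx_mul sMp sMq -!mulmxA (mulmxA B^T Mq) BMq.
  apply: le_trans (fsq_proj _ sMp iMp) _; apply: le_trans (fsqM _ _) _.
  by apply: ler_wpM2l => //; exact: fsq_ge0.
have quadsum (X : nat -> 'M[R]_(p, q)) (v : 'rV[R]_p) :
    (v *m (c *: \sum_(t <- r) X t *m (X t)^T) *m v^T) 0 0 =
    c * \sum_(t <- r) fsq (v *m X t).
  rewrite -scalemxAr -scalemxAl mxE mulmx_sumr mulmx_suml summxE; congr (_ * _).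
  by apply: eq_bigr => t _; rewrite fsq_row trmx_mul !mulmxA.
(* Below, gam lam |v|^2 <= 2 v S v' + 2 (gam lam / 4) |v|^2, so v S v' >= (gam lam / 4) |v|^2; half
   of this leaves a strict inequality. *)
pose l := gam * lam / 8.
have gl0 : 0 < gam * lam by rewrite mulr_gt0.
have l0 : 0 < l by rewrite divr_gt0.
have symS : S^T = S.
  rewrite SE linearZ /= linear_sum /=; congr (_ *: _); apply: eq_bigr => t _.
  by rewrite trmx_mul trmxK.
have Dl : forall j, l < D 0 j.
  apply: (leading_eigen_lb symS lead (A := A)) => y y0.
  pose v := y *m A^T.
  have vv : fsq v = (y *m (A^T *m A) *m y^T) 0 0.
    by rewrite fsq_row trmx_mul trmxK !mulmxA.
  have y0' : 0 < fsq y.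
    rewrite lt_def fsq_ge0 andbT; apply: contra y0 => /eqP h.
    apply/eqP/matrixP => i j; rewrite !ord1 mxE; apply/eqP.
    rewrite -sqrf_eq0 eq_le sqr_ge0 andbT -h /fsq big_ord1 (bigD1 j) //= lerDl.
    by apply: sumr_ge0 => k _; exact: sqr_ge0.
  have v0 : 0 < fsq v by rewrite vv; apply: lt_le_trans (hA y); rewrite mulr_gt0.
  have -> : (y *m (A^T *m (S - l%:M) *m A) *m y^T) 0 0 =
      (v *m S *m v^T) 0 0 - l * fsq v.
    have -> : y *m (A^T *m (S - l%:M) *m A) *m y^T = v *m S *m v^T - l *: (v *m v^T).
      rewrite /v trmx_mul trmxK !mulmxA mulmxBr mulmxBl mulmxBl; congr (_ - _).
      by rewrite mul_mx_scalar -!scalemxAl.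
    by rewrite mxE [X in _ + X]mxE [X in _ - X]mxE -fsq_row.
  rewrite subr_gt0.
  have vS : (v *m S *m v^T) 0 0 = c * \sum_(t <- r) fsq (v *m L t).
    by rewrite SE quadsum.
  have vE : c * \sum_(t <- r) fsq (v *m Et t) <= gam * lam / 4 * fsq v.
    rewrite -quadsum; apply: le_trans (ler_norm _) _; apply: quad_le.
      by rewrite divr_ge0 // ltW.
    exact: le_trans EEg hgl.
  have vC : gam * (lam * fsq v) <= c * \sum_(t <- r) fsq (v *m C t).
    apply: (@le_trans _ _ (gam * fsq (v *m A))).
      rewrite ler_pM2l // vv.
      have -> : v *m A = y *m (A^T *m A) by rewrite /v mulmxA.
      exact: psd_image_lb.
    apply: le_trans (hF _) _; rewrite -quadsum le_eqVlt; apply/orP; left; apply/eqP.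
    congr (fun_of_matrix _ 0 0); rewrite -!scalemxAr -!scalemxAl; congr (_ *: _).
    rewrite !mulmx_sumr !mulmx_suml; apply: eq_bigr => t _.
    by rewrite /C !trmx_mul !trmxK !mulmxA.
  (* Signal is data minus noise, so 2|a|^2 + 2|b|^2 absorbs the cross terms. *)
  have vL : c * \sum_(t <- r) fsq (v *m C t) <=
      2 * (c * \sum_(t <- r) fsq (v *m L t)) + 2 * (c * \sum_(t <- r) fsq (v *m Et t)).
    rewrite !(mulrCA 2) -mulrDr; apply: ler_wpM2l => //.
    rewrite !mulr_sumr -big_split /=; apply: ler_sum => t _.
    have -> : v *m C t = v *m L t + - (v *m Et t).
      by rewrite /L -/(C t) -/(Et t) mulmxDr addrK.
    apply: le_trans (fsqD _ _) _; rewrite -scaleN1r fsqZ sqrrN expr1n mul1r //.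
  rewrite vS /l.
  have : 0 < gam * lam * fsq v by rewrite mulr_gt0.
  by rewrite [gam * (_ * _)]mulrA in vC; lra.
have D0 j : D 0 j != 0 by rewrite gt_eqF // (lt_trans l0).
pose Di : 'rV[R]_kr := map_mx GRing.inv D.
have DiE : diag_mx Di *m diag_mx D = 1%:M.
  apply/matrixP => i j; rewrite mul_diag_mx !mxE.
  by case: eqVneq; rewrite ?mulr0n ?mulr0 // mulr1n mulVf.
have invD : invmx (diag_mx D) = diag_mx Di.
  have [uD _] := mulmx1_unit (mulmx1C DiE).
  by rewrite -[LHS]mul1mx -DiE mulmxK.
have DDi : diag_mx D *m diag_mx Di = 1%:M by exact: mulmx1C.
have [QQ SQ _] := lead.
have QaFZ t : Qa *m FZ t *m Qb^T = C t.
  rewrite /Qa /FZ /Qb /C trmx_mul Zhalf_inv_tr -!mulmxA.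
  rewrite (mulmxA (Zhalf B)) -[Zhalf B *m _]trmxK trmx_mul Zhalf_tr Zhalf_inv_tr.
  by rewrite Zhalf_invK // trmx1 mul1mx (mulmxA (Zhalf_inv A)) Zhalf_invK // mul1mx.
pose Sg := \sum_(1 <= t < T.+1) FZ t *m Qb^T *m Qb *m (FZ t)^T.
have key : Qa *m Sg^T *m Qa^T = \sum_(t <- r) C t *m (C t)^T.
  rewrite /Sg linear_sum /= mulmx_sumr mulmx_suml; apply: eq_bigr => t _.
  by rewrite -!QaFZ !trmx_mul !trmxK !mulmxA.
have -> : Qa *m (T%:R^-1 *: (invmx (diag_mx D) *m Q^T *m Qa *m Sg))^T =
    CC *m Q *m diag_mx Di.
  rewrite invD linearZ /= -scalemxAr /CC -!scalemxAl; congr (_ *: _).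
  rewrite trmx_mul [(_ *m Qa)^T]trmx_mul [(diag_mx Di *m _)^T]trmx_mul.
  by rewrite tr_diag_mx trmxK -key !mulmxA.
(* The eigenvector equation gives Q = S Q D^-1, and S minus the signal Gram matrix [CC] is the
   residual. *)
have -> : Q - CC *m Q *m diag_mx Di = (CE + CE^T + EE) *m Q *m diag_mx Di.
  rewrite -[X in X - _]mulmx1 -DDi mulmxA -SQ -!mulmxBl; congr (_ *m _ *m _).
  by rewrite Sdec addrC addKr.
apply: le_trans (fsqM _ _) _.
(* One factor [kr] is the squared norm of the orthonormal columns of Q, the other counts the entries
   of D^-1, each below l^-1. *)
apply: (@le_trans _ _ (fsq (CE + CE^T + EE) * kr%:R * (kr%:R * (l^-1) ^+ 2))).
  apply: ler_pM; rewrite ?fsq_ge0 //.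
    apply: le_trans (fsqM _ _) _; apply: ler_wpM2l; first exact: fsq_ge0.
    by rewrite -fsqT fsq_trace trmxK QQ mxtrace1.
  rewrite /fsq; apply: (@le_trans _ _ (\sum_(i < kr) l^-1 ^+ 2)); last first.
    by rewrite sumr_const card_ord mulr_natl.
  apply: ler_sum => i _; rewrite (bigD1 i) //= big1 ?addr0; last first.
    by move=> j ji; rewrite !mxE eq_sym (negbTE ji) mulr0n expr0n.
  have Dp : 0 < D 0 i := lt_trans l0 (Dl i).
  rewrite !mxE eqxx mulr1n ler_sqr ?nnegrE ?invr_ge0 //.
  - by rewrite lef_pV2 ?posrE // ltW.
  - exact: ltW.
  - exact: ltW.
have -> : 8 / (gam * lam) = l^-1 by rewrite /l invf_div.
have -> : fsq (CE + CE^T + EE) * kr%:R * (kr%:R * l^-1 ^+ 2) =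
  fsq (CE + CE^T + EE) * (kr%:R ^+ 2 * l^-1 ^+ 2) by ring.
apply: ler_wpM2r; first by rewrite mulr_ge0 // sqr_ge0.
apply: le_trans (fsqD3 _ _ _) _; rewrite fsqT.
by move: CEx EEg; lra.
Qed.

End Core.

(** * The loadings *)

Section Eventually.
Context {R : realType} {d : measure_display} {Om : measurableType d}.
Variable P : probability Om R.

(* Continuity of P from below turns almost sure asymptotics into events of
   probability at least 1 - e that do not depend on n. *)
Lemma ae_eventually_whp (ev : nat -> nat -> set Om) (e : R) :
  (forall K n, measurable (ev K n)) ->
  (forall K K' n, (K <= K')%N -> ev K n `<=` ev K' n) ->
  {ae P, forall w, exists K : nat, forall n, (K <= n)%N -> ev K n w} -> 0 < e ->
  exists K : nat, whp P e (fun w => forall n, (K <= n)%N -> ev K n w).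
Proof.
move=> mev hom hae e0.
pose G K := \bigcap_(n in [set n | (K <= n)%N]) ev K n.
have mG K : measurable (G K) by apply: bigcap_measurable => [|n _]; [exists K => /=|exact: mev].
have mU : measurable (\bigcup_K G K) by exact: bigcupT_measurable.
have hG : {homo G : n m / (n <= m)%N >-> (n <= m)%O}.
  move=> a b ab; apply/subsetPset => w hw n /= bn.
  exact: (hom _ _ _ ab) (hw n (leq_trans ab bn)).
have PU : P (\bigcup_K G K) = 1%E.
  have P0 : P (~` \bigcup_K G K) = 0%E.
    apply: measure_negligible; first exact: measurableC.
    apply: negligibleS hae => w /= hw [K hK]; apply: hw; exists K => // n; exact: hK.
  by have := probability_setC P (measurableC mU); rewrite setCK P0 sube0.
have cv : (P \o G) @ \oo --> (1%E : \bar R).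
  by rewrite -PU; exact: nondecreasing_cvg_mu.
have : \forall K \near \oo, ((1 - e)%:E < P (G K))%E.
  apply: (cv [set x | ((1 - e)%:E < x)%E]); rewrite /=.
  apply: (@open_nbhs_nbhs _ (1%E : \bar R) [set x | ((1 - e)%:E < x)%E]); split.
    exact: open_ereal_gt_ereal.
  by rewrite /= lte_fin ltrBlDr ltrDl.
case=> K _ /(_ K (leqnn K)) /= hK; exists K, (~` G K); split.
- exact: measurableC.
- rewrite probability_setC //.
  by rewrite leeBlDr ?fin_num_measure // -leeBlDl // -EFinB; exact: ltW.
- by move=> w /contrapT hw n Kn; exact: hw.
Qed.

End Eventually.

Section PosDef.
Variable R : realType.

(** A spectral gap without eigenvalues: x_i is the S-inner product of x with e_i S^-1, so
    Cauchy-Schwarz for that inner product gives |x|^2 <= tr(S^-1) x S x'. *)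
Lemma pos_def_lb k (S : 'M[R]_k) : pos_def S ->
  exists2 kap, 0 < kap & forall x : 'rV[R]_k, kap * fsq x <= (x *m S *m x^T) 0 0.
Proof.
case=> Ssym Spos.
have pos (x : 'rV[R]_k) : x != 0 -> 0 < (x *m S *m x^T) 0 0.
  by move=> x0; have := Spos x^T; rewrite trmxK; apply; rewrite -trmx0 (inj_eq trmx_inj).
have nneg (x : 'rV[R]_k) : 0 <= (x *m S *m x^T) 0 0.
  by have [->|/pos/ltW//] := eqVneq x 0; rewrite !mul0mx mxE.
have Su : S \in unitmx.
  rewrite -row_free_unit; apply: inj_row_free => v vS.
  apply/eqP; apply/negP => /negP/pos; rewrite vS mul0mx mxE ltxx //.
have CS (x u : 'rV[R]_k) : (x *m S *m u^T) 0 0 ^+ 2 <=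
    (x *m S *m x^T) 0 0 * (u *m S *m u^T) 0 0.
  set a := (x *m S *m u^T) 0 0; set b := (u *m S *m u^T) 0 0.
  have a' : (u *m S *m x^T) 0 0 = a.
    by rewrite /a -[in RHS](trmxK (x *m S *m u^T)) [RHS]mxE !trmx_mul trmxK Ssym mulmxA.
  have [u0|u0] := eqVneq u 0.
    by rewrite /a /b u0 trmx0 !mulmx0 mxE expr0n /= mulr0.
  have b0 : 0 < b by exact: pos.
  have := nneg (b *: x - a *: u).
  have -> : (b *: x - a *: u)^T = b *: x^T - a *: u^T.
    by apply/matrixP => i j; rewrite !mxE.
  rewrite !mulmxBl !mulmxBr -!scalemxAl -!scalemxAr.
  have quad (X Y Z W : 'M[R]_1) (f g : R) : Z 0 0 = Y 0 0 ->
      (f *: (f *: X) - f *: (g *: Y) - (g *: (f *: Z) - g *: (g *: W))) 0 0 =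
      f ^+ 2 * X 0 0 - 2 * f * g * Y 0 0 + g ^+ 2 * W 0 0.
    by move=> ZY; rewrite !mxE ZY; ring.
  rewrite quad // -/a -/b; set c := (x *m S *m x^T) 0 0.
  rewrite (_ : _ + _ = b * (c * b - a ^+ 2)); last by ring.
  by rewrite pmulr_rge0 // subr_ge0.
pose u i : 'rV[R]_k := delta_mx 0 i *m invmx S.
(* This is tr(S^-1); the constant is (1 + s)^-1 so that k = 0 causes no division by zero. *)
pose s := \sum_i (u i *m S *m (u i)^T) 0 0.
have s0 : 0 <= s by apply: sumr_ge0 => i _.
exists (1 + s)^-1; first by rewrite invr_gt0 ltr_pwDl.
move=> x; rewrite mulrC ler_pdivrMr ?ltr_pwDl // (@le_trans _ _ ((x *m S *m x^T) 0 0 * s)) //;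
  last by rewrite ler_wpM2l ?lerDr.
rewrite /s mulr_sumr /fsq big_ord1; apply: ler_sum => i _.
apply: le_trans (CS x (u i)).
have -> : x *m S *m (u i)^T = x *m (delta_mx 0 i)^T.
  by rewrite /u trmx_mul trmx_inv Ssym mulmxA -(mulmxA x) mulmxV // mulmx1.
by rewrite trmx_delta -colE mxE.
Qed.

End PosDef.

Section Loading.
Context {R : realType} {d : measure_display} {Om : measurableType d}.
Variable P : probability Om R.

Lemma Zdiag_ge0 m k (A : 'M[R]_(m, k)) j : 0 <= Zdiag A 0 j.
Proof.
rewrite !mxE; apply: sumr_ge0 => i _; rewrite !mxE -expr2; exact: sqr_ge0.
Qed.

Definition scaled_gram m k (A : 'M[R]_(m, k)) : 'M[R]_k :=
  Zhalf_inv A *m A^T *m A *m Zhalf_inv A.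

(** The inverse square roots are rewritten as real powers, whose measurability is at hand. *)
Lemma scaled_gramE m k (A : 'M[R]_(m, k)) i j : scaled_gram A i j =
  Zdiag A 0 i `^ (- 2^-1) * (A^T *m A) i j * Zdiag A 0 j `^ (- 2^-1).
Proof.
have sq l : Zdiag A 0 l `^ (- 2^-1) = (Num.sqrt (Zdiag A 0 l))^-1.
  by rewrite powRN powR12_sqrt ?Zdiag_ge0.
rewrite /scaled_gram /Zhalf_inv mul_mx_diag mxE -(mulmxA (diag_mx _)) mul_diag_mx mxE.
by rewrite ![map_mx _ _ _ _]mxE !sq.
Qed.

Section Measurability.
Variables (m k : nat) (A : Om -> 'M[R]_(m, k)).
Hypothesis mA : random_mx A.

Lemma measurable_gram i j : measurable_fun setT (fun w => ((A w)^T *m A w) i j).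
Proof.
rewrite (_ : (fun _ => _) = (fun w => \sum_l A w l i * A w l j)); last first.
  by apply/funext => w; rewrite mxE; apply: eq_bigr => l _; rewrite mxE.
by apply: measurable_sum => l; apply: measurable_funM; exact: mA.
Qed.

Lemma measurable_Zdiag j : measurable_fun setT (fun w => Zdiag (A w) 0 j).
Proof.
by rewrite (_ : (fun _ => _) = (fun w => ((A w)^T *m A w) j j));
  [exact: measurable_gram|apply/funext => w; rewrite mxE].
Qed.

Lemma measurable_scaled_gram i j :
  measurable_fun setT (fun w => scaled_gram (A w) i j).
Proof.
rewrite (_ : (fun _ => _) = (fun w => Zdiag (A w) 0 i `^ (- 2^-1) *
   ((A w)^T *m A w) i j * Zdiag (A w) 0 j `^ (- 2^-1))); last first.
  by apply/funext => w; rewrite scaled_gramE.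
apply: measurable_funM; [apply: measurable_funM|]; try exact: measurable_gram.
  by apply: (measurableT_comp (measurable_powR _)); exact: measurable_Zdiag.
by apply: (measurableT_comp (measurable_powR _)); exact: measurable_Zdiag.
Qed.

Lemma measurable_fsq : measurable_fun setT (fun w => fsq (A w)).
Proof.
by apply: measurable_sum => i; apply: measurable_sum => j; apply: measurable_funX.
Qed.

End Measurability.

(** In the variable y = x Z^{1/2} the form is that of the scaled Gram matrix, which differs from S
    by at most kap/2 and so stays above kap/2; moreover |y|^2 >= z |x|^2. *)
Lemma scaled_gram_lb m k (A : 'M[R]_(m, k)) (S : 'M[R]_k) kap z :
  0 < kap -> 0 < z ->
  (forall x : 'rV[R]_k, kap * fsq x <= (x *m S *m x^T) 0 0) ->
  (forall j, z <= Zdiag A 0 j) ->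
  fsq (scaled_gram A - S) <= (kap / 2) ^+ 2 ->
  forall x : 'rV[R]_k, kap / 2 * z * fsq x <= (x *m (A^T *m A) *m x^T) 0 0.
Proof.
move=> kap0 z0 hS hZ hM x.
have Z0 j : 0 < Zdiag A 0 j by exact: lt_le_trans z0 (hZ j).
have ZiZ := Zhalf_invK Z0.
have ZZi : Zhalf A *m Zhalf_inv A = 1%:M by exact: mulmx1C.
pose y := x *m Zhalf A.
have -> : x *m (A^T *m A) *m x^T = y *m scaled_gram A *m y^T.
  rewrite /y trmx_mul Zhalf_tr /scaled_gram !mulmxA.
  rewrite -(mulmxA x (Zhalf A) (Zhalf_inv A)) ZZi mulmx1.
  by rewrite -(mulmxA _ (Zhalf_inv A) (Zhalf A)) ZiZ mulmx1.
rewrite -(subrK S (scaled_gram A)) mulmxDr mulmxDl mxE.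
have fy : z * fsq x <= fsq y.
  rewrite /fsq !big_ord1 mulr_sumr; apply: ler_sum => j _.
  rewrite /y mul_mx_diag mxE [map_mx _ _ _ _]mxE exprMn sqr_sqrtr ?Zdiag_ge0 //.
  by rewrite mulrC ler_wpM2l ?sqr_ge0.
have := @quad_le R _ (scaled_gram A - S) y (kap / 2) _ hM.
rewrite divr_ge0 ?(ltW kap0) // => /(_ isT); rewrite ler_norml => /andP[h _].
have hy := hS y.
have : kap / 2 * (z * fsq x) <= kap / 2 * fsq y by rewrite ler_wpM2l // divr_ge0 // ltW.
lra.
Qed.

(** A single natural number serves as constant and as starting rank, the form required by
    [ae_eventually_whp]. *)
Lemma asymp_bounds (a b : nat -> R) : (forall n, 0 <= a n) -> (forall n, 0 <= b n) ->
  asymp a b -> exists K : nat, forall n, (K <= n)%N ->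
    a n <= K%:R * b n /\ b n <= K%:R * a n.
Proof.
move=> a0 b0 [/eqO_exP[k k0 [N1 _ h1]] /eqO_exP[k' k0' [N2 _ h2]]].
exists (maxn (maxn N1 N2) (Num.truncn (Num.max k k')).+1) => n; rewrite !geq_max => /andP[/andP[n1 n2] n3].
have kk : Num.max k k' <= (maxn (maxn N1 N2) (Num.truncn (Num.max k k')).+1)%:R.
  apply: (@le_trans _ _ ((Num.truncn (Num.max k k')).+1)%:R); first exact/ltW/truncnS_gt.
  by rewrite ler_nat leq_maxr.
move: kk; rewrite ge_max => /andP[kk kk'].
have /= := h1 n n1; rewrite !ger0_norm // => ha.
have /= := h2 n n2; rewrite !ger0_norm // => hb; split.
  by apply: le_trans ha _; rewrite ler_wpM2r.
by apply: le_trans hb _; rewrite ler_wpM2r.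
Qed.

(** The weakest column, with exponent [delta k], governs the lower bound on A'A; the strongest, with
    exponent [delta 1], governs |A|_F^2 from below; and [delta 1 <= 1] gives the upper bound. The
    constant depends on [e] but not on n, although the assumptions only hold almost surely in the
    limit. *)
Lemma loading_whp k (sz : nat -> nat) (A : forall n, Om -> 'M[R]_(sz n, k))
    (delta : nat -> R) e : (0 < k)%N -> sz @ \oo --> \oo ->
  loading_strength P A delta -> 0 < e ->
  exists2 K : R, 0 < K & \forall n \near \oo, whp P e (fun w =>
    [/\ forall j, 0 < Zdiag (A n w) 0 j,
        forall x : 'rV[R]_k, K^-1 * (sz n)%:R `^ delta k * fsq x <=
          (x *m ((A n w)^T *m A n w) *m x^T) 0 0,
        (sz n)%:R `^ delta 1%N <= K * fsq (A n w) &
        fsq (A n w) <= K * (sz n)%:R]).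
Proof.
move=> k0 sz_oo [hm [S [Spd _ hS]] hZ [_ dmono d1]] e0.
have mA n : random_mx (A n) by case: (hm n).
have [kap kap0 hkap] := pos_def_lb Spd.
pose b n (j : 'I_k) : R := (sz n)%:R `^ delta j.+1.
pose ev K n : set Om :=
  (\bigcap_(j : 'I_k) ([set w | Zdiag (A n w) 0 j <= K%:R * b n j] `&`
                       [set w | b n j <= K%:R * Zdiag (A n w) 0 j])) `&`
  [set w | fsq (scaled_gram (A n w) - S) <= (kap / 2) ^+ 2].
have mle (f g : Om -> R) : measurable_fun setT f -> measurable_fun setT g ->
    measurable [set w | f w <= g w].
  move=> mf mg.
  have : measurable ([set: Om] `&` (fun w => f w <= g w) @^-1` [set true]).
    exact: measurable_fun_ler.
  by rewrite setTI.
have mev K n : measurable (ev K n).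
  apply: measurableI.
    apply: fin_bigcap_measurable => // j _; apply: measurableI; apply: mle.
    - exact: measurable_Zdiag.
    - exact: measurable_cst.
    - exact: measurable_cst.
    - by apply: measurable_funM; [exact: measurable_cst|exact: measurable_Zdiag].
  apply: mle; last exact: measurable_cst.
  apply: measurable_fsq => i j.
  rewrite (_ : (fun _ => _) = (fun w => scaled_gram (A n w) i j - S i j)); last first.
    by apply/funext => w; rewrite !mxE.
  by apply: measurable_funB; [exact: measurable_scaled_gram|exact: measurable_cst].
have hom K K' n : (K <= K')%N -> ev K n `<=` ev K' n.
  move=> KK w [h1 h2]; split => // j _; have [h3 h4] := h1 j I; split.
    by apply: le_trans h3 _; rewrite ler_wpM2r ?powR_ge0 ?ler_nat.
  by apply: le_trans h4 _; rewrite ler_wpM2r ?Zdiag_ge0 ?ler_nat.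
have hae : {ae P, forall w, exists K : nat, forall n, (K <= n)%N -> ev K n w}.
  have hZ' : {ae P, forall w, forall j : 'I_k,
      asymp (fun n => Zdiag (A n w) 0 j) (fun n => b n j)} by exact: filter_forall.
  apply: filterS2 hS hZ' => w cS cZ.
  have [Kf hKf] : exists Kf : 'I_k -> nat, forall j n, (Kf j <= n)%N ->
      Zdiag (A n w) 0 j <= (Kf j)%:R * b n j /\ b n j <= (Kf j)%:R * Zdiag (A n w) 0 j.
    apply: (@fin_all_exists 'I_k (fun=> nat) (fun j N => forall n, (N <= n)%N ->
      Zdiag (A n w) 0 j <= N%:R * b n j /\ b n j <= N%:R * Zdiag (A n w) 0 j)).
    move=> j; apply: asymp_bounds (cZ j) => n; first exact: Zdiag_ge0.
    exact: powR_ge0.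
  have eta0 : 0 < kap / 2 / k%:R by rewrite !divr_gt0 // ltr0n.
  have : \forall n \near \oo, forall i j,
      `|scaled_gram (A n w) i j - S i j| < kap / 2 / k%:R.
    apply: filter_forall => i; apply: filter_forall => j.
    apply: cvgr_distC_lt => //.
    exact: (continuous_cvg _ (@coord_continuous _ _ _ i j S) cS).
  case=> N _ hN; exists (maxn (\max_j Kf j) N) => n; rewrite geq_max => /andP[n1 n2]; split.
    move=> j _; have [|h1 h2] := hKf j n; first exact: leq_trans (leq_bigmax j) n1.
    have KK : ((Kf j)%:R : R) <= (maxn (\max_j Kf j) N)%:R.
      by rewrite ler_nat; apply: leq_trans (leq_bigmax j) _; exact: leq_maxl.
    split; [apply: le_trans h1 _|apply: le_trans h2 _]; rewrite ler_wpM2r ?Zdiag_ge0 //.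
    exact: powR_ge0.
  rewrite /= /fsq (@le_trans _ _ (\sum_(i < k) \sum_(j < k) (kap / 2 / k%:R) ^+ 2)) //.
    apply: ler_sum => i _; apply: ler_sum => j _; rewrite -real_normK ?num_real //.
    have := hN n n2 i j; rewrite /= => /ltW hij.
    rewrite ler_pXn2r ?nnegrE ?normr_ge0 ?(ltW eta0) //.
    by move: hij; rewrite [X in _ -> `|X| <= _]mxE [X in _ -> `|_ + X| <= _]mxE.
  rewrite sumr_const card_ord sumr_const card_ord -mulrnA -[_ *+ _]mulr_natr natrM.
  have k0' : k%:R != 0 :> R by rewrite pnatr_eq0 -lt0n.
  by rewrite (_ : _ * _ = (kap / 2) ^+ 2) //; field.
have [K hK] := ae_eventually_whp mev hom hae e0.
(* One constant for all four conclusions: the first factor covers the lower bound on A'A, the last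
   one the sum over the [k] columns, and [K.+1] avoids K = 0. The outer factors are at least 1, so
   dropping them is harmless. *)
pose K1 : R := Num.max (kap / 2)^-1 1 * K.+1%:R * k%:R.
have km0 : 0 < Num.max (kap / 2)^-1 1 by rewrite lt_max ltr01 orbT.
have km1 : 1 <= Num.max (kap / 2)^-1 1 by rewrite le_max lexx orbT.
have kR : 1 <= (k%:R : R) by rewrite ler1n.
exists K1; first by rewrite /K1 !mulr_gt0 // ltr0n.
have sz0 : \forall n \near \oo, (0 < sz n)%N by exact: (sz_oo _ (nbhs_infty_gt 0)).
near=> n.
have sn : (0 < sz n)%N by near: n.
have Kn : (K <= n)%N by near: n; exact: nbhs_infty_ge.
apply: whp_mono hK => // w /(_ n Kn) [h1 h2].
have z1 : 1 <= ((sz n)%:R : R) by rewrite ler1n.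
have b0 j : 0 < b n j by apply: powR_gt0; rewrite ltr0n.
have hb j : b n j <= K%:R * Zdiag (A n w) 0 j by have [] := h1 j I.
have hb' j : Zdiag (A n w) 0 j <= K%:R * b n j by have [] := h1 j I.
have KK1 : (K%:R : R) <= K.+1%:R by rewrite ler_nat.
have KS0 : 0 < (K.+1%:R : R) by rewrite ltr0n.
have hZb j : K.+1%:R^-1 * b n j <= Zdiag (A n w) 0 j.
  rewrite mulrC ler_pdivrMr // mulrC; apply: le_trans (hb j) _.
  by rewrite ler_wpM2r ?Zdiag_ge0.
have K1ge : K.+1%:R <= K1.
  rewrite /K1 -[X in X <= _]mulr1; apply: ler_pM => //.
  by rewrite ler_peMl // ltW.
split.
- by move=> j; apply: lt_le_trans (hZb j); rewrite mulr_gt0 // invr_gt0.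
- move=> x; apply: le_trans (scaled_gram_lb (z := K.+1%:R^-1 * (sz n)%:R `^ delta k) kap0 _ hkap _ h2 x).
  + rewrite ler_wpM2r ?fsq_ge0 // mulrA ler_wpM2r ?powR_ge0 //.
    have KK : 0 < kap / 2 * K.+1%:R^-1 by rewrite mulr_gt0 ?divr_gt0 // invr_gt0.
    rewrite -[X in _ <= X]invrK lef_pV2 ?posrE ?invr_gt0 //; last first.
      exact: lt_le_trans KS0 K1ge.
    rewrite invfM invrK /K1 -[X in X <= _]mulr1; apply: ler_pM => //.
      by rewrite mulr_ge0 ?(ltW KS0) // invr_ge0 divr_ge0 // ltW.
    by rewrite ler_wpM2r ?(ltW KS0) // le_max lexx.
  + by rewrite mulr_gt0 ?invr_gt0 // powR_gt0 // ltr0n.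
  + move=> j; apply: le_trans (hZb j); rewrite ler_wpM2l ?invr_ge0 ?(ltW KS0) //.
    by rewrite /b; apply: ler_powR => //; apply: dmono => //=; exact: ltn_ord.
- apply: (@le_trans _ _ (K1 * Zdiag (A n w) 0 (Ordinal k0))).
    apply: le_trans (hb (Ordinal k0)) _; rewrite ler_wpM2r ?Zdiag_ge0 //.
    exact: le_trans K1ge.
  rewrite ler_wpM2l //; first exact: le_trans (ltW KS0) K1ge.
  by rewrite -sum_Zdiag (bigD1 (Ordinal k0)) //= lerDl sumr_ge0 // => i _; exact: Zdiag_ge0.
- rewrite -sum_Zdiag (@le_trans _ _ (\sum_(j < k) K.+1%:R * (sz n)%:R)) //.
    apply: ler_sum => j _; apply: le_trans (hb' j) _; apply: ler_pM => //.
      exact: powR_ge0.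
    rewrite /b -[X in _ <= X]powRr1 //; apply: ler_powR => //.
    by apply: le_trans d1; apply: dmono => //=; exact: ltn_ord.
  rewrite sumr_const card_ord -[_ *+ k]mulr_natr /K1.
  rewrite [X in _ <= X](_ : _ = (K.+1%:R * (sz n)%:R * k%:R) * Num.max (kap / 2)^-1 1); last by ring.
  by rewrite ler_peMr // !mulr_ge0.
Unshelve. all: by end_near.
Qed.

End Loading.

(** * Rate for the loading estimators *)

Section IndepMeasurable.
Context {R : realType} {d : measure_display} {Om : measurableType d}.
Variable P : probability Om R.

(** The source space is retyped with the sigma-algebra generated by [G], so the general closure
    lemmas for measurable functions apply unchanged. *)
Definition mfun_wrt (G : set (set Om)) (f : Om -> R) : Prop :=
  @measurable_fun _ _ (g_sigma_algebraType G) _ setT f.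

Lemma indep_systems_rv (G1 G2 : set (set Om)) (X Y : Om -> R) :
  indep_systems P <<s G1>> <<s G2>> -> mfun_wrt G1 X -> mfun_wrt G2 Y ->
  indep_rv P X Y.
Proof.
move=> ind mX mY A B mA mB; apply: ind.
- by have := mX measurableT A mA; rewrite setTI.
- by have := mY measurableT B mB; rewrite setTI.
Qed.

Lemma mfun_wrtM G f g : mfun_wrt G f -> mfun_wrt G g ->
  mfun_wrt G (fun w => f w * g w).
Proof. exact: measurable_funM. Qed.

Lemma mfun_wrt_sum G (I : finType) (a : I -> R) (f : I -> Om -> R) :
  (forall i, mfun_wrt G (f i)) -> mfun_wrt G (fun w => \sum_i a i * f i w).
Proof.
by move=> mf; apply: measurable_sum => i; apply: measurable_funM => //; exact: mf.
Qed.

Lemma mfun_wrt_truncated G (K : finType) (L : K -> Om -> R) (Q : R) k k' :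
  (forall k, mfun_wrt G (L k)) ->
  mfun_wrt G (fun w => if \sum_k L k w ^+ 2 <= Q then L k w * L k' w else 0).
Proof.
move=> mL; apply: measurable_fun_ifT => //; last exact: mfun_wrtM.
apply: measurable_fun_ler; last exact: measurable_cst.
by apply: measurable_sum => l; apply: measurable_funX; exact: mL.
Qed.

Lemma mfun_wrt_cross_mean G (A B I J : finType) (F : int -> A -> B -> Om -> R)
    (e : int -> I -> J -> Om -> R) T l i k :
  (forall t l b, mfun_wrt G (F t l b)) -> (forall t i j, mfun_wrt G (e t i j)) ->
  mfun_wrt G (cross_mean F e T l i k).
Proof.
move=> mF me; apply: (mfun_wrt_sum (fun=> T%:R^-1)
   (f := fun (t : 'I_T) w => F (t.+1)%:Z l k.1 w * e (t.+1)%:Z i k.2 w)) => t.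
exact: mfun_wrtM.
Qed.

End IndepMeasurable.

(** * Arithmetic of the rates *)

Section PowerIdentities.
Variable R : realType.
Implicit Types z d : R.

(** Every power in the rates becomes a rational expression in z and z^d, so the comparison of rates
    is a matter of field identities. *)
Lemma powR_sqrD z d c : 0 < z -> z `^ (c - 2 * d) = z `^ c / (z `^ d) ^+ 2.
Proof.
move=> z0; rewrite powRD; last by rewrite (gt_eqF z0) implybT.
by rewrite powRN; congr (_ * _^-1); rewrite mulrC powRrM powR_mulrn ?powR_ge0.
Qed.

Lemma powR_1sub2 z d : 0 < z -> z `^ (1 - 2 * d) = z / (z `^ d) ^+ 2.
Proof. by move=> z0; rewrite powR_sqrD // powRr1 // ltW. Qed.

Lemma powR_2sub2 z d : 0 < z -> z `^ (2 * (1 - d)) = z ^+ 2 / (z `^ d) ^+ 2.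
Proof.
by move=> z0; rewrite mulrBr mulr1 powR_sqrD // powR_mulrn // ltW.
Qed.

Lemma powR_N2 z d : 0 < z -> z `^ (- (2 * d)) = ((z `^ d) ^+ 2)^-1.
Proof. by move=> z0; rewrite -[- _]add0r powR_sqrD // powRr0 mul1r. Qed.

End PowerIdentities.

Section NoiseShape.
Context {R : realType} {d : measure_display} {Om : measurableType d}.
Variable P : probability Om R.

(* The dimensions and ingredients of the common noise are hidden, so that the
   transposed noise satisfies the same predicate. *)
Definition noise_shape (I J A B : finType) (c k4 hi CA : R)
    (Xf : int -> A -> B -> Om -> R) (e : int -> I -> J -> Om -> R) : Prop :=
  exists (U V : finType) (Ar : I -> U -> R) (Ac : J -> V -> R) (Sg : I -> J -> R)
    (ep Xp : int -> I -> J -> Om -> R) (fe Xe : int -> U -> V -> Om -> R)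
    (a_e a_p : nat -> R),
  [/\ noise_model P Ar Ac Sg c k4 hi CA e ep Xp fe Xe a_e a_p,
      cross_white P (fun z : int * A * B => Xf z.1.1 z.1.2 z.2)
        (fun z : int * U * V => Xe z.1.1 z.1.2 z.2) &
      cross_white P (fun z : int * A * B => Xf z.1.1 z.1.2 z.2)
        (fun z : int * I * J => Xp z.1.1 z.1.2 z.2)].

Lemma cross_white_tr (A B U V : finType) (Xf : int -> A -> B -> Om -> R)
    (Xe : int -> U -> V -> Om -> R) :
  cross_white P (fun z : int * A * B => Xf z.1.1 z.1.2 z.2)
    (fun z : int * U * V => Xe z.1.1 z.1.2 z.2) ->
  cross_white P (fun z : int * B * A => Xf z.1.1 z.2 z.1.2)
    (fun z : int * V * U => Xe z.1.1 z.2 z.1.2).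
Proof.
case=> h1 h2; split; first by move=> [[t b] a] [[s v] u]; exact: h1 (t, a, b) (s, u, v).
move=> [[t b] a] [[s v] u] [[t' b'] a'] [[s' v'] u'] ne.
apply: (h2 (t, a, b) (s, u, v) (t', a', b') (s', u', v')).
by apply: contra_neq ne => -[-> -> -> -> -> ->].
Qed.

Lemma noise_shape_tr (I J A B : finType) (c k4 hi CA : R)
    (Xf : int -> A -> B -> Om -> R) (e : int -> I -> J -> Om -> R) :
  noise_shape c k4 hi CA Xf e ->
  noise_shape c k4 hi CA (fun t b a => Xf t a b) (fun t j i => e t i j).
Proof.
move=> [U [V [Ar [Ac [Sg [ep [Xp [fe [Xe [a_e [a_p [NM c1 c2]]]]]]]]]]]].
exists V, U, Ac, Ar, (fun j i => Sg i j), (fun t j i => ep t i j),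
  (fun t j i => Xp t i j), (fun t v u => fe t u v), (fun t v u => Xe t u v), a_e, a_p.
by split; [exact: noise_model_tr|exact: cross_white_tr c1|exact: cross_white_tr c2].
Qed.

End NoiseShape.

Section RateArithmetic.
Variable R : realType.

(* With [alp = p^{dr kr}] and [bet = q^{dc 1}] the two sides are the bound of
   [eigenvector_error] divided by [p] and the announced rate. *)
Lemma row_rate_arith (p q T alp bet KA KB G m0 k2 : R) :
  0 < p -> 0 < q -> 0 < T -> 0 < alp -> 0 < bet -> 0 < KA -> 0 < KB -> 0 <= m0 ->
  0 <= G -> 0 <= k2 ->
  p^-1 * ((8 * (KA * p * (m0 * p * q / T)) +
           2 * (G * (p * q ^+ 2 + T^-1 * p ^+ 2 * q))) *
          (k2 * (8 / (bet / (2 * KB) * (KA^-1 * alp))) ^+ 2)) <=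
  k2 * (16 * KB * KA) ^+ 2 * (8 * KA * m0 + 2 * G) *
    (T^-1 * (p / alp ^+ 2) * (q / bet ^+ 2) + (alp ^+ 2)^-1 * (q ^+ 2 / bet ^+ 2)).
Proof.
move=> p0 q0 T0 a0 b0 KA0 KB0 m00 G0 k20.
rewrite -subr_ge0.
set lhs := (X in 0 <= X).
(* The cross terms produce only the first of the two rates; the difference is the share of the
   second rate that the right-hand side grants them as well. *)
have -> : lhs = k2 * (16 * KB * KA) ^+ 2 * (8 * KA * m0) *
    (q ^+ 2 / (alp * bet) ^+ 2).
  by rewrite /lhs; field; rewrite !lt0r_neq0.
have KA0' := ltW KA0.
have h x : 0 <= x ^+ 2 :> R by exact: sqr_ge0.
apply: mulr_ge0; last by rewrite divr_ge0 ?h.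
apply: mulr_ge0; last by rewrite !mulr_ge0.
by rewrite mulr_ge0 ?h.
Qed.

(** Multiplication by (alp bet)^2 turns the expressions of the Rate assumption into the noise Gram
    bound; the 8 is 2 * 4, from [gam = bet / (2 * KB)] and the quarter required by
    [eigenvector_error]. *)
Lemma row_gap_arith (p q T alp bet KA KB G : R) :
  0 < p -> 0 < q -> 0 < T -> 0 < alp -> 0 < bet -> 0 < KA -> 0 < KB ->
  G * (T^-1 * (p ^+ 2 / alp ^+ 2) * (q / bet ^+ 2) +
      p / alp ^+ 2 * (q ^+ 2 / bet ^+ 2)) <= ((8 * KB * KA) ^+ 2)^-1 ->
  G * (p * q ^+ 2 + T^-1 * p ^+ 2 * q) <=
    (bet / (2 * KB) * (KA^-1 * alp) / 4) ^+ 2.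
Proof.
move=> p0 q0 T0 a0 b0 KA0 KB0 h.
have ab : 0 <= (alp * bet) ^+ 2 by exact: sqr_ge0.
have := ler_wpM2l ab h.
rewrite [X in X <= _ -> _](_ : _ = G * (p * q ^+ 2 + T^-1 * p ^+ 2 * q)); last first.
  by field; rewrite !lt0r_neq0.
by rewrite [X in _ <= X -> _](_ : _ = (bet / (2 * KB) * (KA^-1 * alp) / 4) ^+ 2) //; field;
  rewrite !lt0r_neq0.
Qed.

End RateArithmetic.

(** * Stochastic rate for one side of the loadings *)

Section RowRate.
Context {R : realType} {d : measure_display} {Om : measurableType d}.
Variable P : probability Om R.
Variables (kr kc : nat) (T p q : nat -> nat).
Variables (A : forall n, Om -> 'M[R]_(p n, kr)) (B : forall n, Om -> 'M[R]_(q n, kc)).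
Variables (F Xf : int -> Om -> 'M[R]_(kr, kc)) (E : forall n, int -> Om -> 'M[R]_(p n, q n)).
Variables (a_f : nat -> R) (c k4 k4' hi CA : R) (dr dc : nat -> R).
Variables (L : forall n, nat -> Om -> 'M[R]_(p n, q n)).
Variables (Qh : forall n, Om -> 'M[R]_(p n, kr)) (Dh : nat -> Om -> 'rV[R]_kr).
Hypothesis kr_gt0 : (0 < kr)%N.
Hypothesis kc_gt0 : (0 < kc)%N.
Hypothesis T_oo : T @ \oo --> \oo.
Hypothesis p_oo : p @ \oo --> \oo.
Hypothesis q_oo : q @ \oo --> \oo.
Hypothesis loadA : loading_strength P A dr.
Hypothesis loadB : loading_strength P B dc.
Local Notation Fe := (fun (t : int) l b w => F t w l b).
Local Notation Xfe := (fun (t : int) l b w => Xf t w l b).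
Local Notation Ee n := (fun (t : int) i j w => E n t w i j).
Hypothesis FM : factor_model P c k4 Fe Xfe a_f.
Hypothesis NM : \forall n \near \oo, noise_shape P c k4' hi CA Xfe (Ee n).
Hypothesis indepB : forall n, exists G1 G2 : set (set Om),
  [/\ indep_systems P <<s G1>> <<s G2>>,
      forall j b, mfun_wrt G1 (fun w => B n w j b),
      forall t l b, mfun_wrt G2 (fun w => F t w l b) &
      forall t i j, mfun_wrt G2 (fun w => E n t w i j)].
Hypothesis modelL : forall n, (0 < p n)%N -> (0 < q n)%N -> {ae P, forall w,
  [/\ (ones R (p n))^T *m A n w = 0, (ones R (q n))^T *m B n w = 0 &
     forall t : nat, (1 <= t <= T n)%N -> L n t w = A n w *m F t%:Z w *m (B n w)^T +
       centering_mx R (p n) *m E n t%:Z w *m centering_mx R (q n)]}.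
Hypothesis hQ : \forall n \near \oo, forall w, leading_eigen
  ((T n)%:R^-1 *: \sum_(1 <= t < (T n).+1) L n t w *m (L n t w)^T) (Qh n w) (Dh n w).
Hypothesis rate1 :
  ((T n)%:R^-1 * (p n)%:R `^ (2 * (1 - dr kr)) * (q n)%:R `^ (1 - 2 * dc 1%N))
    @[n --> \oo] --> (0 : R).
Hypothesis rate2 :
  ((p n)%:R `^ (1 - 2 * dr kr) * (q n)%:R `^ (2 * (1 - dc 1%N)))
    @[n --> \oo] --> (0 : R).

Let FZ n (t : nat) w := Zhalf (A n w) *m F t%:Z w *m Zhalf (B n w).
Let Qa n w := A n w *m Zhalf_inv (A n w).
Let Qb n w := B n w *m Zhalf_inv (B n w).

(** A fixed number of moments, each with mean square error of order 1/T; the threshold 1/4 is the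
    one of [factor_gram_lb]. *)
Lemma factor_moments_whp e : 0 < e -> \forall n \near \oo, whp P e (fun w =>
  \sum_(y : ('I_kr * 'I_kc) * ('I_kr * 'I_kc))
    (\sum_(t < T n) (T n)%:R^-1 * (F (t.+1)%:Z w y.1.1 y.1.2 * F (t.+1)%:Z w y.2.1 y.2.2)
      - (y.1 == y.2)%:R) ^+ 2 <= 1 / 4).
Proof.
move=> e0; pose cst := (c * c) ^+ 2 * (2 * k4 + 2).
pose N : R := #|{: ('I_kr * 'I_kc) * ('I_kr * 'I_kc)}|%:R.
have cst0 : 0 <= cst.
  by rewrite mulr_ge0 ?sqr_ge0 // addr_ge0 // mulr_ge0 // (fm_k4 FM).
have T0 : \forall n \near \oo, (0 < T n)%N by exact: (T_oo (nbhs_infty_gt 0)).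
have T1 : \forall n \near \oo, N * cst / (e / 4) <= (T n)%:R.
  have : \forall n \near \oo, (Num.truncn (N * cst / (e / 4)) < T n)%N.
    exact: (T_oo (nbhs_infty_gt _)).
  apply: filterS => n h; apply: le_trans (ltW (truncnS_gt _)) _.
  by rewrite ler_nat.
near=> n.
have Tn : (0 < T n)%N by near: n.
apply: (@whp_msq_sum _ _ _ P _ e _ (fun=> cst / (T n)%:R)).
- by move=> y; exact: (factor_lln FM y.1 y.2 Tn).
- by [].
rewrite sumr_const -[_ *+ _]mulr_natl -[X in X * _]/N.
rewrite (mulrA N cst) ler_pdivrMr ?ltr0n // mul1r [X in _ <= X]mulrC.
rewrite -ler_pdivrMr ?divr_gt0 //.
by near: n.
Unshelve. all: by end_near.
Qed.

Lemma gram_whp e : 0 < e -> \forall n \near \oo, whp P e (fun w =>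
  fsq ((T n)%:R^-1 *: \sum_(1 <= t < (T n).+1) E n t%:Z w *m (E n t%:Z w)^T) <=
  gram_const c k4' hi CA e *
    ((p n)%:R * (q n)%:R ^+ 2 + (T n)%:R^-1 * (p n)%:R ^+ 2 * (q n)%:R)).
Proof.
move=> e0.
have T0 : \forall n \near \oo, (0 < T n)%N by exact: (T_oo (nbhs_infty_gt 0)).
have p0 : \forall n \near \oo, (0 < p n)%N by exact: (p_oo (nbhs_infty_gt 0)).
have q0 : \forall n \near \oo, (0 < q n)%N by exact: (q_oo (nbhs_infty_gt 0)).
near=> n.
have Tn : (0 < T n)%N by near: n.
have pn : (0 < p n)%N by near: n.
have qn : (0 < q n)%N by near: n.
have [U [V [Aer [Aec [Sg [ep [Xp [fe [Xe [a_e [a_p [nm _ _]]]]]]]]]]]] :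
  noise_shape P c k4' hi CA Xfe (Ee n) by near: n.
have := @noise_gram _ _ _ P _ _ _ _ _ _ _ _ _ _ _ _ _ _ _ _ _ _ nm (T n) e Tn.
rewrite !card_ord => /(_ pn qn e0); apply: whp_mono => // w; apply: le_trans.
rewrite le_eqVlt; apply/orP; left; apply/eqP.
rewrite sum_pairE; apply: eq_bigr => i _; apply: eq_bigr => i' _; congr (_ ^+ 2).
rewrite mxE summxE big_add1 big_mkord sum_pairE mulr_sumr.
apply: eq_bigr => t _ /=; rewrite mxE mulr_sumr; apply: eq_bigr => j _.
by rewrite mxE.
Unshelve. all: by end_near.
Qed.

(** The truncation level KB q is the upper bound on |B|_F^2 supplied by [loading_whp], so the
    premise holds on the event where this is used. The [+ 1] in [m0] only ensures positivity. *)
Lemma cross_whp e KB : 0 < e -> 0 < KB -> exists2 m0, 0 < m0 &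
  \forall n \near \oo, whp P e (fun w => fsq (B n w) <= KB * (q n)%:R ->
  fsq ((T n)%:R^-1 *: \sum_(1 <= t < (T n).+1) F t%:Z w *m (B n w)^T *m (E n t%:Z w)^T)
    <= m0 * (p n)%:R * (q n)%:R / (T n)%:R).
Proof.
move=> e0 KB0.
have cc0 : 0 <= cross_const c hi CA.
  by rewrite /cross_const mulr_ge0 ?sqr_ge0 // addr_ge0 // mulr_ge0 ?sqr_ge0.
exists (kr%:R * (cross_const c hi CA + 1) * KB / e).
  by rewrite divr_gt0 // !mulr_gt0 ?ltr0n // ltr_wpDl.
have T0 : \forall n \near \oo, (0 < T n)%N by exact: (T_oo (nbhs_infty_gt 0)).
have p0 : \forall n \near \oo, (0 < p n)%N by exact: (p_oo (nbhs_infty_gt 0)).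
have q0 : \forall n \near \oo, (0 < q n)%N by exact: (q_oo (nbhs_infty_gt 0)).
near=> n.
have Tn : (0 < T n)%N by near: n.
have pn : (0 < p n)%N by near: n.
have qn : (0 < q n)%N by near: n.
have [U [V [Aer [Aec [Sg [ep [Xp [fe [Xe [a_e [a_p [nm c1 c2]]]]]]]]]]]] :
  noise_shape P c k4' hi CA Xfe (Ee n) by near: n.
have [G1 [G2 [ind mB mF mE]]] := indepB n.
have mB' : random_mx (B n) by case: loadB => h _ _ _; case: (h n).
pose M := kr%:R * (cross_const c hi CA + 1) * KB / e * (p n)%:R * (q n)%:R / (T n)%:R.
have M0 : 0 < M.
  by rewrite !(mulr_gt0, divr_gt0) ?ltr0n ?ltr_wpDl // invr_gt0 ?ltr0n.
have Q0 : 0 <= KB * (q n)%:R by rewrite mulr_ge0 // ltW.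
have := @cross_mean_whp _ _ _ P _ _ _ _ _ _ _ FM _ _ _ _ _ _ _ _ _ _ _ _ _ _ _ _ _
  nm c1 c2 (T n) (fun k w => B n w k.2 k.1) (KB * (q n)%:R) M e Tn Q0 M0.
move=> /(_ (fun k => mB' k.2 k.1)).
have hind l i k k' : indep_rv P
    (fun w => if \sum_k0 B n w k0.2 k0.1 ^+ 2 <= KB * (q n)%:R
              then B n w k.2 k.1 * B n w k'.2 k'.1 else 0)
    (fun w => cross_mean Fe (Ee n) (T n) l i k w * cross_mean Fe (Ee n) (T n) l i k' w).
  apply: (indep_systems_rv ind).
    by apply: (@mfun_wrt_truncated _ _ _ _ _ (fun k w => B n w k.2 k.1)) => z; exact: mB.
  by apply: mfun_wrtM; apply: mfun_wrt_cross_mean.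
move=> /(_ hind); rewrite !card_ord.
have hM : kr%:R * (p n)%:R * (cross_const c hi CA / (T n)%:R * (KB * (q n)%:R)) <= e * M.
  rewrite /M.
  have -> : e * (kr%:R * (cross_const c hi CA + 1) * KB / e * (p n)%:R * (q n)%:R / (T n)%:R) =
    kr%:R * (p n)%:R * (cross_const c hi CA / (T n)%:R * (KB * (q n)%:R)) +
    kr%:R * (p n)%:R * (KB * (q n)%:R) / (T n)%:R.
    by field; rewrite !lt0r_neq0 // ltr0n.
  by rewrite lerDl !mulr_ge0 // ?invr_ge0 // ltW.
move=> /(_ hM); apply: whp_mono => // w h.
have e1 : \sum_k B n w k.2 k.1 ^+ 2 = fsq (B n w).
  by rewrite sum_pairE exchange_big.
rewrite e1 in h => /h; apply: le_trans; rewrite le_eqVlt; apply/orP; left; apply/eqP.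
rewrite sum_pairE; apply: eq_bigr => l _; apply: eq_bigr => i _; congr (_ ^+ 2).
rewrite mxE summxE big_add1 big_mkord sum_pairE mulr_sumr.
under [RHS]eq_bigr => b _ do (under eq_bigr => j _ do rewrite mulr_sumr; rewrite exchange_big).
rewrite [RHS]exchange_big; apply: eq_bigr => t _ /=.
rewrite -mulmxA mxE mulr_sumr; apply: eq_bigr => b _; rewrite mxE !mulr_sumr.
by apply: eq_bigr => j _; rewrite !mxE; ring.
Unshelve. all: by end_near.
Qed.

(* L is only required to coincide almost surely with the centered data, and the
   model enters through noise_shape and factor_model: the lemma applies both to
   the data and to their transposes. *)
Lemma row_rate : stochO P (fun n w => (p n)%:R^-1 *
    normF (Qh n w - Qa n w *m ((T n)%:R^-1 *:
      (invmx (diag_mx (Dh n w)) *m (Qh n w)^T *m Qa n w *m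
       \sum_(1 <= t < (T n).+1) FZ n t w *m (Qb n w)^T *m Qb n w *m (FZ n t w)^T))^T) ^+ 2)
  (fun n => (T n)%:R^-1 * (p n)%:R `^ (1 - 2 * dr kr) * (q n)%:R `^ (1 - 2 * dc 1%N)
    + (p n)%:R `^ (- (2 * dr kr)) * (q n)%:R `^ (2 * (1 - dc 1%N))).
Proof.
(* Six events: the two loadings, the cross terms, the factor moments, the noise Gram matrix, and the
   almost sure identities of the model. *)
apply: stochO_whp => e e0; pose e6 := e / 6.
have e60 : 0 < e6 by rewrite divr_gt0.
have [KA KA0 whA] := loading_whp kr_gt0 p_oo loadA e60.
have [KB KB0 whB] := loading_whp kc_gt0 q_oo loadB e60.
have [m0 m00 whC] := cross_whp e60 KB0.
have whF := factor_moments_whp e60.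
have whG := gram_whp e60.
pose G := `|gram_const c k4' hi CA e6|.
pose k2 : R := kr%:R ^+ 2.
have k20 : 0 < k2 by rewrite exprn_gt0 // ltr0n.
have G0 : 0 <= G by exact: normr_ge0.
exists (k2 * (16 * KB * KA) ^+ 2 * (8 * KA * m0 + 2 * G)).
  apply: mulr_gt0; first by apply: mulr_gt0 => //; apply: exprn_gt0; rewrite !mulr_gt0.
  by rewrite ltr_pwDl ?mulr_ge0 // !mulr_gt0.
(* Here the Rate assumption enters: eventually the noise is small enough for the lower bound on the
   eigenvalues. *)
have gap : \forall n \near \oo,
   G * ((T n)%:R^-1 * (p n)%:R `^ (2 * (1 - dr kr)) * (q n)%:R `^ (1 - 2 * dc 1%N) +
    (p n)%:R `^ (1 - 2 * dr kr) * (q n)%:R `^ (2 * (1 - dc 1%N)))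
   < ((8 * KB * KA) ^+ 2)^-1.
  have := cvgM (cvg_cst G) (cvgD rate1 rate2); rewrite addr0 mulr0 => cv.
  have gg : 0 < ((8 * KB * KA) ^+ 2)^-1.
    by rewrite invr_gt0; apply: exprn_gt0; rewrite !mulr_gt0.
  exact: (cvgr_lt _ (cv _ _ _) _ gg).
have T0 : \forall n \near \oo, (0 < T n)%N by exact: (T_oo (nbhs_infty_gt 0)).
have p0 : \forall n \near \oo, (0 < p n)%N by exact: (p_oo (nbhs_infty_gt 0)).
have q0 : \forall n \near \oo, (0 < q n)%N by exact: (q_oo (nbhs_infty_gt 0)).
have hall := filterI T0 (filterI p0 (filterI q0 (filterI gap (filterI whA (filterI whB
  (filterI whC (filterI whF (filterI whG hQ)))))))).
case: hall => N _ hN; exists N => // n /hN [Tn [pn [qn [hgap [hA [hB [hC [hF [hG hL]]]]]]]]].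
have hM := whp_ae (ltW e60) (modelL pn qn).
have := whp_and hA (whp_and hB (whp_and hC (whp_and hF (whp_and hG hM)))).
apply: whp_mono.
  by rewrite /e6 le_eqVlt; apply/orP; left; apply/eqP; field.
move=> w [[ZA lamA _ fA] [[ZB _ gamB fB] [/(_ fB) hx [hD [hg [A1 B1 hLw]]]]]].
pose alp : R := (p n)%:R `^ dr kr; pose bet : R := (q n)%:R `^ dc 1%N.
have pR : 0 < ((p n)%:R : R) by rewrite ltr0n.
have qR : 0 < ((q n)%:R : R) by rewrite ltr0n.
have TR : 0 < ((T n)%:R : R) by rewrite ltr0n.
have alp0 : 0 < alp by exact: powR_gt0.
have bet0 : 0 < bet by exact: powR_gt0.
rewrite normF_sqr ger0_norm; last by rewrite mulr_ge0 ?invr_ge0 ?fsq_ge0.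
rewrite !(powR_1sub2, powR_2sub2, powR_N2) // -/alp -/bet in hgap *.
apply: le_trans (row_rate_arith pR qR TR alp0 bet0 KA0 KB0 (ltW m00) G0 (ltW k20)).
rewrite ler_wpM2l ?invr_ge0 //.
(* [gam] combines |B|_F^2 >= bet / KB with the half lost in [factor_gram_lb], and [lam] is the lower
   bound for A'A. *)
have gam0 : 0 < bet / (2 * KB) by rewrite divr_gt0 // mulr_gt0.
have lam0 : 0 < KA^-1 * alp by rewrite mulr_gt0 // invr_gt0.
have hgG : fsq ((T n)%:R^-1 *: \sum_(1 <= t < (T n).+1) E n t%:Z w *m (E n t%:Z w)^T) <=
    G * ((p n)%:R * (q n)%:R ^+ 2 + (T n)%:R^-1 * (p n)%:R ^+ 2 * (q n)%:R).
  apply: le_trans hg _; apply: ler_wpM2r; last exact: ler_norm.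
  by apply: addr_ge0; rewrite !mulr_ge0 ?sqr_ge0 ?invr_ge0.
have hgam (v : 'rV[R]_kr) : bet / (2 * KB) * fsq v <=
    (v *m ((T n)%:R^-1 *: \sum_(1 <= t < (T n).+1) F t%:Z w *m ((B n w)^T *m B n w) *m (F t%:Z w)^T) *m v^T) 0 0.
  have := @factor_gram_lb _ (T n) kr kc (q n) (B n w) (fun t : 'I_(T n) => F (t.+1)%:Z w) hD v.
  rewrite big_add1 big_mkord; apply: le_trans.
  rewrite ler_wpM2r ?fsq_ge0 // ler_pdivrMr ?mulr_gt0 //.
  by rewrite (_ : fsq (B n w) / 2 * (2 * KB) = KB * fsq (B n w)) //; field.
have := eigenvector_error pn qn lam0 gam0 A1 B1 ZA ZB _ (hL w) hgG hx lamA hgam.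
move=> /(_ _ (row_gap_arith pR qR TR alp0 bet0 KA0 KB0 (ltW hgap))).
have eS : (T n)%:R^-1 *: (\sum_(1 <= t < (T n).+1) L n t w *m (L n t w)^T) =
  (T n)%:R^-1 *: \sum_(1 <= t < (T n).+1)
    (A n w *m F t%:Z w *m (B n w)^T + centering_mx R (p n) *m E n t%:Z w *m centering_mx R (q n)) *m
    (A n w *m F t%:Z w *m (B n w)^T + centering_mx R (p n) *m E n t%:Z w *m centering_mx R (q n))^T.
  by congr (_ *: _); apply: eq_big_nat => t ht; rewrite hLw.
move=> /(_ eS) h; apply: le_trans h _.
apply: ler_wpM2r; first by apply: mulr_ge0; exact: sqr_ge0.
rewrite lerD2r; apply: ler_wpM2l => //; apply: ler_wpM2r => //.
have m00' := ltW m00; by rewrite !mulr_ge0 ?invr_ge0.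
Qed.

End RowRate.

(** * The model *)

Section CrossWhite.
Context {R : realType} {d : measure_display} {Om : measurableType d}.
Variable P : probability Om R.

(** In a product of two cross products the X-factors and the Y-factors are regrouped, and
    independence splits the mean into two second moments. *)
Lemma indep_cross_white (I J : choiceType) (X : I -> Om -> R) (Y : J -> Om -> R) :
  white2 P X -> white2 P Y ->
  (forall i k j l, indep_rv P (fun w => X i w * X k w) (fun w => Y j w * Y l w)) ->
  cross_white P X Y.
Proof.
move=> wX wY ind.
have [mX X2 _ XX] := wX; have [mY Y2 _ YY] := wY.
have prod i k j l : (\int[P]_w (X i w * Y j w * (X k w * Y l w))%:E =
    (\int[P]_w (X i w * X k w)%:E) * (\int[P]_w (Y j w * Y l w)%:E))%E.
  have [_ <-] := indep_rv_integralM (measurable_funM (mX i) (mX k))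
    (measurable_funM (mY j) (mY l))
    (msq_le_integrable_mul (white2_msq i wX) (white2_msq k wX))
    (msq_le_integrable_mul (white2_msq j wY) (white2_msq l wY)) (ind i k j l).
  by apply: eq_integral => w _; congr (_%:E); rewrite mulrACA.
split.
- move=> i j; split; first exact: measurable_funM.
  under eq_integral do rewrite expr2.
  rewrite prod.
  under eq_integral do rewrite -expr2.
  rewrite X2 mul1e; under eq_integral do rewrite -expr2.
  by rewrite Y2.
- move=> i j k l; rewrite prod xpair_eqE negb_and => /orP[ik|jl].
    by rewrite XX // mul0e.
  by rewrite YY // mule0.
Qed.

Lemma gen_mx_mfun (G : set (set Om)) m n (x : Om -> 'M[R]_(m, n)) i j :
  gen_mx x `<=` G -> mfun_wrt G (fun w => x w i j).
Proof.
move=> xG _ B mB; apply: sub_sigma_algebra; apply: xG.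
by exists i => //; exists j => //; exists B.
Qed.

Lemma gen_proc_mfun (G : set (set Om)) m n (x : int -> Om -> 'M[R]_(m, n)) t i j :
  gen_proc x `<=` G -> mfun_wrt G (fun w => x t w i j).
Proof. by move=> xG; apply: gen_mx_mfun => A xA; apply: xG; exists t. Qed.

Lemma gen_proc_cross_white (G : set (set Om)) (A B U V : nat)
    (X : int -> Om -> 'M[R]_(A, B)) (Y : int -> Om -> 'M[R]_(U, V)) :
  white2 P (entries X) -> white2 P (entries Y) ->
  indep_systems P <<s G >> <<s gen_proc X >> -> gen_proc Y `<=` G ->
  cross_white P (entries X) (entries Y).
Proof.
move=> wX wY ind YG; apply: indep_cross_white => // i k j l.
apply: indep_rvC; apply: (indep_systems_rv ind); apply: mfun_wrtM;
  exact: gen_proc_mfun.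
Qed.

Lemma linear_process_entry a m n (X Z : int -> Om -> 'M[R]_(m, n)) t i j :
  linear_process P a X Z ->
  lin_limit P a (fun k w => X (t - k%:Z) w i j) (fun w => Z t w i j).
Proof.
move=> /(_ t); apply: filterS => w h.
have := continuous_cvg _ (@coord_continuous _ _ _ i j (Z t w)) h.
move=> /(_ _); rewrite (_ : _ \o _ = (fun N => \sum_(0 <= k < N) a k * X (t - k%:Z) w i j)) //.
by apply/funext => N; rewrite /= summxE; apply: eq_bigr => k _; rewrite mxE.
Qed.

Lemma white4_entries c m n (x : int -> Om -> 'M[R]_(m, n)) :
  (forall t, random_mx (x t)) -> indep_family P (entries x) -> standardized P x ->
  fourth_moments_le P c x -> white4 P (Num.max c 0) (entries x).
Proof.
move=> mx ind st h4; apply: white4_indep => // k; first exact: mx.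
by apply: le_trans (h4 k) _; rewrite lee_fin le_max lexx.
Qed.

(** In each column the Euclidean norm is at most the l1 norm. Since the number of common noise
    factors is bounded, this gives a constant [CA] free of p and q. *)
Lemma norm1_fsq m n (A : 'M[R]_(m, n)) : fsq A <= n%:R * norm1 A ^+ 2.
Proof.
have n0 j : \sum_i `|A i j| <= norm1 A by exact: le_bigmax.
rewrite /fsq exchange_big /= (@le_trans _ _ (\sum_(j < n) norm1 A ^+ 2)) //.
  apply: ler_sum => j _.
  have s0 : 0 <= \sum_i `|A i j| by apply: sumr_ge0.
  apply: (@le_trans _ _ ((\sum_i `|A i j|) ^+ 2)); last first.
    by rewrite ler_pXn2r // nnegrE // (le_trans s0).
  rewrite expr2 mulr_suml; apply: ler_sum => i _.
  rewrite -real_normK ?num_real // expr2 ler_wpM2l //.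
  by rewrite (bigD1 i) //= lerDl sumr_ge0.
by rewrite sumr_const card_ord -[_ *+ n]mulr_natl.
Qed.

End CrossWhite.

(** * From the assumptions to uniform constants *)

Section Shapes.
Context {R : realType} {d : measure_display} {Om : measurableType d}.
Context {kr kc : nat}.
Variables (P : probability Om R) (m : mefm R Om kr kc).
Hypothesis hfactor : assume_factor P m.
Hypothesis hdec : assume_noise_decomposition P m.
Hypothesis hdyn : assume_noise_dynamics P m.

Lemma eqO1_bound (u : nat -> R) : (u : nat -> R^o) =O_\oo (fun=> 1 : R^o) ->
  exists2 K, 0 < K & \forall n \near \oo, `|u n| <= K.
Proof.
move=> /eqO_exP[K K0 h]; exists K => //; case: h => N _ hN; exists N => // n /hN /=.
by rewrite normr1 mulr1.
Qed.

(** The constants are fixed before n. The O(1) assumptions on the common noise loadings give bounds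
    only for large n, whence the form of the second part; [c] is the largest of the three filter
    bounds. *)
Lemma mefm_shapes : exists c k4 k4' hi CA,
  factor_model P c k4 (fun t l b w => F m t w l b) (fun t l b w => Xf m t w l b) (a_f m) /\
  \forall n \near \oo, noise_shape P c k4' hi CA (fun t l b w => Xf m t w l b)
    (fun t i j w => E m n t w i j).
Proof.
have [mF lF [iX _] [stX [k4 X4]] [a2 [cf af]]] := hfactor.
have [mE decE ind [lo [hi [lo0 Sg]]] [nr nc kr' kc']] := hdec.
have [lin indX famX [k4' X4'] [[ae2 [ce ae]] [ap2 [cp ap]]]] := hdyn.
have [Kr Kr0 hKr] := eqO1_bound kr'; have [Kc Kc0 hKc] := eqO1_bound kc'.
have [Nr Nr0 hNr] := eqO1_bound nr; have [Nc Nc0 hNc] := eqO1_bound nc.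
pose c := Num.max cf (Num.max ce cp).
pose CA := Num.max (Kr * Nr ^+ 2) (Kc * Nc ^+ 2).
have wXf : white4 P (Num.max k4 0) (entries (Xf m)).
  by apply: white4_entries => // t; case: (mF t).
exists c, (Num.max k4 0), (Num.max k4' 0), hi, CA; split.
  constructor.
  - by move=> t l b; exact: (mF t).2.
  - by rewrite le_max lexx orbT.
  - exact: wXf.
  - by move=> N; apply: le_trans (af N) _; rewrite /c le_max lexx.
  - exact: a2.
  - by move=> t l b; exact: linear_process_entry.
have hall := filterI hKr (filterI hKc (filterI hNr hNc)).
case: hall => N _ hN; exists N => // n /hN [hkr [hkc [hnr hnc]]].
have [mX lFe lep] := lin n; have [_ indf] := indX n.
have [iXe iXp stXe stXp] := famX n; have [Xe4 Xp4] := X4' n.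
have [stF ste indt _] := ind n.
have wXe : white4 P (Num.max k4' 0) (entries (Xe m n)).
  by apply: white4_entries => // t; case: (mX t).
have wXp : white4 P (Num.max k4' 0) (entries (Xeps m n)).
  by apply: white4_entries => // t; case: (mX t).
have w2 (I : choiceType) k (X : I -> Om -> R) : white4 P k X -> white2 P X by case.
exists 'I_(k_er m n), 'I_(k_ec m n), (fun i u => Aer m n i u), (fun j v => Aec m n j v),
  (fun i j => Sigma_eps m n i j), (fun t i j w => eps m n t w i j),
  (fun t i j w => Xeps m n t w i j), (fun t u v w => Fe m n t w u v),
  (fun t u v w => Xe m n t w u v), (a_e m), (a_eps m); split; last first.
- by apply: (gen_proc_cross_white (w2 _ _ _ wXf) (w2 _ _ _ wXp) indf) => A; right.
- by apply: (gen_proc_cross_white (w2 _ _ _ wXf) (w2 _ _ _ wXe) indf) => A; left.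
constructor.
- by move=> t i j; case: (mE n t) => h _ _; exact: h.
- by move=> t i j; case: (mE n t) => _ h _; exact: h.
- by move=> t i j; case: (mE n t) => _ _ h; exact: h.
- move=> t i j; apply: filterS (decE n t) => w ->.
  rewrite mxE [X in _ + X]mxE; congr (_ + _).
  rewrite sum_pairE exchange_big mxE; apply: eq_bigr => v _ /=.
  rewrite !mxE mulr_suml; apply: eq_bigr => u _ /=; ring.
- apply: le_trans (norm1_fsq (Aer m n)) _; rewrite /CA le_max; apply/orP; left.
  by move: hkr hnr; rewrite /= normr_nat => h1 h2; apply: ler_pM => //; rewrite ?sqr_ge0 //
    -real_normK ?num_real // ler_pXn2r ?nnegrE // ltW.
- apply: le_trans (norm1_fsq (Aec m n)) _; rewrite /CA le_max; apply/orP; right.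
  by move: hkc hnc; rewrite /= normr_nat => h1 h2; apply: ler_pM => //; rewrite ?sqr_ge0 //
    -real_normK ?num_real // ler_pXn2r ?nnegrE // ltW.
- by move=> i j; have /andP[h1 ->] := Sg n i j; rewrite andbT (le_trans (ltW lo0)).
- by rewrite le_max lexx orbT.
(* The bound on the empty partial sum shows that the filter constant is nonnegative. *)
- by rewrite /c !le_max; apply/orP; left; have := af 0%N; rewrite big_geq.
- move=> t; apply: white2_indep; first by case: (indt t).
    by move=> z; case: (mE n t) => _ h _; exact: h.
  by move=> z; exact: (stF (t, z.1, z.2)).
- move=> t; apply: white2_indep; first by case: (indt t).
    by move=> z; case: (mE n t) => _ _ h; exact: h.
  by move=> z; exact: (ste (t, z.1, z.2)).
- exact: wXp.
- by move=> k; apply: le_trans (ae k) _; rewrite /c !le_max lexx !orbT.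
- by move=> k; apply: le_trans (ap k) _; rewrite /c !le_max lexx !orbT.
- by move=> t u v; exact: linear_process_entry.
- by move=> t i j; exact: linear_process_entry.
Qed.

End Shapes.

(** * Centering identities for one observation *)

Section CenteredModel.
Variable R : realType.

Lemma ones_centering n : (0 < n)%N -> (ones R n)^T *m centering_mx R n = 0.
Proof.
move=> n0; rewrite /centering_mx mulmxBr mulmx1 -scalemxAr mulmxA ones_sq.
by rewrite mul_scalar_mx scalerA mulVf ?pnatr_eq0 -?lt0n // scale1r subrr.
Qed.

Lemma centering_ones n : (0 < n)%N -> centering_mx R n *m ones R n = 0.
Proof.
by move=> n0; rewrite -[LHS]trmxK trmx_mul centering_sym ones_centering // trmx0.
Qed.

Variables (p q k l : nat) (a : R) (al : 'cV[R]_p) (be : 'cV[R]_q).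
Variables (A : 'M[R]_(p, k)) (F : 'M[R]_(k, l)) (B : 'M[R]_(q, l)) (E : 'M[R]_(p, q)).
Hypotheses (p0 : (0 < p)%N) (q0 : (0 < q)%N).
Hypotheses (al0 : (ones R p)^T *m al = 0) (be0 : (ones R q)^T *m be = 0).
Hypotheses (A0 : (ones R p)^T *m A = 0) (B0 : (ones R q)^T *m B = 0).

Let Y := a *: (ones R p *m (ones R q)^T) + al *m (ones R q)^T
  + ones R p *m be^T + A *m F *m B^T + E.

Let B0' : B^T *m ones R q = 0.
Proof. by rewrite -[LHS]trmxK trmx_mul trmxK B0 trmx0. Qed.
Let be0' : be^T *m ones R q = 0.
Proof. by rewrite -[LHS]trmxK trmx_mul trmxK be0 trmx0. Qed.

Lemma centered_data : centering_mx R p *m Y *m centering_mx R q =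
  A *m F *m B^T + centering_mx R p *m E *m centering_mx R q.
Proof.
have Mp1 := centering_ones p0; have Mq1 := ones_centering q0.
have MA := centering_id A0.
have MB : B^T *m centering_mx R q = B^T.
  by rewrite -[LHS]trmxK trmx_mul trmxK centering_sym centering_id.
move: (centering_mx R p) (centering_mx R q) Mp1 Mq1 MA MB => Mp Mq Mp1 Mq1 MA MB.
rewrite /Y !mulmxDr !mulmxDl -scalemxAr -scalemxAl !mulmxA Mp1 !mul0mx scaler0 add0r.
by rewrite -(mulmxA _ (ones R q)^T) Mq1 mulmx0 !add0r MA -(mulmxA _ B^T) MB.
Qed.

Let Y1 : Y *m ones R q = (a * q%:R) *: ones R p + q%:R *: al + E *m ones R q.
Proof.
rewrite /Y !mulmxDl -scalemxAl -!mulmxA ones_sq be0' B0' !mulmx0 !addr0.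
by rewrite !mul_mx_scalar scalerA.
Qed.

Let grand_mean : ((ones R p)^T *m Y *m ones R q) 0 0 / (p%:R * q%:R) =
  a + ((ones R p)^T *m (E *m ones R q)) 0 0 / (p%:R * q%:R).
Proof.
have pn : p%:R != 0 :> R by rewrite pnatr_eq0 -lt0n.
have qn : q%:R != 0 :> R by rewrite pnatr_eq0 -lt0n.
rewrite -mulmxA Y1 !mulmxDr -!scalemxAr al0 scaler0 addr0 ones_sq.
rewrite mxE [X in (X + _) / _]mxE [X in (_ * X + _) / _]mxE eqxx mulr1n.
by field; rewrite pn qn.
Qed.

Lemma grand_mean_error : ((ones R p)^T *m Y *m ones R q) 0 0 / (p%:R * q%:R) - a =
  \sum_(z : 'I_p * 'I_q) (p%:R * q%:R)^-1 * E z.1 z.2.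
Proof.
rewrite grand_mean addrAC subrr add0r -mulr_sumr sum_pairE mulrC; congr (_ * _).
rewrite mxE; apply: eq_bigr => i _; rewrite !mxE mul1r.
by apply: eq_bigr => j _; rewrite !mxE mulr1.
Qed.

(** The centering conditions remove the other effect and the common component from the row means;
    subtracting the grand mean amounts to projecting the row means of the noise. *)
Lemma main_effect_error :
  q%:R^-1 *: (Y *m ones R q) -
    (((ones R p)^T *m Y *m ones R q) 0 0 / (p%:R * q%:R)) *: ones R p - al =
  centering_mx R p *m (q%:R^-1 *: (E *m ones R q)).
Proof.
have pn : p%:R != 0 :> R by rewrite pnatr_eq0 -lt0n.
have qn : q%:R != 0 :> R by rewrite pnatr_eq0 -lt0n.
rewrite grand_mean Y1 /centering_mx mulmxBl mul1mx -scalemxAl -scalemxAr -!mulmxA.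
rewrite [(ones R p)^T *m (E *m _)]mx11_scalar mul_mx_scalar.
set s := ((ones R p)^T *m _) 0 0; set v := E *m _.
rewrite [s%:M 0 0]mxE eqxx mulr1n.
apply/matrixP => i j; rewrite !mxE.
by field; rewrite pn qn.
Qed.

(** The projection is dropped, as it cannot increase the norm. Row means are written as combinations
    over all entries, the form taken by [noise_lincomb]. *)
Lemma main_effect_error_le : fsq (centering_mx R p *m (q%:R^-1 *: (E *m ones R q))) <=
  \sum_i (\sum_(z : 'I_p * 'I_q) (z.1 == i)%:R * q%:R^-1 * E z.1 z.2) ^+ 2.
Proof.
apply: le_trans (fsq_projl _ (centering_sym _ _) (centering_idem _ p0)) _.
rewrite /fsq; apply: ler_sum => i _; rewrite big_ord1 le_eqVlt; apply/orP; left; apply/eqP.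
congr (_ ^+ 2); rewrite sum_pairE (bigD1 i) //= [X in _ = _ + X]big1 ?addr0; last first.
  by move=> i' /negPf ni; apply: big1 => j _; rewrite ni !mul0r.
rewrite !mxE mulr_sumr; apply: eq_bigr => j _.
by rewrite eqxx mul1r !mxE mulr1.
Qed.

End CenteredModel.

Section MainEffects.
Context {R : realType} {d : measure_display} {Om : measurableType d}.
Variable P : probability Om R.

Lemma stochO_le_ae (X X' : nat -> Om -> R) (r : nat -> R) :
  (\forall n \near \oo, {ae P, forall w, `|X' n w| <= `|X n w|}) ->
  stochO P X r -> stochO P X' r.
Proof.
move=> hXX hX e e0; have e2 : 0 < e / 2 by rewrite divr_gt0.
have [M M0 hM] := hX _ e2; exists M => //.
case: (filterI hM hXX) => N _ hN; exists N => // n /hN [[B [mB PB hB]] hn].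
have [B' [mB' PB' hB']] := whp_ae (ltW e2) hn.
exists (B `|` B'); split; first exact: measurableU.
  apply: le_trans (measureU2 _ mB mB') _.
  by apply: le_trans (leeD PB PB') _; rewrite -EFinD lee_fin -splitr.
move=> w /= Mw; have [|Bw] := pselect (B' w); first by right.
by left; apply: hB; apply: lt_le_trans Mw (hB' w Bw).
Qed.

Variables (kr kc : finType) (Xf : int -> kr -> kc -> Om -> R) (p q : nat -> nat).
Variables (E : forall n, int -> Om -> 'M[R]_(p n, q n)) (t : nat -> int).
Variables (c k4 hi CA : R).
Hypothesis p_oo : p @ \oo --> \oo.
Hypothesis q_oo : q @ \oo --> \oo.
Hypothesis NM : \forall n \near \oo,
  noise_shape P c k4 hi CA Xf (fun t i j w => E n t w i j).

Let cst := 2 * CA ^+ 2 + 2 * hi ^+ 2.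
Let cst0 : 0 <= cst.
Proof. by apply: addr_ge0; apply: mulr_ge0 => //; exact: sqr_ge0. Qed.

(** The p q coefficients 1/(p q) have sum of squares 1/(p q). *)
Lemma grand_mean_rate : stochO P (fun n w =>
    (\sum_(z : 'I_(p n) * 'I_(q n))
       ((p n)%:R * (q n)%:R)^-1 * E n (t n) w z.1 z.2) ^+ 2)
  (fun n => (p n)%:R^-1 * (q n)%:R^-1).
Proof.
apply: stochO_whp => e e0; exists ((cst + 1) / e).
  by rewrite divr_gt0 // ltr_wpDl.
have p0 : \forall n \near \oo, (0 < p n)%N by exact: (p_oo (nbhs_infty_gt 0)).
have q0 : \forall n \near \oo, (0 < q n)%N by exact: (q_oo (nbhs_infty_gt 0)).
case: (filterI p0 (filterI q0 NM)) => N _ hN; exists N => // n /hN [pn [qn nm]].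
have [U [V [Aer [Aec [Sg [ep [Xp [fe [Xe [a_e [a_p [{}nm _ _]]]]]]]]]]]] := nm.
have pR : 0 < ((p n)%:R : R) by rewrite ltr0n.
have qR : 0 < ((q n)%:R : R) by rewrite ltr0n.
have := noise_lincomb nm (t n) (fun=> ((p n)%:R * (q n)%:R)^-1) => h.
have : whp P e (fun w => (\sum_(z : 'I_(p n) * 'I_(q n))
   ((p n)%:R * (q n)%:R)^-1 * E n (t n) w z.1 z.2) ^+ 2 <=
   (cst + 1) / e * ((p n)%:R^-1 * (q n)%:R^-1)).
  apply: (whp_msq h).
    by rewrite mulr_gt0 ?mulr_gt0 ?invr_gt0 // ltr_wpDl.
  rewrite sumr_const card_prod !card_ord -[_ *+ (p n * q n)]mulr_natl natrM -/cst.
  have -> : e * ((cst + 1) / e * ((p n)%:R^-1 * (q n)%:R^-1)) =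
    (cst + 1) * ((p n)%:R * (q n)%:R)^-1 by field; rewrite !lt0r_neq0.
  have -> : (p n)%:R * (q n)%:R * ((p n)%:R * (q n)%:R)^-1 ^+ 2 =
    ((p n)%:R * (q n)%:R)^-1 :> R by field; rewrite !lt0r_neq0.
  by rewrite ler_wpM2r ?lerDl // invr_ge0 ltW // mulr_gt0.
by apply: whp_mono => // w hw; rewrite ger0_norm ?sqr_ge0.
Qed.

(** For each row the coefficients 1/q on its q entries have sum of squares 1/q; averaging over the
    rows keeps this order. *)
Lemma main_effect_rate : stochO P (fun n w =>
    (p n)%:R^-1 * \sum_i (\sum_(z : 'I_(p n) * 'I_(q n))
       (z.1 == i)%:R * (q n)%:R^-1 * E n (t n) w z.1 z.2) ^+ 2)
  (fun n => (q n)%:R^-1).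
Proof.
apply: stochO_whp => e e0; exists ((cst + 1) / e).
  by rewrite divr_gt0 // ltr_wpDl.
have p0 : \forall n \near \oo, (0 < p n)%N by exact: (p_oo (nbhs_infty_gt 0)).
have q0 : \forall n \near \oo, (0 < q n)%N by exact: (q_oo (nbhs_infty_gt 0)).
case: (filterI p0 (filterI q0 NM)) => N _ hN; exists N => // n /hN [pn [qn nm]].
have [U [V [Aer [Aec [Sg [ep [Xp [fe [Xe [a_e [a_p [{}nm _ _]]]]]]]]]]]] := nm.
have pR : 0 < ((p n)%:R : R) by rewrite ltr0n.
have qR : 0 < ((q n)%:R : R) by rewrite ltr0n.
have b2 (i : 'I_(p n)) : \sum_(z : 'I_(p n) * 'I_(q n))
    ((z.1 == i)%:R * (q n)%:R^-1) ^+ 2 = (q n)%:R^-1 :> R.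
  rewrite sum_pairE (bigD1 i) //= [X in _ + X]big1 ?addr0; last first.
    by move=> i' /negPf ni; apply: big1 => j _; rewrite ni !mul0r expr0n.
  rewrite eqxx mul1r sumr_const card_ord -[_ *+ _]mulr_natl.
  by field; rewrite lt0r_neq0.
have : whp P e (fun w => \sum_i (\sum_(z : 'I_(p n) * 'I_(q n))
   (z.1 == i)%:R * (q n)%:R^-1 * E n (t n) w z.1 z.2) ^+ 2 <=
   (p n)%:R * ((cst + 1) / e * (q n)%:R^-1)).
  apply: (@whp_msq_sum _ _ _ P _ e _ (fun=> cst * (q n)%:R^-1)).
  - move=> i; have := noise_lincomb nm (t n) (fun z => (z.1 == i)%:R * (q n)%:R^-1).
    by rewrite b2.
  - by rewrite !mulr_gt0 ?invr_gt0 // ltr_wpDl.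
  rewrite sumr_const card_ord -[_ *+ _]mulr_natl.
  have -> : e * ((p n)%:R * ((cst + 1) / e * (q n)%:R^-1)) =
    (p n)%:R * ((cst + 1) * (q n)%:R^-1) by field; rewrite !lt0r_neq0.
  apply: ler_wpM2l => //; apply: ler_wpM2r; first by rewrite invr_ge0.
  by rewrite lerDl.
apply: whp_mono => // w hw; rewrite ger0_norm; last first.
  by rewrite mulr_ge0 ?invr_ge0 //; apply: sumr_ge0 => i _; exact: sqr_ge0.
by rewrite ler_pdivrMl.
Qed.

End MainEffects.

(** * The estimators and their transposes *)

Section Assembly.
Context {R : realType} {d : measure_display} {Om : measurableType d}.
Context {kr kc : nat}.
Variables (P : probability Om R) (m : mefm R Om kr kc).

(** Transposition exchanges alpha with beta and the two loadings, so the result for beta is the one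
    for alpha applied to the transposed observation. *)
Lemma Y_tr n t w : (Y m n t w)^T =
  mu m n t w *: (ones R (nq m n) *m (ones R (np m n))^T)
  + beta m n t w *m (ones R (np m n))^T + ones R (nq m n) *m (alpha m n t w)^T
  + Ac m n w *m (F m t%:Z w)^T *m (Ar m n w)^T + (E m n t%:Z w)^T.
Proof.
rewrite /Y /C !raddfD /= linearZ /= !trmx_mul !trmxK mulmxA.
by rewrite -!addrA; congr (_ + _); rewrite addrCA.
Qed.

Lemma mu_hat_tr n t w : mu_hat m n t w =
  ((ones R (nq m n))^T *m (Y m n t w)^T *m ones R (np m n)) 0 0 /
    ((nq m n)%:R * (np m n)%:R).
Proof.
rewrite /mu_hat [X in _ / X]mulrC; congr (_ / _).
by rewrite -[in LHS](trmxK (_ *m ones R (nq m n))) mxE !trmx_mul trmxK mulmxA.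
Qed.

Lemma FZ_tr n t w : (FZ m n t w)^T =
  Zhalf (Ac m n w) *m (F m t%:Z w)^T *m Zhalf (Ar m n w).
Proof. by rewrite /FZ !trmx_mul !Zhalf_tr mulmxA. Qed.

Hypothesis p_oo : np m @ \oo --> \oo.
Hypothesis q_oo : nq m @ \oo --> \oo.
Hypothesis hcentering : assume_centering P m.

Lemma L_hat_centered n : (0 < np m n)%N -> (0 < nq m n)%N -> {ae P, forall w,
  [/\ (ones R (np m n))^T *m Ar m n w = 0, (ones R (nq m n))^T *m Ac m n w = 0 &
     forall t : nat, (1 <= t <= nT m n)%N ->
       L_hat m n t w = Ar m n w *m F m t%:Z w *m (Ac m n w)^T +
       centering_mx R (np m n) *m E m n t%:Z w *m centering_mx R (nq m n)]}.
Proof.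
move=> pn qn; apply: filterS (hcentering n) => w [hab hA hB]; split => // t ht.
by have [ha hb] := hab t ht; rewrite /L_hat /Y /C; exact: centered_data.
Qed.

Variables (X : finType) (Z : finType) (Xf : int -> X -> Z -> Om -> R) (c k4 hi CA : R).
Hypothesis NM : \forall n \near \oo,
  noise_shape P c k4 hi CA Xf (fun t i j w => E m n t w i j).
Variable t : nat -> nat.
Hypothesis ht : \forall n \near \oo, (1 <= t n <= nT m n)%N.

Let inrange : \forall n \near \oo, [/\ (0 < np m n)%N, (0 < nq m n)%N &
  {ae P, forall w, [/\ (ones R (np m n))^T *m alpha m n (t n) w = 0,
   (ones R (nq m n))^T *m beta m n (t n) w = 0,
   (ones R (np m n))^T *m Ar m n w = 0 & (ones R (nq m n))^T *m Ac m n w = 0]}].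
Proof.
have p0 : \forall n \near \oo, (0 < np m n)%N by exact: (p_oo (nbhs_infty_gt 0)).
have q0 : \forall n \near \oo, (0 < nq m n)%N by exact: (q_oo (nbhs_infty_gt 0)).
case: (filterI p0 (filterI q0 ht)) => N _ hN; exists N => // n /hN [pn [qn tn]].
split => //; apply: filterS (hcentering n) => w [hab hA hB].
by have [ha hb] := hab _ tn.
Qed.

Lemma mu_hat_rate : stochO P (fun n w => (mu_hat m n (t n) w - mu m n (t n) w) ^+ 2)
  (fun n => (np m n)%:R^-1 * (nq m n)%:R^-1).
Proof.
apply: stochO_le_ae (grand_mean_rate (fun n => (t n)%:Z) p_oo q_oo NM).
case: inrange => N _ hN; exists N => // n /hN [pn qn hae].
apply: filterS hae => w [ha hb hA hB].
by rewrite /mu_hat /Y /C grand_mean_error.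
Qed.

Lemma alpha_hat_rate : stochO P (fun n w => (np m n)%:R^-1 *
    normF (alpha_hat m n (t n) w - alpha m n (t n) w) ^+ 2)
  (fun n => (nq m n)%:R^-1).
Proof.
apply: stochO_le_ae (main_effect_rate (fun n => (t n)%:Z) p_oo q_oo NM).
case: inrange => N _ hN; exists N => // n /hN [pn qn hae].
apply: filterS hae => w [ha hb hA hB].
rewrite normF_sqr ger0_norm; last by rewrite mulr_ge0 ?invr_ge0 ?fsq_ge0.
rewrite ger0_norm; last by rewrite mulr_ge0 ?invr_ge0 // sumr_ge0 // => i _; exact: sqr_ge0.
rewrite ler_wpM2l ?invr_ge0 //.
by rewrite /alpha_hat /mu_hat /Y /C main_effect_error // main_effect_error_le.
Qed.

Lemma beta_hat_rate : stochO P (fun n w => (nq m n)%:R^-1 *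
    normF (beta_hat m n (t n) w - beta m n (t n) w) ^+ 2)
  (fun n => (np m n)%:R^-1).
Proof.
have NM' : \forall n \near \oo, noise_shape P c k4 hi CA (fun t b a => Xf t a b)
    (fun t j i w => (E m n t w)^T j i).
  case: NM => N _ hN; exists N => // n /hN /noise_shape_tr.
  congr (noise_shape P c k4 hi CA _ _); apply/funext => s; apply/funext => j.
  by apply/funext => i; apply/funext => w; rewrite mxE.
apply: stochO_le_ae (main_effect_rate (fun n => (t n)%:Z) q_oo p_oo NM').
case: inrange => N _ hN; exists N => // n /hN [pn qn hae].
apply: filterS hae => w [ha hb hA hB].
rewrite normF_sqr ger0_norm; last by rewrite mulr_ge0 ?invr_ge0 ?fsq_ge0.
rewrite ger0_norm; last by rewrite mulr_ge0 ?invr_ge0 // sumr_ge0 // => i _; exact: sqr_ge0.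
rewrite ler_wpM2l ?invr_ge0 //.
by rewrite /beta_hat mu_hat_tr Y_tr main_effect_error // main_effect_error_le.
Qed.

End Assembly.

Unset Implicit Arguments.
Theorem theorem2 (R : realType) (d : measure_display) (Om : measurableType d)
    (P : probability Om R) (kr kc : nat) (kr_gt0 : (0 < kr)%N)
    (kc_gt0 : (0 < kc)%N) (m : mefm R Om kr kc) (dr dc : nat -> R)
    (T_oo : nT m @ \oo --> \oo) (p_oo : np m @ \oo --> \oo)
    (q_oo : nq m @ \oo --> \oo)
    (hcentering : assume_centering P m) (hmixing : assume_mixing P m) (hfactor : assume_factor P m)
    (hloading : assume_loading P m dr dc)
    (hnoise_decomposition : assume_noise_decomposition P m)
    (hnoise_dynamics : assume_noise_dynamics P m) (hrate : assume_rate m dr dc)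
    (Qr_hat : forall n, Om -> 'M[R]_(np m n, kr)) (Dr_hat : nat -> Om -> 'rV[R]_kr)
    (Qc_hat : forall n, Om -> 'M[R]_(nq m n, kc)) (Dc_hat : nat -> Om -> 'rV[R]_kc)
    (hQr : \forall n \near \oo, forall w,
       leading_eigen (Sr_hat m n w) (Qr_hat n w) (Dr_hat n w))
    (hQc : \forall n \near \oo, forall w,
       leading_eigen (Sc_hat m n w) (Qc_hat n w) (Dc_hat n w)) :
  [/\ forall t : nat -> nat, (\forall n \near \oo, (1 <= t n <= nT m n)%N) ->
        [/\ stochO P (fun n w => (mu_hat m n (t n) w - mu m n (t n) w) ^+ 2)
              (fun n => (np m n)%:R^-1 * (nq m n)%:R^-1),
            stochO P (fun n w => (np m n)%:R^-1 *
                normF (alpha_hat m n (t n) w - alpha m n (t n) w) ^+ 2)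
              (fun n => (nq m n)%:R^-1) &
            stochO P (fun n w => (nq m n)%:R^-1 *
                normF (beta_hat m n (t n) w - beta m n (t n) w) ^+ 2)
              (fun n => (np m n)%:R^-1)],
      stochO P (fun n w => (np m n)%:R^-1 *
          normF (Qr_hat n w - Qr m n w *m
                 (Hr m n w (Qr_hat n w) (Dr_hat n w))^T) ^+ 2)
        (fun n =>
          (nT m n)%:R^-1 * (np m n)%:R `^ (1 - 2 * dr kr)
            * (nq m n)%:R `^ (1 - 2 * dc 1%N)
          + (np m n)%:R `^ (- (2 * dr kr))
            * (nq m n)%:R `^ (2 * (1 - dc 1%N))) &
      stochO P (fun n w => (nq m n)%:R^-1 *
          normF (Qc_hat n w - Qc m n w *m
                 (Hc m n w (Qc_hat n w) (Dc_hat n w))^T) ^+ 2)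
        (fun n =>
          (nT m n)%:R^-1 * (nq m n)%:R `^ (1 - 2 * dc kc)
            * (np m n)%:R `^ (1 - 2 * dr 1%N)
          + (nq m n)%:R `^ (- (2 * dc kc))
            * (np m n)%:R `^ (2 * (1 - dr 1%N)))].

Proof.
have [c [k4 [k4' [hi [CA [FM NM]]]]]] := mefm_shapes hfactor hnoise_decomposition hnoise_dynamics.
have [loadr loadc indl] := hloading.
have [r1 r2 r3 r4] := hrate.
(* The generators are hidden behind an existential, so that the same pair serves the rows and, after
   transposition, the columns. *)
have gens n : exists G1 G2 : set (set Om),
    [/\ indep_systems P <<s G1>> <<s G2>>,
        forall i b, mfun_wrt G1 (fun w => Ar m n w i b),
        forall j b, mfun_wrt G1 (fun w => Ac m n w j b),
        forall t l b, mfun_wrt G2 (fun w => F m t w l b) &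
        forall t i j, mfun_wrt G2 (fun w => E m n t w i j)].
  exists (gen_mx (Ar m n) `|` gen_mx (Ac m n)), (gen_proc (F m) `|` gen_proc (E m n)).
  split; first exact: indl.
  - by move=> i b; apply: gen_mx_mfun => A; left.
  - by move=> i b; apply: gen_mx_mfun => A; right.
  - by move=> t i b; apply: gen_proc_mfun => A; left.
  - by move=> t i b; apply: gen_proc_mfun => A; right.
split.
- move=> t ht; split.
  + exact: (mu_hat_rate p_oo q_oo hcentering NM ht).
  + exact: (alpha_hat_rate p_oo q_oo hcentering NM ht).
  + exact: (beta_hat_rate p_oo q_oo hcentering NM ht).
- apply: (row_rate kr_gt0 kc_gt0 T_oo p_oo q_oo loadr loadc FM NM _ _ hQr r1 r2).
  + by move=> n; have [G1 [G2 [h1 h2 h3 h4 h5]]] := gens n; exists G1, G2.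
  + by move=> n pn qn; exact: L_hat_centered.
(* The columns: all hypotheses of [row_rate] are restated for the transposed processes, with the
   centered data transposed too. *)
- have trE p q (Z : int -> Om -> 'M[R]_(p, q)) :
      (fun t j i w => (Z t w)^T j i) = (fun t j i w => Z t w i j).
    apply/funext => s; apply/funext => j; apply/funext => i.
    by apply/funext => w; rewrite mxE.
  have FM' : factor_model P c k4 (fun t l b w => (F m t w)^T l b)
      (fun t l b w => (Xf m t w)^T l b) (a_f m).
    by rewrite !trE; exact: factor_model_tr FM.
  have NM' : \forall n \near \oo, noise_shape P c k4' hi CA
      (fun t l b w => (Xf m t w)^T l b) (fun t i j w => (E m n t w)^T i j).
    by case: NM => N _ hN; exists N => // n /hN; rewrite !trE; exact: noise_shape_tr.
  have hQ : \forall n \near \oo, forall w, leading_eigen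
      ((nT m n)%:R^-1 *: \sum_(1 <= t < (nT m n).+1)
         (L_hat m n t w)^T *m ((L_hat m n t w)^T)^T) (Qc_hat n w) (Dc_hat n w).
    case: hQc => N _ hN; exists N => // n /hN h w.
    by under eq_bigr do rewrite trmxK; exact: h.
  have := row_rate (L := fun n t w => (L_hat m n t w)^T)
    kc_gt0 kr_gt0 T_oo q_oo p_oo loadc loadr FM' NM' _ _ hQ r3 r4.
  have hi' n : exists G1 G2 : set (set Om),
    [/\ indep_systems P <<s G1>> <<s G2>>,
        forall i b, mfun_wrt G1 (fun w => Ar m n w i b),
        forall t l b, mfun_wrt G2 (fun w => (F m t w)^T l b) &
        forall t i j, mfun_wrt G2 (fun w => (E m n t w)^T i j)].
    have [G1 [G2 [h1 h2 h3 h4 h5]]] := gens n; exists G1, G2; split => //.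
    + move=> t l b; rewrite (_ : (fun w => _) = (fun w => F m t w b l)) //.
      by apply/funext => w; rewrite mxE.
    + move=> t l b; rewrite (_ : (fun w => _) = (fun w => E m n t w b l)) //.
      by apply/funext => w; rewrite mxE.
  move=> /(_ hi') h; apply: (stochO_le_ae _ (h _)); last first.
    move=> n qn pn; apply: filterS (L_hat_centered hcentering pn qn) => w [hA hB hL].
    split => // t /hL ->; rewrite raddfD /= !trmx_mul !centering_sym !trmxK.
    by rewrite !mulmxA.
  (* The two normalised errors are equal for every n and w: [Hc] is the rotation that [row_rate]
     builds from the transposed factors. *)
  exists 0%N => // n _; apply/aeW => w.
  rewrite /Hc /Qc /Qr.
  rewrite le_eqVlt; apply/orP; left; apply/eqP.
  congr (`|_ * normF (_ - _ *m (_ *: (_ *m _))^T) ^+ 2|).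
  by apply: eq_bigr => t _; rewrite -FZ_tr trmxK.
Qed.
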